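(* Let $\nu_0\ge0$ be an integer, $m$ a fixed positive integer, $b>1$ and $\sigma_1,\ldots,\sigma_m>0$. Let $K_N$ be the kernel (case $r=0$) defined in the context with $$a_j=\sigma_j\,b/(b-1),\quad j=1,\ldots,m,\qquad\text{and}\qquad a_k=bN,\quad k=m+1,\ldots,N.$$ Then, for $\xi,\eta>0$, $$\lim_{N\to\infty}e^{(1-\frac1b)(\eta-\xi)}\Big(1-\frac1b\Big)K_N\Big(\Big(1-\frac1b\Big)\xi,\Big(1-\frac1b\Big)\eta\Big)$$ $$=\frac{1}{2\pi i}\frac{\eta^{\nu_0}}{(\Gamma(\nu_0+1))^2}\int_0^\infty du\int_{\mathcal{C}}dv\;{}_0F_1(\nu_0+1;-u\xi)\;{}_0F_1(\nu_0+1;-v\eta)\,u^{\nu_0}\,\frac{e^{-u+v}}{u-v}\prod_{j=1}^m\frac{u+\sigma_j}{v+\sigma_j},$$ where $\mathcal{C}$ is a counterclockwise contour encircling $-\sigma_1,\ldots,-\sigma_m$ but not $u$.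
   Context: ${}_0F_1$ denotes the hypergeometric function. For $a_1,\ldots,a_N>0$ the kernel is $$K_N(x,y)=\frac{1}{2\pi i}\int_0^\infty du\int_{\mathcal{C}'}dv\,u^{\nu_0}e^{-u+v}\,\Psi(u;x)\,\Phi(v;y)\,\frac{1}{u-v}\prod_{l=1}^N\frac{u+a_l}{v+a_l},$$ where $\mathcal{C}'$ is a counterclockwise contour encircling $-a_1,\ldots,-a_N$ but not $u$, and $$\Psi(u;x)=\frac{1}{\Gamma(\nu_0+1)}e^{x}\,{}_0F_1(\nu_0+1;-ux),\qquad \Phi(v;y)=\frac{1}{\Gamma(\nu_0+1)}y^{\nu_0}e^{-y}\,{}_0F_1(\nu_0+1;-vy).$$ *)

(* Defs.v *)
From Stdlib Require Import Reals List Factorial.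
From Coquelicot Require Export Coquelicot.
Open Scope R_scope.

Definition Cexp (z : C) : C :=
  (exp (Re z) * cos (Im z), exp (Re z) * sin (Im z)).

Definition CSeries (a : nat -> C) : C :=
  (Series (fun k => Re (a k)), Series (fun k => Im (a k))).

Fixpoint pochhammer (c : R) (k : nat) : R :=
  match k with
  | O => 1
  | S k' => pochhammer c k' * (c + INR k')
  end.

(* 0F1(c; z) = sum_k z^k / ((c)_k k!) *)
Definition hyp0F1 (c : R) (z : C) : C :=
  CSeries (fun k => (z ^ k / RtoC (pochhammer c k * INR (fact k)))%C).

Definition Gamma (x : R) : R :=
  RInt_gen (fun t => Rpower t (x - 1) * exp (- t))
           (at_right 0) (Rbar_locally p_infty).

(* The product of f 1, ..., f n. *)
Fixpoint Cprod (f : nat -> C) (n : nat) : C :=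
  match n with
  | O => RtoC 1
  | S n' => (Cprod f n' * f (S n'))%C
  end.

(** A piecewise C^1 path is the list of its successive C^1 arcs, each
    parametrised by [0, 1]. Only the restriction of an arc to [0, 1] matters;
    the two-sided derivatives asked for at 0 and 1 are no loss of generality,
    because a C^1 map on [0, 1] extends to a C^1 map on R. *)
Definition path : Type := list (R -> C).

Definition velocity (g : R -> C) (t : R) : C :=
  (Derive (fun s => Re (g s)) t, Derive (fun s => Im (g s)) t).

Definition C1_arc (g : R -> C) : Prop :=
  forall t, 0 <= t <= 1 ->
    ex_derive (fun s => Re (g s)) t /\
    ex_derive (fun s => Im (g s)) t /\
    continuous (velocity g) t.

(* The index i + 1 is taken modulo the length, so the last arc ends where the
   first one starts. *)
Definition closed_contour (p : path) : Prop :=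
  (forall g, In g p -> C1_arc g) /\
  (forall i, (i < length p)%nat ->
     nth i p (fun _ => RtoC 0) 1 =
     nth (S i mod length p) p (fun _ => RtoC 0) 0).

Definition arc_integral (f : C -> C) (g : R -> C) : C :=
  RInt (V := C_R_CompleteNormedModule)
       (fun t => (f (g t) * velocity g t)%C) 0 1.

Definition contour_integral (f : C -> C) (p : path) : C :=
  fold_right Cplus (RtoC 0) (map (arc_integral f) p).

Definition two_pi_i : C := (RtoC (2 * PI) * Ci)%C.

Definition on_path (p : path) (z : C) : Prop :=
  exists g t, In g p /\ 0 <= t <= 1 /\ g t = z.

Definition winding_number (p : path) (z : C) : C :=
  (contour_integral (fun v => / (v - z)) p / two_pi_i)%C.

(* Once, and counterclockwise. *)
Definition encircles (p : path) (z : C) : Prop :=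
  ~ on_path p z /\ winding_number p z = RtoC 1.

Definition leaves_outside (p : path) (z : C) : Prop :=
  ~ on_path p z /\ winding_number p z = RtoC 0.

(** p is a counterclockwise contour encircling -a_1, ..., -a_n but none of the
    points u of the integration domain [0, oo) of the outer integral. *)
Definition contour_around (n : nat) (a : nat -> R) (p : path) : Prop :=
  closed_contour p /\
  (forall l, (1 <= l <= n)%nat -> encircles p (RtoC (- a l))) /\
  (forall u : R, 0 <= u -> leaves_outside p (RtoC u)).

(* Improper integral over [0, oo) of a complex-valued function. *)
Definition integral_0_oo (f : R -> C) : C :=
  RInt_gen (V := C_R_CompleteNormedModule) f
           (at_point 0) (Rbar_locally p_infty).

Definition Psi (nu0 : nat) (u : C) (x : R) : C :=
  (RtoC (/ Gamma (INR nu0 + 1) * exp x)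
   * hyp0F1 (INR nu0 + 1) (- (u * RtoC x)))%C.

Definition Phi (nu0 : nat) (v : C) (y : R) : C :=
  (RtoC (/ Gamma (INR nu0 + 1) * y ^ nu0 * exp (- y))
   * hyp0F1 (INR nu0 + 1) (- (v * RtoC y)))%C.

(** The kernel K_N for the parameters a_1, ..., a_N (a 0 is unused), with inner
    contour p. *)
Definition kernel (nu0 N : nat) (a : nat -> R) (p : path) (x y : R) : C :=
  (/ two_pi_i *
   integral_0_oo (fun u =>
     contour_integral (fun v =>
       RtoC u ^ nu0 * Cexp (- RtoC u + v) * Psi nu0 (RtoC u) x * Phi nu0 v y
       * / (RtoC u - v)
       * Cprod (fun l => (RtoC u + RtoC (a l)) / (v + RtoC (a l))) N) p))%C.

Definition spiked (m : nat) (b : R) (sigma : nat -> R) (N : nat) : nat -> R :=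
  fun j => if Nat.leb j m then sigma j * b / (b - 1) else b * INR N.

(* Main.v *)
Require Import Defs.
From Stdlib Require Import Reals Lra Lia List Factorial.
From Coquelicot Require Import Coquelicot.
Open Scope R_scope.

(** Rescale both variables by [k = 1 - 1/b]. The poles in [w] are then the
    [-sigma_j] and a pole of order [N - m] at [-(b - 1) N], and the factor
    [((1 + s / ((b-1) N)) / (1 + w / ((b-1) N)))^(N - m)] tends to
    [e^((s - w) / (b - 1))], which turns [e^((w - s) / k)] into [e^(w - s)]. The
    [N]-th contour is homologous, off the poles, to the limit contour plus the
    circle of radius [k N] about [-(b - 1) N]. On the circle the integrand is
    [O((b e^(1 - b))^N)] up to the subexponential growth of [0F1], hence negligible as
    [b > 1]; on the limit contour it is within [O((1 + s^2) / N)] of its limit.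
    Both errors carry a factor [e^(- s / 2)], so they can be integrated in [s].

    Cauchy's theorem is only needed for an entire function over a product of
    linear factors: approximating the entire function by polynomials and
    splitting off partial fractions reduces it to the winding numbers. *)

(** * Calculus for functions from R to C *)

(** The contours given for the kernels may vary arbitrarily with [N], so no uniform estimate holds
    on them. They have to be exchanged exactly, for every [s >= 0], for contours under control, and
    winding numbers are the only information available; Cauchy's theorem is therefore needed in
    homological form.

    The outer integral runs over a half line, where [s / N] is not small. Hence the factor depending
    on [N] is kept as a product of [damping], a function of [s] alone with values in [0, 1], and
    [interest], a function of [w] alone that is compared with 1 only on a fixed path. The Cauchy
    kernel is bounded uniformly in [s] by the positive distance of that path from the half line.

    The radius [k N] is optimal: on a circle of radius [r] about the far pole, the exponential and
    the pole together are essentially of size [exp (r / k) r ^ (- N)] up to factors free of [r],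
    which is minimal at [r = k N]. The minimum decays because [ln b < b - 1]; half of this rate is
    spent on [0F1], whose argument has size [N] there. *)

Definition Ccont (f : R -> C) (t : R) : Prop :=
  continuous (fun s => Re (f s)) t /\ continuous (fun s => Im (f s)) t.

(** Derivatives are taken only in a real parameter, along arcs: no notion of complex derivative
    enters the development. *)
Definition is_Cderive (f : R -> C) (t : R) (l : C) : Prop :=
  is_derive (fun s => Re (f s)) t (Re l) /\
  is_derive (fun s => Im (f s)) t (Im l).

Definition is_CInt (f : R -> C) (a b : R) (l : C) : Prop :=
  is_RInt (V := C_R_NormedModule) f a b l.

Lemma C_eq (x y : C) : Re x = Re y -> Im x = Im y -> x = y.
Proof. destruct x, y; simpl; intros; subst; reflexivity. Qed.

Lemma Cmod_triangle_sub (x y : C) : Cmod (x - y) <= Cmod x + Cmod y.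
Proof.
  unfold Cminus. eapply Rle_trans; [apply Cmod_triangle|].
  rewrite Cmod_opp. lra.
Qed.

Lemma im_le_Cmod (x : C) : Rabs (Im x) <= Cmod x.
Proof.
  eapply Rle_trans; [|apply Rmax_Cmod]. apply Rmax_r.
Qed.

Lemma Cmod_le_abs (x : C) : Cmod x <= Rabs (Re x) + Rabs (Im x).
Proof.
  replace x with (RtoC (Re x) + Ci * RtoC (Im x))%C.
  2: apply C_eq; simpl; ring.
  eapply Rle_trans; [apply Cmod_triangle|].
  rewrite Cmod_mult, Cmod_Ci, !Cmod_R. simpl.
  replace (Re x + (0 * Im x - 1 * 0)) with (Re x) by ring.
  replace (0 + (0 * 0 + 1 * Im x)) with (Im x) by ring. lra.
Qed.

Lemma Cmod_sub_sym (x y : C) : Cmod (x - y) = Cmod (y - x).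
Proof. rewrite <- Cmod_opp. f_equal. ring. Qed.

Lemma Ccont_ext (f g : R -> C) t : (forall s, f s = g s) -> Ccont f t -> Ccont g t.
Proof.
  intros H [H1 H2]; split.
  - eapply continuous_ext; [|exact H1]. intros; simpl; now rewrite H.
  - eapply continuous_ext; [|exact H2]. intros; simpl; now rewrite H.
Qed.

Lemma Ccont_const (c : C) t : Ccont (fun _ => c) t.
Proof. split; apply continuous_const. Qed.

Lemma Ccont_RtoC (f : R -> R) t : continuous f t -> Ccont (fun s => RtoC (f s)) t.
Proof. split; simpl; [exact H | apply continuous_const]. Qed.

Lemma Ccont_plus (f g : R -> C) t : Ccont f t -> Ccont g t -> Ccont (fun s => f s + g s)%C t.
Proof.
  intros [f1 f2] [g1 g2]; split; simpl.
  - apply (continuous_plus (fun s => Re (f s)) (fun s => Re (g s))); assumption.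
  - apply (continuous_plus (fun s => Im (f s)) (fun s => Im (g s))); assumption.
Qed.

Lemma Ccont_opp (f : R -> C) t : Ccont f t -> Ccont (fun s => - f s)%C t.
Proof.
  intros [f1 f2]; split; simpl.
  - apply (continuous_opp (fun s => Re (f s))); assumption.
  - apply (continuous_opp (fun s => Im (f s))); assumption.
Qed.

Lemma Ccont_minus (f g : R -> C) t : Ccont f t -> Ccont g t -> Ccont (fun s => f s - g s)%C t.
Proof. intros; apply Ccont_plus; [|apply Ccont_opp]; assumption. Qed.

Lemma Ccont_mult (f g : R -> C) t : Ccont f t -> Ccont g t -> Ccont (fun s => f s * g s)%C t.
Proof.
  intros [f1 f2] [g1 g2]; split; simpl.
  - apply (continuous_minus (fun s => Re (f s) * Re (g s)) (fun s => Im (f s) * Im (g s))).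
    + apply (continuous_mult (fun s => Re (f s)) (fun s => Re (g s))); assumption.
    + apply (continuous_mult (fun s => Im (f s)) (fun s => Im (g s))); assumption.
  - apply (continuous_plus (fun s => Re (f s) * Im (g s)) (fun s => Im (f s) * Re (g s))).
    + apply (continuous_mult (fun s => Re (f s)) (fun s => Im (g s))); assumption.
    + apply (continuous_mult (fun s => Im (f s)) (fun s => Re (g s))); assumption.
Qed.

Lemma Cnorm2_neq0 (z : C) : z <> 0%C -> Re z ^ 2 + Im z ^ 2 <> 0.
Proof.
  intros H E. apply H. destruct z as [x y]; simpl in *.
  assert (x = 0) by nra. assert (y = 0) by nra. subst; reflexivity.
Qed.

Lemma Ccont_inv (f : R -> C) t : f t <> 0%C -> Ccont f t -> Ccont (fun s => / f s)%C t.
Proof.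
  intros H [f1 f2]. apply Cnorm2_neq0 in H.
  assert (D : continuous (fun s => / (Re (f s) ^ 2 + Im (f s) ^ 2)) t).
  { apply (continuous_comp (fun s => Re (f s) ^ 2 + Im (f s) ^ 2) Rinv).
    - apply (continuous_plus (fun s => Re (f s) ^ 2) (fun s => Im (f s) ^ 2)); simpl.
      + apply (continuous_mult (fun s => Re (f s)) (fun s => Re (f s) * 1)); [assumption|].
        apply (continuous_mult (fun s => Re (f s)) (fun s => 1)); [assumption|apply continuous_const].
      + apply (continuous_mult (fun s => Im (f s)) (fun s => Im (f s) * 1)); [assumption|].
        apply (continuous_mult (fun s => Im (f s)) (fun s => 1)); [assumption|apply continuous_const].
    - apply continuity_pt_filterlim.
      apply continuity_pt_inv; [apply continuity_pt_id|exact H]. }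
  split.
  - apply (continuous_mult (fun s => Re (f s)) (fun s => / (Re (f s) ^ 2 + Im (f s) ^ 2))); assumption.
  - apply (continuous_mult (fun s => - Im (f s)) (fun s => / (Re (f s) ^ 2 + Im (f s) ^ 2))); [|assumption].
    apply (continuous_opp (fun s => Im (f s))); assumption.
Qed.

Lemma continuous_eps (f : R -> R) t :
  continuous f t <->
  forall eps, 0 < eps -> exists d, 0 < d /\ forall s, Rabs (s - t) < d -> Rabs (f s - f t) < eps.
Proof.
  split.
  - intros H eps He.
    destruct (proj1 (filterlim_locally _ _) H (mkposreal eps He)) as [d Hd].
    exists d; split; [apply cond_pos|]. intros s Hs. apply Hd. exact Hs.
  - intros H. apply filterlim_locally. intros eps.
    destruct (H eps (cond_pos eps)) as (d & Hd & H').
    exists (mkposreal d Hd). intros y Hy. apply H'. exact Hy.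
Qed.

Lemma Ccont_eps (f : R -> C) t :
  Ccont f t <->
  forall eps, 0 < eps -> exists d, 0 < d /\ forall s, Rabs (s - t) < d -> Cmod (f s - f t) < eps.
Proof.
  unfold Ccont. rewrite !continuous_eps. split.
  - intros [H1 H2] eps He.
    destruct (H1 (eps / 2)) as (d1 & Hd1 & K1); [lra|].
    destruct (H2 (eps / 2)) as (d2 & Hd2 & K2); [lra|].
    exists (Rmin d1 d2); split; [now apply Rmin_glb_lt|].
    intros s Hs. eapply Rle_lt_trans; [apply Cmod_le_abs|].
    assert (A1 := K1 s (Rlt_le_trans _ _ _ Hs (Rmin_l _ _))).
    assert (A2 := K2 s (Rlt_le_trans _ _ _ Hs (Rmin_r _ _))).
    destruct (f s), (f t); simpl in *. unfold Rminus in *. lra.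
  - intros H; split; intros eps He; destruct (H eps He) as (d & Hd & K);
      exists d; (split; [assumption|]); intros s Hs; specialize (K s Hs);
      eapply Rle_lt_trans; [|exact K| |exact K].
    + eapply Rle_trans; [|apply re_le_Cmod]. destruct (f s), (f t); simpl; right; reflexivity.
    + eapply Rle_trans; [|apply im_le_Cmod]. destruct (f s), (f t); simpl; right; reflexivity.
Qed.

Lemma Ccont_Cmod (f : R -> C) t : Ccont f t -> continuous (fun s => Cmod (f s)) t.
Proof.
  rewrite Ccont_eps, continuous_eps. intros H eps He.
  destruct (H eps He) as (d & Hd & K). exists d; split; [assumption|].
  intros s Hs. eapply Rle_lt_trans; [|exact (K s Hs)].
  apply Rabs_le; split.
  - assert (A := Cmod_triangle (f s - f t) (- f s)).
    replace (f s - f t + - f s)%C with (- f t)%C in A by ring. rewrite !Cmod_opp in A. lra.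
  - assert (A := Cmod_triangle (f s - f t) (f t)).
    replace (f s - f t + f t)%C with (f s)%C in A by ring. lra.
Qed.

Lemma Ccont_continuous (f : R -> C) t :
  Ccont f t <-> continuous (U := C_R_CompleteNormedModule) f t.
Proof.
  split.
  - intros [H1 H2]. apply filterlim_locally. intros eps.
    assert (K1 := proj1 (filterlim_locally _ _) H1 eps).
    assert (K2 := proj1 (filterlim_locally _ _) H2 eps).
    generalize (filter_and _ _ K1 K2). apply filter_imp. intros x [A B]. split; assumption.
  - intros H. split; apply filterlim_locally; intros eps;
    generalize (proj1 (filterlim_locally _ _) H eps); apply filter_imp; intros x [A B]; assumption.
Qed.

Lemma is_Cderive_cont (f : R -> C) t l : is_Cderive f t l -> Ccont f t.
Proof.
  intros [H1 H2]; split; apply (@ex_derive_continuous R_AbsRing R_NormedModule); eexists; eassumption.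
Qed.

Lemma is_Cderive_ext (f g : R -> C) t l :
  (forall s, f s = g s) -> is_Cderive f t l -> is_Cderive g t l.
Proof.
  intros H [H1 H2]; split.
  - eapply is_derive_ext; [|exact H1]. intros; simpl; now rewrite H.
  - eapply is_derive_ext; [|exact H2]. intros; simpl; now rewrite H.
Qed.

Lemma is_Cderive_const (c : C) t : is_Cderive (fun _ => c) t 0%C.
Proof. split; apply (@is_derive_const R_AbsRing R_NormedModule). Qed.

Lemma is_Cderive_plus (f g : R -> C) t lf lg :
  is_Cderive f t lf -> is_Cderive g t lg -> is_Cderive (fun s => f s + g s)%C t (lf + lg)%C.
Proof.
  intros [f1 f2] [g1 g2]; split; simpl.
  - apply (@is_derive_plus R_AbsRing R_NormedModule (fun s => Re (f s)) (fun s => Re (g s))); assumption.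
  - apply (@is_derive_plus R_AbsRing R_NormedModule (fun s => Im (f s)) (fun s => Im (g s))); assumption.
Qed.

Lemma is_derive_eq (f : R -> R) t l l' : is_derive f t l -> l = l' -> is_derive f t l'.
Proof. intros H <-. exact H. Qed.

Lemma is_Cderive_mult (f g : R -> C) t lf lg :
  is_Cderive f t lf -> is_Cderive g t lg ->
  is_Cderive (fun s => f s * g s)%C t (lf * g t + f t * lg)%C.
Proof.
  intros [f1 f2] [g1 g2]; split; simpl.
  - assert (A := is_derive_mult _ _ t _ _ f1 g1 Rmult_comm).
    assert (B := is_derive_mult _ _ t _ _ f2 g2 Rmult_comm).
    assert (D := is_derive_minus _ _ t _ _ A B).
    refine (is_derive_eq _ _ _ _ D _). unfold minus, plus, opp, mult; simpl. unfold Re, Im. ring.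
  - assert (A := is_derive_mult _ _ t _ _ f1 g2 Rmult_comm).
    assert (B := is_derive_mult _ _ t _ _ f2 g1 Rmult_comm).
    assert (D := is_derive_plus _ _ t _ _ A B).
    refine (is_derive_eq _ _ _ _ D _). unfold minus, plus, opp, mult; simpl. unfold Re, Im. ring.
Qed.

(** Real and imaginary parts of [- z' / z ^ 2] for [z = x + i y]. *)
Lemma is_derive_inv_parts (x y : R -> R) t dx dy :
  is_derive x t dx -> is_derive y t dy -> x t ^ 2 + y t ^ 2 <> 0 ->
  is_derive (fun s => x s / (x s ^ 2 + y s ^ 2)) t
    (((y t ^ 2 - x t ^ 2) * dx - 2 * x t * y t * dy) / (x t ^ 2 + y t ^ 2) ^ 2) /\
  is_derive (fun s => - y s / (x s ^ 2 + y s ^ 2)) t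
    (((y t ^ 2 - x t ^ 2) * dy + 2 * x t * y t * dx) / (x t ^ 2 + y t ^ 2) ^ 2).
Proof.
  intros H1 H2 N. split; auto_derive;
    try (repeat split; try (eexists; eassumption); simpl in N; rewrite ?Rmult_1_r in *; exact N);
    change (Derive (fun s => x s) t) with (Derive x t); change (Derive (fun s => y s) t) with (Derive y t);
    rewrite (is_derive_unique _ _ _ H1), (is_derive_unique _ _ _ H2); field;
    simpl in *; rewrite ?Rmult_1_r in *; exact N.
Qed.

Lemma is_Cderive_inv (f : R -> C) t lf :
  f t <> 0%C -> is_Cderive f t lf ->
  is_Cderive (fun s => / f s)%C t (- lf / (f t * f t))%C.
Proof.
  intros H [f1 f2]. assert (N := Cnorm2_neq0 _ H).
  destruct (is_derive_inv_parts _ _ t _ _ f1 f2 N) as [A B].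
  (* This is the squared modulus of [f t ^ 2], the denominator that [field] will meet. *)
  assert (N2 : (Re (f t) ^ 2 - Im (f t) ^ 2) ^ 2 + (2 * Re (f t) * Im (f t)) ^ 2 <> 0).
  { replace (_ + _) with ((Re (f t) ^ 2 + Im (f t) ^ 2) ^ 2) by ring. now apply pow_nonzero. }
  split.
  - refine (is_derive_eq _ _ _ _ A _). destruct (f t) as [p q], lf as [p' q']. simpl in *.
    field. split; intros E; [apply N2|apply N]; rewrite <- E; ring.
  - refine (is_derive_eq _ _ _ _ B _). destruct (f t) as [p q], lf as [p' q']. simpl in *.
    field. split; intros E; [apply N2|apply N]; rewrite <- E; ring.
Qed.

Lemma is_CInt_pair (f : R -> C) a b l :
  is_CInt f a b l <->
  is_RInt (fun t => Re (f t)) a b (Re l) /\ is_RInt (fun t => Im (f t)) a b (Im l).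
Proof.
  split.
  - intros H; split.
    + apply (is_RInt_fct_extend_fst (U:=R_NormedModule) (V:=R_NormedModule) f a b l H).
    + apply (is_RInt_fct_extend_snd (U:=R_NormedModule) (V:=R_NormedModule) f a b l H).
  - intros [H1 H2]. destruct l as [l1 l2].
    apply (is_RInt_fct_extend_pair (U:=R_NormedModule) (V:=R_NormedModule) f a b l1 l2); assumption.
Qed.

Lemma is_CInt_unique (f : R -> C) a b l :
  is_CInt f a b l -> RInt (V := C_R_CompleteNormedModule) f a b = l.
Proof. intros H. apply (is_RInt_unique (V := C_R_CompleteNormedModule)). exact H. Qed.

Lemma is_CInt_ext (f g : R -> C) a b l :
  (forall x, Rmin a b < x < Rmax a b -> f x = g x) -> is_CInt f a b l -> is_CInt g a b l.
Proof. apply is_RInt_ext. Qed.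

Lemma ex_CInt_cont (f : R -> C) a b :
  (forall t, Rmin a b <= t <= Rmax a b -> Ccont f t) -> exists l, is_CInt f a b l.
Proof.
  intros H. apply (ex_RInt_continuous (V := C_R_CompleteNormedModule)).
  intros t Ht. apply Ccont_continuous. auto.
Qed.

Lemma is_CInt_plus (f g : R -> C) a b lf lg :
  is_CInt f a b lf -> is_CInt g a b lg -> is_CInt (fun t => f t + g t)%C a b (lf + lg)%C.
Proof. apply (is_RInt_plus (V := C_R_NormedModule)). Qed.

Lemma is_CInt_scal (c : C) (f : R -> C) a b l :
  is_CInt f a b l -> is_CInt (fun t => c * f t)%C a b (c * l)%C.
Proof.
  rewrite !is_CInt_pair. intros [H1 H2]. split; simpl.
  - apply (is_RInt_minus (V := R_NormedModule) (fun t => fst c * fst (f t)) (fun t => snd c * snd (f t))).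
    + apply (is_RInt_scal (V := R_NormedModule) _ _ _ (fst c)); exact H1.
    + apply (is_RInt_scal (V := R_NormedModule) _ _ _ (snd c)); exact H2.
  - apply (is_RInt_plus (V := R_NormedModule) (fun t => fst c * snd (f t)) (fun t => snd c * fst (f t))).
    + apply (is_RInt_scal (V := R_NormedModule) _ _ _ (fst c)); exact H2.
    + apply (is_RInt_scal (V := R_NormedModule) _ _ _ (snd c)); exact H1.
Qed.

Lemma is_CInt_le (f : R -> C) (g : R -> R) a b lf lg :
  a <= b -> (forall t, a <= t <= b -> Cmod (f t) <= g t) ->
  is_CInt f a b lf -> is_RInt g a b lg -> Cmod lf <= lg.
Proof.
  intros ab H Hf Hg.
  rewrite Cmod_norm. eapply (norm_RInt_le (V := C_R_NormedModule) f g a b lf lg ab); try assumption.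
  intros x Hx. specialize (H x Hx). rewrite Cmod_norm in H. exact H.
Qed.

Lemma is_CInt_le_const (f : R -> C) a b M lf :
  a <= b -> (forall t, a <= t <= b -> Cmod (f t) <= M) ->
  is_CInt f a b lf -> Cmod lf <= (b - a) * M.
Proof.
  intros ab H Hf. apply (is_CInt_le f (fun _ => M) a b lf); try assumption.
  apply (is_RInt_const (V := R_NormedModule)).
Qed.

Lemma is_CInt_derive (F f : R -> C) a b :
  (forall t, Rmin a b <= t <= Rmax a b -> is_Cderive F t (f t)) ->
  (forall t, Rmin a b <= t <= Rmax a b -> Ccont f t) ->
  is_CInt f a b (F b - F a)%C.
Proof.
  intros H1 H2. apply is_CInt_pair. split.
  - apply (is_RInt_derive (V := R_CompleteNormedModule) (fun t => Re (F t)) (fun t => Re (f t)));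
    intros x Hx; [apply H1|apply H2]; assumption.
  - apply (is_RInt_derive (V := R_CompleteNormedModule) (fun t => Im (F t)) (fun t => Im (f t)));
    intros x Hx; [apply H1|apply H2]; assumption.
Qed.

(** * Contour integrals *)

Definition smooth (p : path) : Prop := forall g, In g p -> C1_arc g.

(** Continuity along each arc is all that integrability asks for, and it tolerates poles off the
    path. *)
Definition path_cont (f : C -> C) (p : path) : Prop :=
  forall g t, In g p -> 0 <= t <= 1 -> Ccont (fun s => f (g s)) t.

Lemma closed_smooth p : closed_contour p -> smooth p.
Proof. intros [H _]; exact H. Qed.

Lemma C1_arc_derive g t : C1_arc g -> 0 <= t <= 1 -> is_Cderive g t (velocity g t).
Proof.
  intros H Ht. destruct (H t Ht) as (H1 & H2 & _).
  split; apply Derive_correct; assumption.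
Qed.

Lemma C1_arc_velocity_cont g t : C1_arc g -> 0 <= t <= 1 -> Ccont (velocity g) t.
Proof.
  intros H Ht. destruct (H t Ht) as (_ & _ & H3).
  apply Ccont_continuous. exact H3.
Qed.

Lemma C1_arc_cont g t : C1_arc g -> 0 <= t <= 1 -> Ccont g t.
Proof. intros H Ht. eapply is_Cderive_cont. now apply C1_arc_derive. Qed.

Lemma velocity_unique g t l : is_Cderive g t l -> velocity g t = l.
Proof.
  intros [H1 H2]. apply C_eq; simpl; now apply is_derive_unique.
Qed.

Lemma Ccont_max_on_unit (f : R -> C) :
  (forall t, 0 <= t <= 1 -> Ccont f t) -> exists M, 0 <= M /\ forall t, 0 <= t <= 1 -> Cmod (f t) <= M.
Proof.
  intros H.
  destruct (continuity_ab_maj (fun t => Cmod (f t)) 0 1) as (x & Hx & _); [lra| |].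
  - intros c Hc. apply continuity_pt_filterlim. apply Ccont_Cmod. auto.
  - exists (Cmod (f x)); split; [apply Cmod_ge_0|exact Hx].
Qed.

Lemma arc_integral_correct (f : C -> C) p g :
  smooth p -> path_cont f p -> In g p ->
  is_CInt (fun t => f (g t) * velocity g t)%C 0 1 (arc_integral f g).
Proof.
  intros Hp Hf Hg.
  destruct (ex_CInt_cont (fun t => f (g t) * velocity g t)%C 0 1) as [l Hl].
  - rewrite Rmin_left, Rmax_right by lra. intros t Ht. apply Ccont_mult.
    + now apply (Hf g t).
    + apply C1_arc_velocity_cont; auto.
  - unfold arc_integral. rewrite (is_CInt_unique _ _ _ _ Hl). exact Hl.
Qed.

Lemma smooth_cons g p : smooth (g :: p) -> C1_arc g /\ smooth p.
Proof. intros H; split; [apply H; now left|intros h Hh; apply H; now right]. Qed.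

Lemma path_cont_cons f g p : path_cont f (g :: p) -> path_cont f p.
Proof. intros H h t Hh Ht; apply H; [now right|assumption]. Qed.

Lemma on_path_here g p t : 0 <= t <= 1 -> on_path (g :: p) (g t).
Proof. intros H. exists g, t. repeat split; try apply H. now left. Qed.

Lemma on_path_cons g p v : on_path p v -> on_path (g :: p) v.
Proof. intros (h & t & Hh & H). exists h, t. split; [now right|assumption]. Qed.

Lemma on_path_in p g t : In g p -> 0 <= t <= 1 -> on_path p (g t).
Proof. intros. now exists g, t. Qed.

Lemma contour_integral_ext f h p :
  (forall v, on_path p v -> f v = h v) -> contour_integral f p = contour_integral h p.
Proof.
  intros H. unfold contour_integral. f_equal. apply map_ext_in. intros g Hg.
  unfold arc_integral. apply (RInt_ext (V := C_R_CompleteNormedModule)). rewrite Rmin_left, Rmax_right by lra.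
  intros t Ht. rewrite H; [reflexivity|]. apply on_path_in; [assumption|lra].
Qed.

Lemma path_cont_const c p : path_cont (fun _ => c) p.
Proof. intros g t _ _. apply Ccont_const. Qed.

Lemma path_cont_id p : smooth p -> path_cont (fun v => v) p.
Proof. intros Hp g t Hg Ht. apply (C1_arc_cont g); auto. Qed.

Lemma path_cont_plus f h p : path_cont f p -> path_cont h p -> path_cont (fun v => f v + h v)%C p.
Proof. intros Hf Hh g t Hg Ht. apply Ccont_plus; [now apply Hf|now apply Hh]. Qed.

Lemma path_cont_minus f h p : path_cont f p -> path_cont h p -> path_cont (fun v => f v - h v)%C p.
Proof. intros Hf Hh g t Hg Ht. apply Ccont_minus; [now apply Hf|now apply Hh]. Qed.

Lemma path_cont_mult f h p : path_cont f p -> path_cont h p -> path_cont (fun v => f v * h v)%C p.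
Proof. intros Hf Hh g t Hg Ht. apply Ccont_mult; [now apply Hf|now apply Hh]. Qed.

Lemma path_cont_inv f p :
  path_cont f p -> (forall v, on_path p v -> f v <> 0%C) -> path_cont (fun v => / f v)%C p.
Proof.
  intros Hf H0 g t Hg Ht. apply (Ccont_inv (fun s => f (g s))).
  - apply H0. now apply on_path_in.
  - now apply Hf.
Qed.

Lemma contour_integral_plus f h p :
  smooth p -> path_cont f p -> path_cont h p ->
  contour_integral (fun v => f v + h v)%C p = (contour_integral f p + contour_integral h p)%C.
Proof.
  induction p as [|g p IH]; intros Hp Hf Hh.
  - unfold contour_integral; simpl. ring.
  - assert (Af := arc_integral_correct f _ g Hp Hf (or_introl eq_refl)).
    assert (Ah := arc_integral_correct h _ g Hp Hh (or_introl eq_refl)).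
    unfold contour_integral in *; simpl.
    rewrite IH; [|apply (smooth_cons _ _ Hp)|apply (path_cont_cons _ _ _ Hf)|apply (path_cont_cons _ _ _ Hh)].
    replace (arc_integral (fun v => f v + h v)%C g) with (arc_integral f g + arc_integral h g)%C; [ring|].
    symmetry. apply is_CInt_unique.
    eapply is_CInt_ext; [|apply (is_CInt_plus _ _ _ _ _ _ Af Ah)].
    intros t _; simpl. ring.
Qed.

Lemma contour_integral_scal c f p :
  smooth p -> path_cont f p ->
  contour_integral (fun v => c * f v)%C p = (c * contour_integral f p)%C.
Proof.
  induction p as [|g p IH]; intros Hp Hf.
  - unfold contour_integral; simpl. ring.
  - assert (Af := arc_integral_correct f _ g Hp Hf (or_introl eq_refl)).
    unfold contour_integral in *; simpl.
    rewrite IH; [|apply (smooth_cons _ _ Hp)|apply (path_cont_cons _ _ _ Hf)].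
    replace (arc_integral (fun v => c * f v)%C g) with (c * arc_integral f g)%C; [ring|].
    symmetry. apply is_CInt_unique.
    eapply is_CInt_ext; [|apply (is_CInt_scal c _ _ _ _ Af)].
    intros t _; simpl. ring.
Qed.

Lemma contour_integral_minus f h p :
  smooth p -> path_cont f p -> path_cont h p ->
  contour_integral (fun v => f v - h v)%C p = (contour_integral f p - contour_integral h p)%C.
Proof.
  intros Hp Hf Hh.
  replace (contour_integral f p - contour_integral h p)%C
    with (contour_integral f p + contour_integral (fun v => - (1) * h v) p)%C.
  - rewrite <- contour_integral_plus; try assumption.
    + apply contour_integral_ext. intros; ring.
    + apply path_cont_mult; [apply path_cont_const|assumption].
  - rewrite contour_integral_scal by assumption. ring.
Qed.

(** The sum of the maximal speeds of the arcs bounds the length. [L] is chosen before [f], so that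
    one constant serves all [N] and all [s]. *)
Lemma contour_integral_bound p :
  smooth p -> exists L, 0 <= L /\ forall f M, path_cont f p ->
    (forall v, on_path p v -> Cmod (f v) <= M) -> Cmod (contour_integral f p) <= L * M.
Proof.
  induction p as [|g p IH]; intros Hp.
  - exists 0; split; [lra|]. intros f M _ _. unfold contour_integral; simpl. rewrite Cmod_0. lra.
  - destruct (smooth_cons _ _ Hp) as [Hg Hp'].
    destruct (IH Hp') as (L & HL & IHL).
    destruct (Ccont_max_on_unit (velocity g)) as (V & HV & HVb).
    { intros t Ht. now apply C1_arc_velocity_cont. }
    exists (V + L); split; [lra|]. intros f M Hf HM.
    assert (Af := arc_integral_correct f _ g Hp Hf (or_introl eq_refl)).
    unfold contour_integral in *; simpl.
    eapply Rle_trans; [apply Cmod_triangle|].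
    rewrite Rmult_plus_distr_r. apply Rplus_le_compat.
    + replace (V * M) with ((1 - 0) * (M * V)) by ring.
      eapply is_CInt_le_const; [lra| |exact Af].
      intros t Ht. cbv beta; rewrite Cmod_mult. apply Rmult_le_compat; try apply Cmod_ge_0; auto.
      apply HM. now apply on_path_here.
    + apply IHL; [now apply (path_cont_cons _ g)|]. intros v Hv. apply HM. now apply on_path_cons.
Qed.

(** Telescoping: the list of end points is the list of starting points rotated by one place, so the
    two sums of values of [F] coincide. *)
Lemma closed_contour_boundary (p : path) (F : C -> C) :
  closed_contour p ->
  fold_right Cplus (RtoC 0) (map (fun g => F (g 1) - F (g 0))%C p) = 0%C.
Proof.
  intros [_ H].
  destruct p as [|g0 p]; [reflexivity|].
  assert (E : map (fun g : R -> C => g 1) (g0 :: p) = map (fun g : R -> C => g 0) p ++ (g0 0 :: nil)).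
  { apply (nth_ext _ _ (RtoC 0) (RtoC 0)).
    - rewrite length_app, !length_map. simpl. lia.
    - intros i Hi. rewrite length_map in Hi.
      assert (Hi' := H i Hi). clear H.
      rewrite (map_nth (fun g : R -> C => g 1) (g0 :: p) (fun _ => RtoC 0) i). rewrite Hi'.
      simpl length in *.
      destruct (Nat.eq_dec (S i) (S (length p))) as [e|n].
      + rewrite e, Nat.Div0.mod_same. rewrite app_nth2; rewrite length_map; [|lia].
        replace (i - length p)%nat with O by lia. reflexivity.
      + rewrite Nat.mod_small by lia. rewrite app_nth1 by (rewrite length_map; lia).
        rewrite (map_nth (fun g : R -> C => g 0) p (fun _ => RtoC 0) i). reflexivity. }
  assert (S1 : forall q : path, fold_right Cplus (RtoC 0) (map (fun g => F (g 1) - F (g 0))%C q) =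
    (fold_right Cplus (RtoC 0) (map F (map (fun g => g 1) q)) -
     fold_right Cplus (RtoC 0) (map F (map (fun g => g 0) q)))%C).
  { induction q as [|h q IH]; simpl; [ring|]. rewrite IH. ring. }
  rewrite S1, E.
  assert (S2 : forall (l : list C) a, fold_right Cplus (RtoC 0) (map F (l ++ a :: nil)) =
     (fold_right Cplus (RtoC 0) (map F l) + F a)%C).
  { induction l as [|x l IH]; intros a; simpl; [ring|]. rewrite IH. ring. }
  rewrite S2. simpl. ring.
Qed.

(** Fundamental theorem on each arc, after which the boundary terms cancel. [F] has to be a
    primitive along the arcs only, which admits functions with singularities off the path. *)
Lemma contour_integral_primitive (p : path) (F f : C -> C) :
  closed_contour p -> path_cont f p ->
  (forall g t, In g p -> 0 <= t <= 1 ->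
     is_Cderive (fun s => F (g s)) t (f (g t) * velocity g t)%C) ->
  contour_integral f p = 0%C.
Proof.
  intros Hp Hf HF. rewrite <- (closed_contour_boundary p F Hp).
  unfold contour_integral. f_equal. apply map_ext_in. intros g Hg.
  apply is_CInt_unique.
  apply (is_CInt_derive (fun s => F (g s)) (fun t => f (g t) * velocity g t)%C);
    rewrite Rmin_left, Rmax_right by lra; intros t Ht.
  - now apply HF.
  - apply Ccont_mult; [now apply Hf|]. apply C1_arc_velocity_cont; [|assumption].
    now apply (closed_smooth p Hp).
Qed.

(** Compactness of the arcs; for the empty path every positive number will do. *)
Lemma path_lower_bound (p : path) (phi : C -> R) :
  (forall g t, In g p -> 0 <= t <= 1 -> continuous (fun s => phi (g s)) t) ->
  (forall v, on_path p v -> 0 < phi v) ->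
  exists d, 0 < d /\ forall v, on_path p v -> d <= phi v.
Proof.
  induction p as [|g p IH]; intros Hc Hpos.
  - exists 1; split; [lra|]. intros v (h & t & [] & _).
  - destruct IH as (d & Hd & Hdb).
    { intros h t Hh Ht. apply Hc; [now right|assumption]. }
    { intros v Hv. apply Hpos. now apply on_path_cons. }
    destruct (continuity_ab_min (fun t => phi (g t)) 0 1) as (x & Hx & Hx01); [lra| |].
    { intros c Hcc. apply continuity_pt_filterlim. apply Hc; [now left|assumption]. }
    exists (Rmin d (phi (g x))); split.
    + apply Rmin_glb_lt; [assumption|]. apply Hpos. now apply on_path_here.
    + intros v (h & t & [<-|Hh] & Ht & <-).
      * eapply Rle_trans; [apply Rmin_r|]. auto.
      * eapply Rle_trans; [apply Rmin_l|]. apply Hdb. now apply on_path_in.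
Qed.

Lemma path_bounded (f : C -> C) (p : path) :
  path_cont f p -> exists M, 0 < M /\ forall v, on_path p v -> Cmod (f v) <= M.
Proof.
  intros Hp.
  (* A positive lower bound for [1 / (1 + |f|)] is an upper bound for [|f|], so the compactness
     argument need not be repeated. *)
  destruct (path_lower_bound p (fun v => / (1 + Cmod (f v)))) as (d & Hd & Hb).
  - intros g t Hg Ht.
    apply (continuous_comp (fun s => 1 + Cmod (f (g s))) Rinv).
    + apply (continuous_plus (fun _ => 1) (fun s => Cmod (f (g s)))); [apply continuous_const|].
      apply (Ccont_Cmod (fun s => f (g s))). now apply Hp.
    + apply continuity_pt_filterlim. apply continuity_pt_inv; [apply continuity_pt_id|].
      assert (A := Cmod_ge_0 (f (g t))). unfold id. lra.
  - intros v _. apply Rinv_0_lt_compat. assert (A := Cmod_ge_0 (f v)). lra.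
  - exists (/ d); split; [now apply Rinv_0_lt_compat|]. intros v Hv. specialize (Hb v Hv).
    assert (A := Cmod_ge_0 (f v)).
    apply Rinv_le_contravar in Hb; [|assumption]. rewrite Rinv_inv in Hb. lra.
Qed.

(** * Dilation of contours *)

Definition scale_path (k : R) (p : path) : path :=
  map (fun g t => (RtoC k * g t)%C) p.

Lemma is_Cderive_scal_real k (g : R -> C) t l :
  is_Cderive g t l -> is_Cderive (fun s => RtoC k * g s)%C t (RtoC k * l)%C.
Proof.
  intros H. assert (A := is_Cderive_mult _ _ _ _ _ (is_Cderive_const (RtoC k) t) H).
  replace (RtoC k * l)%C with (0 * g t + RtoC k * l)%C by ring. exact A.
Qed.

Lemma velocity_scale k g t : velocity (fun s => (RtoC k * g s)%C) t = (RtoC k * velocity g t)%C.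
Proof.
  unfold velocity. apply C_eq; simpl.
  - transitivity (Derive (fun s => k * Re (g s)) t).
    + apply Derive_ext. intros s. unfold Re. ring.
    + rewrite Derive_scal. ring.
  - transitivity (Derive (fun s => k * Im (g s)) t).
    + apply Derive_ext. intros s. unfold Im. ring.
    + rewrite Derive_scal. ring.
Qed.

Lemma C1_arc_scale k g : C1_arc g -> C1_arc (fun t => (RtoC k * g t)%C).
Proof.
  intros H t Ht.
  destruct (is_Cderive_scal_real k g t _ (C1_arc_derive g t H Ht)) as [D1 D2].
  split; [|split]; [eexists; exact D1|eexists; exact D2|].
  apply Ccont_continuous.
  apply (Ccont_ext (fun s => RtoC k * velocity g s)%C).
  - intros s. now rewrite velocity_scale.
  - apply Ccont_mult; [apply Ccont_const|]. now apply C1_arc_velocity_cont.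
Qed.

Lemma closed_contour_scale k p : closed_contour p -> closed_contour (scale_path k p).
Proof.
  intros [H1 H2]. split.
  - intros g Hg. apply in_map_iff in Hg. destruct Hg as (h & <- & Hh). apply C1_arc_scale. auto.
  - unfold scale_path. rewrite length_map. intros i Hi.
    (* In range, the default of [nth] may be replaced by its own dilation, the form in which
       [map_nth] applies. *)
    assert (L : forall j, (j < length p)%nat ->
      nth j (map (fun (g : R -> C) t => (RtoC k * g t)%C) p) (fun _ => RtoC 0)
        = (fun t => (RtoC k * nth j p (fun _ => RtoC 0) t)%C)).
    { intros j Hj.
      rewrite (nth_indep _ _ ((fun (g : R -> C) t => (RtoC k * g t)%C) (fun _ => RtoC 0)))
        by (now rewrite length_map).
      now rewrite (map_nth (fun (g : R -> C) t => (RtoC k * g t)%C)). }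
    rewrite !L; [|apply Nat.mod_upper_bound; lia|assumption]. now rewrite H2.
Qed.

Lemma on_path_scale k p v : on_path (scale_path k p) v -> exists w, on_path p w /\ v = (RtoC k * w)%C.
Proof.
  intros (g & t & Hg & Ht & <-). apply in_map_iff in Hg. destruct Hg as (h & <- & Hh).
  exists (h t); split; [now apply on_path_in|reflexivity].
Qed.

Lemma contour_integral_scale k f p :
  contour_integral f (scale_path k p) = contour_integral (fun v => RtoC k * f (RtoC k * v))%C p.
Proof.
  unfold contour_integral, scale_path. rewrite map_map. f_equal. apply map_ext. intros g.
  unfold arc_integral. apply (RInt_ext (V := C_R_CompleteNormedModule)). intros t _.
  rewrite velocity_scale. match goal with |- ?a = ?b => change (@eq C a b) end. ring.
Qed.

(** * Cauchy's theorem *)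

Lemma is_Cderive_eq f t l l' : is_Cderive f t l -> l = l' -> is_Cderive f t l'.
Proof. intros H <-. exact H. Qed.

Lemma is_Cderive_pow (g : R -> C) t l n :
  is_Cderive g t l ->
  is_Cderive (fun s => g s ^ S n)%C t (RtoC (INR (S n)) * g t ^ n * l)%C.
Proof.
  intros H. induction n as [|n IH].
  - apply (is_Cderive_ext g); [intros; simpl; ring|].
    eapply is_Cderive_eq; [exact H|]. simpl. ring.
  - apply (is_Cderive_ext (fun s => g s * g s ^ S n)%C); [intros; reflexivity|].
    eapply is_Cderive_eq; [apply (is_Cderive_mult _ _ _ _ _ H IH)|].
    rewrite (S_INR (S n)), RtoC_plus. simpl. ring.
Qed.

Definition avoids (p : path) (Z : list C) : Prop := forall z, In z Z -> ~ on_path p z.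

Lemma avoids_cons p z Z : avoids p (z :: Z) <-> ~ on_path p z /\ avoids p Z.
Proof.
  split.
  - intros H; split; [apply H; now left|intros w Hw; apply H; now right].
  - intros [H1 H2] w [<-|Hw]; auto.
Qed.

Lemma avoids_neq p z v : ~ on_path p z -> on_path p v -> (v - z)%C <> 0%C.
Proof.
  intros H Hv E. apply H. replace z with v; [assumption|].
  replace v with ((v - z) + z)%C by ring. rewrite E. ring.
Qed.

Definition cauchy_kernel (z v : C) : C := (/ (v - z))%C.

Lemma path_cont_kernel z p : smooth p -> ~ on_path p z -> path_cont (cauchy_kernel z) p.
Proof.
  intros Hp Hz. apply (path_cont_inv (fun v => v - z)%C).
  - apply path_cont_minus; [now apply path_cont_id|apply path_cont_const].
  - intros v Hv. now apply (avoids_neq p).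
Qed.

Lemma path_cont_pow f n p : path_cont f p -> path_cont (fun v => f v ^ n)%C p.
Proof.
  intros H. induction n as [|n IH]; simpl; [apply path_cont_const|].
  now apply (path_cont_mult f (fun v => f v ^ n)%C).
Qed.

Lemma contour_integral_pow n p :
  closed_contour p -> contour_integral (fun v => v ^ n)%C p = 0%C.
Proof.
  intros Hp. assert (Hs := closed_smooth p Hp).
  apply (contour_integral_primitive p (fun v => RtoC (/ INR (S n)) * v ^ S n)%C); [assumption| |].
  - apply (path_cont_pow (fun v => v)). now apply path_cont_id.
  - intros g t Hg Ht.
    eapply is_Cderive_eq.
    + apply is_Cderive_scal_real. apply is_Cderive_pow. apply C1_arc_derive; auto.
    + rewrite !Cmult_assoc, <- RtoC_mult, Rinv_l by (apply not_0_INR; lia). ring.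
Qed.

(** A pole of order at least 2 has the single-valued primitive [- (v - z) ^ (- (n + 1)) / (n + 1)];
    only simple poles can contribute winding numbers. *)
Lemma contour_integral_kernel_pow n z p :
  closed_contour p -> ~ on_path p z ->
  contour_integral (fun v => cauchy_kernel z v ^ S (S n))%C p = 0%C.
Proof.
  intros Hp Hz. assert (Hs := closed_smooth p Hp).
  apply (contour_integral_primitive p (fun v => RtoC (- / INR (S n)) * cauchy_kernel z v ^ S n)%C); [assumption| |].
  - apply (path_cont_pow (cauchy_kernel z)). now apply path_cont_kernel.
  - intros g t Hg Ht.
    assert (N : (g t - z)%C <> 0%C).
    { apply (avoids_neq p); [assumption|]. now apply on_path_in. }
    assert (D : is_Cderive (fun s => cauchy_kernel z (g s)) t
                  (- velocity g t * (cauchy_kernel z (g t)) ^ 2)%C).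
    { assert (D1 : is_Cderive (fun s => g s - z)%C t (velocity g t)).
      { eapply is_Cderive_eq.
        - apply (is_Cderive_plus _ (fun _ => - z)%C); [|apply is_Cderive_const].
          apply C1_arc_derive; auto.
        - ring. }
      eapply is_Cderive_eq; [apply (is_Cderive_inv (fun s => g s - z)%C _ _ N D1)|].
      unfold cauchy_kernel. simpl. field. exact N. }
    eapply is_Cderive_eq.
    + apply is_Cderive_scal_real. apply is_Cderive_pow. exact D.
    + rewrite !Cmult_assoc, <- RtoC_mult.
      replace (- / INR (S n) * INR (S n)) with (-1) by (field; apply not_0_INR; lia).
      simpl. ring.
Qed.

(** Real and imaginary parts of [z' / (z - z0)] for [z0 = a + i c]; the arctangent plays the part of
    the argument, up to a locally constant multiple of pi. *)
Lemma is_derive_log_parts (x y : R -> R) (a c t dx dy : R) :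
  is_derive x t dx -> is_derive y t dy -> x t - a <> 0 ->
  is_derive (fun s => ln ((x s - a) ^ 2 + (y s - c) ^ 2) / 2) t
    (((x t - a) * dx + (y t - c) * dy) / ((x t - a) ^ 2 + (y t - c) ^ 2)) /\
  is_derive (fun s => atan ((y s - c) / (x s - a))) t
    (((x t - a) * dy - (y t - c) * dx) / ((x t - a) ^ 2 + (y t - c) ^ 2)).
Proof.
  intros D1 D2 N.
  assert (P : 0 < (x t - a) * (x t - a) + (y t - c) * (y t - c)).
  { assert (P1 := pow2_gt_0 _ N). assert (P2 := pow2_ge_0 (y t - c)). lra. }
  split; auto_derive.
  - repeat split; try (eexists; eassumption). rewrite !Rmult_1_r. exact P.
  - change (Derive (fun s => x s) t) with (Derive x t); change (Derive (fun s => y s) t) with (Derive y t);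
    rewrite (is_derive_unique _ _ _ D1), (is_derive_unique _ _ _ D2). field. lra.
  - repeat split; try (eexists; eassumption). exact N.
  - change (Derive (fun s => x s) t) with (Derive x t); change (Derive (fun s => y s) t) with (Derive y t);
    rewrite (is_derive_unique _ _ _ D1), (is_derive_unique _ _ _ D2). unfold Rsqr. field.
    repeat split; try assumption; intros E; simpl in *; lra.
Qed.

(* Off the vertical line through [z], [ln |v - z| + i atan (Im (v - z) / Re (v - z))]
   is locally, up to a constant, a logarithm of [v - z]. *)
Lemma contour_integral_kernel_half_plane z p :
  closed_contour p -> (forall v, on_path p v -> Re v <> Re z) ->
  contour_integral (cauchy_kernel z) p = 0%C.
Proof.
  intros Hp Hz. assert (Hs := closed_smooth p Hp).
  assert (Hz' : ~ on_path p z) by (intros H; now apply (Hz z)).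
  apply (contour_integral_primitive p
    (fun v => (ln ((Re v - Re z) ^ 2 + (Im v - Im z) ^ 2) / 2,
               atan ((Im v - Im z) / (Re v - Re z))))); [assumption|now apply path_cont_kernel|].
  intros g t Hg Ht.
  assert (N := Hz (g t) (on_path_in p g t Hg Ht)).
  assert (N' : Re (g t) - Re z <> 0) by lra.
  destruct (C1_arc_derive g t (Hs g Hg) Ht) as [D1 D2].
  destruct (is_derive_log_parts _ _ (Re z) (Im z) t _ _ D1 D2 N') as [A B].
  assert (P : 0 < (Re (g t) - Re z) ^ 2 + (Im (g t) - Im z) ^ 2).
  { assert (P1 := pow2_gt_0 _ N'). assert (P2 := pow2_ge_0 (Im (g t) - Im z)). lra. }
  split; (eapply is_derive_eq; [eassumption|]); unfold cauchy_kernel;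
    destruct (velocity g t) as [dx dy], (g t) as [gx gy], z as [zx zy]; simpl in *; field;
    intros E; simpl in *; lra.
Qed.

(** Orders of poles are encoded by repetitions in [Z]. *)
Definition invprod (Z : list C) (v : C) : C :=
  fold_right (fun z acc => cauchy_kernel z v * acc)%C (RtoC 1) Z.

(* [cs] is chosen before [p], so a linear relation between winding numbers of
   several contours passes to the integrals of [f]. *)
Definition reduces (f : C -> C) (Z : list C) : Prop :=
  (forall p, smooth p -> avoids p Z -> path_cont f p) /\
  exists cs : list (C * C),
    (forall q, In q cs -> In (snd q) Z) /\
    forall p, closed_contour p -> avoids p Z ->
      contour_integral f p =
      fold_right (fun q acc => fst q * contour_integral (cauchy_kernel (snd q)) p + acc)%C
        (RtoC 0) cs.

Lemma reduces_plus f h Z : reduces f Z -> reduces h Z -> reduces (fun v => f v + h v)%C Z.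
Proof.
  intros (Cf & cf & If & Ef) (Ch & ch & Ih & Eh). split.
  - intros p Hp Ha. apply path_cont_plus; auto.
  - exists (cf ++ ch); split.
    + intros q Hq. apply in_app_or in Hq. destruct Hq; auto.
    + intros p Hp Ha. rewrite contour_integral_plus, Ef, Eh; auto using closed_smooth.
      clear. induction cf as [|q cf IH]; simpl; [ring|]. rewrite <- IH. ring.
Qed.

Lemma reduces_scal c f Z : reduces f Z -> reduces (fun v => c * f v)%C Z.
Proof.
  intros (Cf & cf & If & Ef). split.
  - intros p Hp Ha. apply path_cont_mult; [apply path_cont_const|auto].
  - exists (map (fun q => (c * fst q, snd q)%C) cf); split.
    + intros q Hq. apply in_map_iff in Hq. destruct Hq as (q' & <- & Hq'). simpl. auto.
    + intros p Hp Ha. rewrite contour_integral_scal, Ef; auto using closed_smooth.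
      clear. induction cf as [|q cf IH]; simpl; [ring|]. rewrite <- IH. ring.
Qed.

Lemma reduces_incl f Z Z' : incl Z Z' -> reduces f Z -> reduces f Z'.
Proof.
  intros HZ (Cf & cf & If & Ef).
  assert (A : forall p, avoids p Z' -> avoids p Z) by (intros p H z Hz; apply H; auto).
  split; [auto|]. exists cf; split; auto.
Qed.

(** Admissible contours avoid [Z], so equality off [Z] is enough; partial fraction identities are
    available only there. *)
Lemma reduces_ext f h Z :
  (forall p, smooth p -> avoids p Z -> path_cont h p) ->
  (forall v, ~ In v Z -> f v = h v) -> reduces f Z -> reduces h Z.
Proof.
  intros Ch H (Cf & cf & If & Ef). split; [assumption|].
  exists cf; split; [assumption|]. intros p Hp Ha. rewrite <- Ef by assumption.
  apply contour_integral_ext. intros v Hv. symmetry. apply H. intros I. now apply (Ha v I).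
Qed.

Lemma reduces_zero f Z :
  (forall p, smooth p -> avoids p Z -> path_cont f p) ->
  (forall p, closed_contour p -> avoids p Z -> contour_integral f p = 0%C) -> reduces f Z.
Proof.
  intros Cf H. split; [assumption|]. exists nil; split; [intros q []|]. intros p Hp Ha. simpl. auto.
Qed.

Lemma path_cont_invprod Z p : smooth p -> avoids p Z -> path_cont (invprod Z) p.
Proof.
  intros Hp. induction Z as [|z Z IH]; intros Ha.
  - apply path_cont_const.
  - apply avoids_cons in Ha. destruct Ha as [Hz Ha].
    apply (path_cont_mult (cauchy_kernel z) (invprod Z)); [now apply path_cont_kernel|auto].
Qed.

(** Partial fractions, by induction on the remaining poles for all exponents [n] at once. A
    repetition of [z] raises the exponent. A different pole [w] is handled by [1 / ((v - z) (v - w))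
    = (1 / (v - z) - 1 / (v - w)) / (z - w)]: one term loses [w], the other has a lower power at
    [z], whence the inner induction on [n]. *)
Lemma reduces_kernel_pow Z : forall z n,
  reduces (fun v => cauchy_kernel z v ^ n * invprod Z v)%C (z :: Z).
Proof.
  assert (PC : forall W z n p, smooth p -> avoids p (z :: W) ->
     path_cont (fun v => cauchy_kernel z v ^ n * invprod W v)%C p).
  { intros W z n p Hp Ha. apply avoids_cons in Ha. destruct Ha as [Hz Ha].
    apply path_cont_mult; [apply path_cont_pow, path_cont_kernel; assumption|].
    now apply path_cont_invprod. }
  induction Z as [|w Z IH]; intros z n.
  - apply (reduces_ext (fun v => cauchy_kernel z v ^ n)%C); [apply PC|intros; simpl; ring|].
    assert (Cn : forall p, smooth p -> avoids p (z :: nil) ->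
              path_cont (fun v => cauchy_kernel z v ^ n)%C p).
    { intros p Hp Ha. apply path_cont_pow, path_cont_kernel; [assumption|]. apply Ha. now left. }
    (* No pole, a simple pole, a higher pole: only the middle case produces a coefficient. *)
    destruct n as [|[|n]].
    + apply reduces_zero; [assumption|]. intros p Hp _.
      rewrite <- (contour_integral_pow 0 p Hp). reflexivity.
    + split; [assumption|]. exists ((RtoC 1, z) :: nil). split.
      * intros q [<-|[]]. now left.
      * intros p _ _. simpl. rewrite Cmult_1_l, Cplus_0_r.
        apply contour_integral_ext. intros; apply Cmult_1_r.
    + apply reduces_zero; [assumption|]. intros p Hp Ha.
      apply contour_integral_kernel_pow; [assumption|]. apply Ha. now left.
  - destruct (Ceq_dec z w) as [<-|Hzw].
    + apply (reduces_ext (fun v => cauchy_kernel z v ^ S n * invprod Z v)%C).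
      * apply PC.
      * intros v _. simpl. ring.
      * eapply reduces_incl; [|apply IH]. intros x [<-|Hx]; [now left|right; now right].
    + induction n as [|n IHn].
      * apply (reduces_ext (fun v => cauchy_kernel w v ^ 1 * invprod Z v)%C).
        -- apply PC.
        -- intros v _. simpl. ring.
        -- eapply reduces_incl; [|apply IH]. intros x Hx. now right.
      * apply (reduces_ext (fun v => / (z - w) * (cauchy_kernel z v ^ S n * invprod Z v)
             + (- / (z - w)) * (cauchy_kernel z v ^ n * invprod (w :: Z) v))%C).
        -- apply PC.
        -- intros v Hv. simpl. unfold cauchy_kernel.
           assert ((v - z)%C <> 0%C).
           { intros E. apply Hv. left. replace v with (v - z + z)%C by ring. rewrite E. ring. }
           assert ((v - w)%C <> 0%C).
           { intros E. apply Hv. right; left. replace v with (v - w + w)%C by ring. rewrite E. ring. }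
           assert ((z - w)%C <> 0%C).
           { intros E. apply Hzw. replace z with (z - w + w)%C by ring. rewrite E. ring. }
           field. repeat split; assumption.
        -- apply reduces_plus; apply reduces_scal; [|exact IHn].
           eapply reduces_incl; [|apply IH]. intros x [<-|Hx]; [now left|right; now right].
Qed.

Lemma path_cont_mono k Z p : smooth p -> avoids p Z -> path_cont (fun v => v ^ k * invprod Z v)%C p.
Proof.
  intros Hp Ha. apply path_cont_mult; [|now apply path_cont_invprod].
  apply (path_cont_pow (fun v => v)). now apply path_cont_id.
Qed.

(** Division with remainder: [v / (v - z) = 1 + z / (v - z)] lowers the degree by one, with and
    without the pole [z]. *)
Lemma reduces_mono k : forall Z, reduces (fun v => v ^ k * invprod Z v)%C Z.
Proof.
  induction k as [|k IH]; intros [|z Z].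
  1, 3: apply reduces_zero; [intros; now apply path_cont_mono|]; intros p Hp _.
  - rewrite <- (contour_integral_pow 0 p Hp). apply contour_integral_ext. intros; simpl. ring.
  - rewrite <- (contour_integral_pow (S k) p Hp). apply contour_integral_ext. intros; simpl. ring.
  - apply (reduces_ext (fun v => cauchy_kernel z v ^ 1 * invprod Z v)%C).
    + intros; now apply path_cont_mono.
    + intros; simpl. ring.
    + apply reduces_kernel_pow.
  - apply (reduces_ext (fun v => v ^ k * invprod Z v + z * (v ^ k * invprod (z :: Z) v))%C).
    + intros; now apply path_cont_mono.
    + intros v Hv. simpl. unfold cauchy_kernel.
      assert ((v - z)%C <> 0%C).
      { intros E. apply Hv. left. replace v with (v - z + z)%C by ring. rewrite E. ring. }
      field. assumption.
    + apply reduces_plus; [|apply reduces_scal; apply IH].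
      eapply reduces_incl; [|apply IH]. intros x Hx. now right.
Qed.

(** * Polynomial numerators and their uniform limits *)

Definition peval (cs : list C) (v : C) : C :=
  fold_right (fun c acc => c + v * acc)%C (RtoC 0) cs.

Lemma peval_path_cont cs p : smooth p -> path_cont (peval cs) p.
Proof.
  intros Hp. induction cs as [|c cs IH]; [apply path_cont_const|].
  apply (path_cont_plus (fun _ => c) (fun v => v * peval cs v)%C); [apply path_cont_const|].
  apply path_cont_mult; [now apply path_cont_id|assumption].
Qed.

Lemma reduces_poly cs Z : reduces (fun v => peval cs v * invprod Z v)%C Z.
Proof.
  (* The extra factor [v ^ k] absorbs the [v] of each Horner step, so the induction on the
     coefficients goes through. *)
  assert (G : forall k, reduces (fun v => v ^ k * invprod Z v * peval cs v)%C Z).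
  { induction cs as [|c cs IH]; intros k.
    - apply (reduces_ext (fun v => 0 * (v ^ k * invprod Z v))%C).
      + intros p Hp Ha. apply path_cont_mult; [now apply path_cont_mono|now apply peval_path_cont].
      + intros; simpl. ring.
      + apply reduces_scal, reduces_mono.
    - apply (reduces_ext (fun v => c * (v ^ k * invprod Z v) + v ^ S k * invprod Z v * peval cs v)%C).
      + intros p Hp Ha. apply path_cont_mult; [now apply path_cont_mono|now apply peval_path_cont].
      + intros; simpl. ring.
      + apply reduces_plus; [apply reduces_scal, reduces_mono|apply IH]. }
  apply (reduces_ext (fun v => v ^ 0 * invprod Z v * peval cs v)%C).
  - intros p Hp Ha. apply path_cont_mult; [now apply peval_path_cont|now apply path_cont_invprod].
  - intros; simpl. ring.
  - apply G.
Qed.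

(* Locally uniform limits of polynomials; no power series is needed. *)
Definition entire (f : C -> C) : Prop :=
  forall M eps, 0 < eps ->
    exists cs, forall v, Cmod v <= M -> Cmod (f v - peval cs v) <= eps.

Lemma peval_Ccont cs (g : R -> C) t : Ccont g t -> Ccont (fun s => peval cs (g s)) t.
Proof.
  intros H. induction cs as [|c cs IH]; [apply Ccont_const|].
  apply (Ccont_plus (fun _ => c) (fun s => g s * peval cs (g s))%C); [apply Ccont_const|].
  now apply Ccont_mult.
Qed.

Lemma entire_Ccont f (g : R -> C) t : entire f -> Ccont g t -> Ccont (fun s => f (g s)) t.
Proof.
  intros Hf Hg. apply Ccont_eps. intros eps He.
  (* The margin 1 keeps [g s] in the disc of approximation for [s] near [t]. *)
  destruct (Hf (Cmod (g t) + 1) (eps / 4)) as (cs & Hcs); [lra|].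
  destruct (proj1 (Ccont_eps _ _) Hg 1) as (d1 & Hd1 & K1); [lra|].
  destruct (proj1 (Ccont_eps _ _) (peval_Ccont cs g t Hg) (eps / 4)) as (d2 & Hd2 & K2); [lra|].
  exists (Rmin d1 d2); split; [now apply Rmin_glb_lt|].
  intros s Hs.
  assert (A1 := K1 s (Rlt_le_trans _ _ _ Hs (Rmin_l _ _))).
  assert (A2 := K2 s (Rlt_le_trans _ _ _ Hs (Rmin_r _ _))).
  assert (B1 : Cmod (g s) <= Cmod (g t) + 1).
  { replace (g s) with (g t + (g s - g t))%C by ring. eapply Rle_trans; [apply Cmod_triangle|]. lra. }
  assert (B2 := Hcs (g s) B1). assert (B3 : Cmod (g t) <= Cmod (g t) + 1) by lra.
  apply Hcs in B3. rewrite Cmod_sub_sym in B3.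
  replace (f (g s) - f (g t))%C with ((f (g s) - peval cs (g s)) + (peval cs (g s) - peval cs (g t))
     + (peval cs (g t) - f (g t)))%C by ring.
  eapply Rle_lt_trans; [apply Cmod_triangle|].
  assert (T := Cmod_triangle (f (g s) - peval cs (g s)) (peval cs (g s) - peval cs (g t))). lra.
Qed.

Lemma entire_path_cont f p : entire f -> smooth p -> path_cont f p.
Proof. intros Hf Hp g t Hg Ht. apply entire_Ccont; [assumption|]. apply C1_arc_cont; auto. Qed.

(** [K] and [R] precede the polynomial, so a single polynomial, close to [f] on a large enough disc,
    can serve several contours simultaneously. *)
Lemma entire_approx_integral f Z p :
  entire f -> smooth p -> avoids p Z ->
  exists K R, 0 <= K /\ forall cs eps, 0 < eps ->
    (forall v, Cmod v <= R -> Cmod (f v - peval cs v) <= eps) ->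
    Cmod (contour_integral (fun v => f v * invprod Z v)%C p
          - contour_integral (fun v => peval cs v * invprod Z v)%C p) <= K * eps.
Proof.
  intros Hf Hp Ha.
  destruct (contour_integral_bound p Hp) as (L & HL & HLb).
  assert (CI := path_cont_invprod Z p Hp Ha).
  destruct (path_bounded (invprod Z) p CI) as (B & HB & HBb).
  destruct (path_bounded (fun v => v) p (path_cont_id p Hp)) as (R & HR & HRb).
  exists (L * B), R. split; [apply Rmult_le_pos; lra|].
  intros cs eps He Hcs.
  assert (Cf := entire_path_cont f p Hf Hp).
  assert (Cp := peval_path_cont cs p Hp).
  rewrite <- contour_integral_minus by (try apply path_cont_mult; assumption).
  rewrite Rmult_assoc. apply HLb.
  - apply path_cont_minus; apply path_cont_mult; assumption.
  - intros v Hv. replace (f v * invprod Z v - peval cs v * invprod Z v)%C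
      with (invprod Z v * (f v - peval cs v))%C by ring.
    rewrite Cmod_mult. apply Rmult_le_compat; try apply Cmod_ge_0; auto.
Qed.

Lemma Cmod_le_all_eps (z : C) K : 0 <= K -> (forall eps, 0 < eps -> Cmod z <= K * eps) -> z = 0%C.
Proof.
  intros HK H. apply Cmod_eq_0.
  destruct (Cmod_ge_0 z) as [P|E]; [|now symmetry].
  assert (E : 0 < Cmod z / (2 * (K + 1))) by (apply Rdiv_lt_0_compat; lra).
  specialize (H _ E).
  replace (K * (Cmod z / (2 * (K + 1)))) with (Cmod z * (K / (2 * (K + 1)))) in H by (field; lra).
  assert (K / (2 * (K + 1)) < 1).
  { apply (Rmult_lt_reg_r (2 * (K + 1))); [lra|]. unfold Rdiv. rewrite Rmult_assoc, Rinv_l by lra. lra. }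
  nra.
Qed.

(* Cauchy's theorem in homological form for [p - q - r]. *)
Lemma contour_integral_decompose f Z p q r :
  entire f -> closed_contour p -> closed_contour q -> closed_contour r ->
  avoids p Z -> avoids q Z -> avoids r Z ->
  (forall z, In z Z -> contour_integral (cauchy_kernel z) p =
     (contour_integral (cauchy_kernel z) q + contour_integral (cauchy_kernel z) r)%C) ->
  contour_integral (fun v => f v * invprod Z v)%C p =
  (contour_integral (fun v => f v * invprod Z v)%C q
   + contour_integral (fun v => f v * invprod Z v)%C r)%C.
Proof.
  intros Hf Hp Hq Hr Ap Aq Ar HZ.
  destruct (entire_approx_integral f Z p Hf (closed_smooth _ Hp) Ap) as (Kp & Rp & HKp & Bp).
  destruct (entire_approx_integral f Z q Hf (closed_smooth _ Hq) Aq) as (Kq & Rq & HKq & Bq).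
  destruct (entire_approx_integral f Z r Hf (closed_smooth _ Hr) Ar) as (Kr & Rr & HKr & Br).
  set (Ip := contour_integral _ p) in *. set (Iq := contour_integral _ q) in *.
  set (Ir := contour_integral _ r) in *.
  assert (E : (Ip - (Iq + Ir))%C = 0%C).
  { apply (Cmod_le_all_eps _ (Kp + Kq + Kr)); [lra|]. intros eps He.
    destruct (Hf (Rmax Rp (Rmax Rq Rr)) eps He) as (cs & Hcs).
    specialize (Bp cs eps He). specialize (Bq cs eps He). specialize (Br cs eps He).
    assert (M1 := Rmax_l Rp (Rmax Rq Rr)). assert (M2 := Rmax_r Rp (Rmax Rq Rr)).
    assert (M3 := Rmax_l Rq Rr). assert (M4 := Rmax_r Rq Rr).
    lapply Bp; [clear Bp; intros Bp|intros v Hv; apply Hcs; lra].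
    lapply Bq; [clear Bq; intros Bq|intros v Hv; apply Hcs; lra].
    lapply Br; [clear Br; intros Br|intros v Hv; apply Hcs; lra].
    set (Pp := contour_integral _ p) in Bp. set (Pq := contour_integral _ q) in Bq.
    set (Pr := contour_integral _ r) in Br.
    assert (EP : Pp = (Pq + Pr)%C).
    { unfold Pp, Pq, Pr. destruct (reduces_poly cs Z) as (_ & ds & Ids & Eds).
      rewrite !Eds by assumption.
      clear - Ids HZ. induction ds as [|d ds IH]; simpl; [ring|].
      rewrite IH by (intros; apply Ids; now right).
      rewrite HZ by (apply Ids; now left). ring. }
    replace (Ip - (Iq + Ir))%C with ((Ip - Pp) - (Iq - Pq) - (Ir - Pr))%C by (rewrite EP; ring).
    eapply Rle_trans; [apply Cmod_triangle_sub|].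
    assert (T := Cmod_triangle_sub (Ip - Pp) (Iq - Pq)). lra. }
  replace Ip with (Ip - (Iq + Ir) + (Iq + Ir))%C by ring. rewrite E. ring.
Qed.

(** * Entire functions *)

Fixpoint padd (cs ds : list C) : list C :=
  match cs, ds with
  | nil, _ => ds
  | _, nil => cs
  | c :: cs', d :: ds' => (c + d)%C :: padd cs' ds'
  end.

Lemma peval_padd cs ds v : peval (padd cs ds) v = (peval cs v + peval ds v)%C.
Proof.
  revert ds. induction cs as [|c cs IH]; intros [|d ds]; simpl; try ring.
  rewrite IH. ring.
Qed.

Fixpoint pmul (cs ds : list C) : list C :=
  match cs with
  | nil => nil
  | c :: cs' => padd (map (Cmult c) ds) (RtoC 0 :: pmul cs' ds)
  end.

Lemma peval_pmul cs ds v : peval (pmul cs ds) v = (peval cs v * peval ds v)%C.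
Proof.
  induction cs as [|c cs IH]; simpl; [ring|].
  assert (M : peval (map (Cmult c) ds) v = (c * peval ds v)%C).
  { clear IH. induction ds as [|d ds IHd]; simpl; [ring|]. rewrite IHd. ring. }
  rewrite peval_padd, M. simpl. rewrite IH. ring.
Qed.

Fixpoint pscale (k : C) (cs : list C) : list C :=
  match cs with
  | nil => nil
  | c :: cs' => c :: map (Cmult k) (pscale k cs')
  end.

Lemma peval_pscale k cs v : peval (pscale k cs) v = peval cs (k * v)%C.
Proof.
  induction cs as [|c cs IH]; simpl; [reflexivity|].
  assert (M : forall ds, peval (map (Cmult k) ds) v = (k * peval ds v)%C).
  { induction ds as [|d ds IHd]; simpl; [ring|]. rewrite IHd. ring. }
  rewrite M, IH. ring.
Qed.

Lemma peval_bounded cs M : 0 <= M -> exists B, 0 <= B /\ forall v, Cmod v <= M -> Cmod (peval cs v) <= B.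
Proof.
  intros HM. induction cs as [|c cs (B & HB & IH)].
  - exists 0; split; [lra|]. intros; simpl. rewrite Cmod_0. lra.
  - exists (Cmod c + M * B); split.
    + assert (A := Cmod_ge_0 c). assert (0 <= M * B) by (now apply Rmult_le_pos). lra.
    + intros v Hv. simpl. eapply Rle_trans; [apply Cmod_triangle|].
      rewrite Cmod_mult. apply Rplus_le_compat_l. apply Rmult_le_compat; try apply Cmod_ge_0; auto.
Qed.

Lemma entire_bounded f M :
  entire f -> 0 <= M -> exists B, 0 <= B /\ forall v, Cmod v <= M -> Cmod (f v) <= B.
Proof.
  intros Hf HM. destruct (Hf M 1) as (cs & Hcs); [lra|].
  destruct (peval_bounded cs M HM) as (B & HB & HBb).
  exists (B + 1); split; [lra|]. intros v Hv.
  replace (f v) with (peval cs v + (f v - peval cs v))%C by ring.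
  eapply Rle_trans; [apply Cmod_triangle|]. apply Rplus_le_compat; auto.
Qed.

Lemma entire_mult f h : entire f -> entire h -> entire (fun v => f v * h v)%C.
Proof.
  intros Hf Hh M eps He.
  set (M' := Rmax M 0). assert (HM' : 0 <= M') by apply Rmax_r.
  destruct (entire_bounded f M' Hf HM') as (Bf & HBf & HBfb).
  destruct (entire_bounded h M' Hh HM') as (Bh & HBh & HBhb).
  assert (Hd : 0 < eps / (2 * (Bf + Bh + 1))) by (apply Rdiv_lt_0_compat; lra).
  (* If both factors are approximated within [d], the product is off by at most
     [d (Bf + Bh) + d ^ 2]. The bound [d <= 1] replaces [d ^ 2] by [d], and the approximants need no
     bounds of their own. *)
  set (d := Rmin 1 (eps / (2 * (Bf + Bh + 1)))).
  assert (Hd0 : 0 < d) by (apply Rmin_glb_lt; lra).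
  assert (Hd1 : d <= 1) by apply Rmin_l.
  assert (Hd2 : d * (2 * (Bf + Bh + 1)) <= eps).
  { apply (Rmult_le_reg_r (/ (2 * (Bf + Bh + 1)))); [apply Rinv_0_lt_compat; lra|].
    rewrite Rmult_assoc, Rinv_r by lra. rewrite Rmult_1_r. apply Rmin_r. }
  destruct (Hf M' d Hd0) as (cs & Hcs). destruct (Hh M' d Hd0) as (ds & Hds).
  exists (pmul cs ds). intros v Hv. rewrite peval_pmul.
  assert (Hv' : Cmod v <= M') by (eapply Rle_trans; [exact Hv|apply Rmax_l]).
  specialize (Hcs v Hv'). specialize (Hds v Hv'). specialize (HBfb v Hv'). specialize (HBhb v Hv').
  replace (f v * h v - peval cs v * peval ds v)%C
    with ((f v - peval cs v) * h v + f v * (h v - peval ds v)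
          - (f v - peval cs v) * (h v - peval ds v))%C by ring.
  assert (T1 : Cmod ((f v - peval cs v) * h v) <= d * Bh).
  { rewrite Cmod_mult. apply Rmult_le_compat; auto using Cmod_ge_0. }
  assert (T2 : Cmod (f v * (h v - peval ds v)) <= Bf * d).
  { rewrite Cmod_mult. apply Rmult_le_compat; auto using Cmod_ge_0. }
  assert (T3 : Cmod ((f v - peval cs v) * (h v - peval ds v)) <= d * 1).
  { rewrite Cmod_mult. apply Rmult_le_compat; auto using Cmod_ge_0. lra. }
  eapply Rle_trans; [apply Cmod_triangle_sub|].
  assert (T := Cmod_triangle ((f v - peval cs v) * h v) (f v * (h v - peval ds v))).
  nra.
Qed.

Lemma entire_scale k f : entire f -> entire (fun v => f (k * v)%C).
Proof.
  intros Hf M eps He.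
  destruct (Hf (Cmod k * Rmax M 0) eps He) as (cs & Hcs).
  exists (pscale k cs). intros v Hv. rewrite peval_pscale. apply Hcs.
  rewrite Cmod_mult. apply Rmult_le_compat_l; [apply Cmod_ge_0|].
  eapply Rle_trans; [exact Hv|apply Rmax_l].
Qed.

Lemma entire_ext f h : (forall v, f v = h v) -> entire f -> entire h.
Proof.
  intros H Hf M eps He. destruct (Hf M eps He) as (cs & Hcs). exists cs.
  intros v Hv. rewrite <- H. auto.
Qed.

(** * Partial sums of power series *)

Fixpoint psum (c : nat -> C) (n : nat) (v : C) : C :=
  match n with
  | O => RtoC 0
  | S n' => (psum c n' v + c n' * v ^ n')%C
  end.

Lemma peval_app cs ds v : peval (cs ++ ds) v = (peval cs v + v ^ length cs * peval ds v)%C.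
Proof. induction cs as [|c cs IH]; simpl; [ring|]. rewrite IH. ring. Qed.

Lemma psum_peval c n v : psum c n v = peval (map c (seq 0 n)) v.
Proof.
  induction n as [|n IH]; [reflexivity|].
  rewrite seq_S, map_app, peval_app, length_map, length_seq. simpl. rewrite IH. ring.
Qed.

(** * The complex exponential *)

Lemma Cexp_plus z w : Cexp (z + w)%C = (Cexp z * Cexp w)%C.
Proof.
  unfold Cexp. apply C_eq; simpl; rewrite exp_plus.
  - rewrite cos_plus. unfold Re, Im. ring.
  - rewrite sin_plus. unfold Re, Im. ring.
Qed.

Lemma Cexp_RtoC x : Cexp (RtoC x) = RtoC (exp x).
Proof. unfold Cexp; apply C_eq; simpl; rewrite ?cos_0, ?sin_0; ring. Qed.

Lemma Cexp_0 : Cexp 0 = 1%C.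
Proof. rewrite Cexp_RtoC, exp_0. reflexivity. Qed.

Lemma Cmod_Cexp z : Cmod (Cexp z) = exp (Re z).
Proof.
  unfold Cmod, Cexp; simpl.
  replace (_ + _) with (exp (Re z) * exp (Re z) * (Rsqr (sin (Im z)) + Rsqr (cos (Im z))))
    by (unfold Rsqr; ring).
  rewrite sin2_cos2, Rmult_1_r. apply sqrt_square. left. apply exp_pos.
Qed.

Lemma is_derive_Cexp_parts (x y : R -> R) t dx dy :
  is_derive x t dx -> is_derive y t dy ->
  is_derive (fun s => exp (x s) * cos (y s)) t (exp (x t) * cos (y t) * dx - exp (x t) * sin (y t) * dy) /\
  is_derive (fun s => exp (x s) * sin (y s)) t (exp (x t) * cos (y t) * dy + exp (x t) * sin (y t) * dx).
Proof.
  intros D1 D2. split; auto_derive; try (repeat split; try (eexists; eassumption));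
    change (Derive (fun s => x s) t) with (Derive x t); change (Derive (fun s => y s) t) with (Derive y t);
    rewrite (is_derive_unique _ _ _ D1), (is_derive_unique _ _ _ D2); ring.
Qed.

Lemma is_Cderive_Cexp (g : R -> C) t l :
  is_Cderive g t l -> is_Cderive (fun s => Cexp (g s)) t (Cexp (g t) * l)%C.
Proof.
  intros [D1 D2]. destruct (is_derive_Cexp_parts _ _ t _ _ D1 D2) as [A B].
  split; [exact A|exact B].
Qed.

Definition exp_coef (k : nat) : C := RtoC (/ INR (fact k)).

Lemma is_Cderive_exp_psum z t n :
  is_Cderive (fun s => psum exp_coef (S n) (RtoC s * z))%C t (z * psum exp_coef n (RtoC t * z))%C.
Proof.
  assert (D : is_Cderive (fun s => RtoC s * z)%C t z).
  { eapply is_Cderive_eq.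
    - apply (is_Cderive_mult (fun s => RtoC s) (fun _ => z) t 1%C 0%C).
      + split; simpl; [apply (@is_derive_id R_AbsRing)|apply (@is_derive_const R_AbsRing R_NormedModule)].
      + apply is_Cderive_const.
    - ring. }
  induction n as [|n IH].
  - apply (is_Cderive_ext (fun _ => exp_coef 0)); [intros; simpl; ring|].
    eapply is_Cderive_eq; [apply is_Cderive_const|]. simpl. ring.
  - apply (is_Cderive_ext (fun s => psum exp_coef (S n) (RtoC s * z) + exp_coef (S n) * (RtoC s * z) ^ S n)%C);
      [intros; reflexivity|].
    eapply is_Cderive_eq.
    + apply is_Cderive_plus; [exact IH|].
      apply is_Cderive_scal_real. apply is_Cderive_pow. exact D.
    + change (psum exp_coef (S n) (RtoC t * z)) with (psum exp_coef n (RtoC t * z) + exp_coef n * (RtoC t * z) ^ n)%C.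
      assert (E : RtoC (/ INR (fact (S n))) = (/ RtoC (INR (S n)) * exp_coef n)%C).
      { unfold exp_coef. rewrite <- RtoC_inv, <- RtoC_mult by (apply not_0_INR; lia). f_equal.
        rewrite fact_simpl, mult_INR. field. split; [apply INR_fact_neq_0|apply not_0_INR; lia]. }
      rewrite E. field. intros H. apply RtoC_inj in H. revert H. apply not_0_INR. lia.
Qed.

(** With [P] the Taylor polynomial of degree [n], the function [h t = exp (- t z) P (t z)] has as
    derivative the single term [- z exp (- t z) (t z) ^ n / n!]. Integration over [0, 1] estimates
    [exp (- z) P z - 1], and multiplication by [exp z] concludes. The two exponentials account for
    [exp (2 |z|)]. *)
Lemma Cexp_taylor z n :
  Cmod (Cexp z - psum exp_coef (S n) z) <= exp (2 * Cmod z) * (Cmod z ^ S n / INR (fact n)).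
Proof.
  set (h := fun t => (Cexp (RtoC t * - z) * psum exp_coef (S n) (RtoC t * z))%C).
  set (h' := fun t => (- z * Cexp (RtoC t * - z) * (exp_coef n * (RtoC t * z) ^ n))%C).
  assert (D : forall t, is_Cderive h t (h' t)).
  { intros t. unfold h, h'. eapply is_Cderive_eq.
    - apply is_Cderive_mult; [|apply is_Cderive_exp_psum].
      apply is_Cderive_Cexp.
      apply (is_Cderive_mult (fun s => RtoC s) (fun _ => - z)%C t 1%C 0%C).
      + split; simpl; [apply (@is_derive_id R_AbsRing)|apply (@is_derive_const R_AbsRing R_NormedModule)].
      + apply is_Cderive_const.
    - simpl. ring. }
  assert (Ch : forall t, Ccont (fun s => RtoC s) t).
  { intros t. split; simpl; [apply continuous_id|apply continuous_const]. }
  assert (I : is_CInt h' 0 1 (h 1 - h 0)%C).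
  { apply is_CInt_derive; intros t _; [apply D|]. unfold h'.
    apply Ccont_mult; [apply Ccont_mult; [apply Ccont_const|]|apply Ccont_mult; [apply Ccont_const|]].
    - eapply is_Cderive_cont. apply is_Cderive_Cexp.
      apply (is_Cderive_mult (fun s => RtoC s) (fun _ => - z)%C t 1%C 0%C).
      + split; simpl; [apply (@is_derive_id R_AbsRing)|apply (@is_derive_const R_AbsRing R_NormedModule)].
      + apply is_Cderive_const.
    - clear -Ch. induction n as [|n IH]; simpl; [apply Ccont_const|].
      apply (Ccont_mult (fun s => RtoC s * z)%C (fun s => (RtoC s * z) ^ n)%C); [|assumption].
      apply Ccont_mult; [apply Ch|apply Ccont_const]. }
  assert (F0 := INR_fact_lt_0 n).
  assert (B : Cmod (h 1 - h 0) <= (1 - 0) * (exp (Cmod z) * (Cmod z ^ S n / INR (fact n)))).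
  { eapply is_CInt_le_const; [lra| |exact I]. intros t Ht. unfold h', exp_coef. cbv beta.
    rewrite !Cmod_mult, Cmod_opp, Cmod_Cexp, Cmod_pow, Cmod_mult, !Cmod_R.
    rewrite (Rabs_right t) by lra.
    rewrite (Rabs_right (/ _)) by (left; now apply Rinv_0_lt_compat).
    assert (E : exp (Re (RtoC t * - z)) <= exp (Cmod z)).
    { destruct (Rle_lt_or_eq_dec (Re (RtoC t * - z)) (Cmod z)) as [L|L].
      - eapply Rle_trans; [apply Rle_abs|]. eapply Rle_trans; [apply re_le_Cmod|].
        rewrite Cmod_mult, Cmod_opp, Cmod_R, Rabs_right by lra.
        assert (A := Cmod_ge_0 z). nra.
      - left. now apply exp_increasing.
      - rewrite L. lra. }
    assert (P : (t * Cmod z) ^ n <= Cmod z ^ n).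
    { apply pow_incr. assert (A := Cmod_ge_0 z). nra. }
    assert (P0 : 0 <= (t * Cmod z) ^ n) by (apply pow_le; assert (A := Cmod_ge_0 z); nra).
    replace (exp (Cmod z) * (Cmod z ^ S n / INR (fact n)))
      with (Cmod z * exp (Cmod z) * (/ INR (fact n) * Cmod z ^ n)) by (simpl; field; lra).
    assert (Z0 := Cmod_ge_0 z). assert (I0 := Rinv_0_lt_compat _ F0).
    assert (E0 := exp_pos (Re (RtoC t * - z))).
    apply Rmult_le_compat.
    - apply Rmult_le_pos; lra.
    - apply Rmult_le_pos; lra.
    - apply Rmult_le_compat_l; assumption.
    - apply Rmult_le_compat_l; lra. }
  assert (E1 : h 0 = 1%C).
  { unfold h. replace (0 * - z)%C with (RtoC 0) by ring. rewrite Cexp_0.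
    replace (0 * z)%C with (RtoC 0) by ring.
    assert (P : forall k, psum exp_coef (S k) 0 = 1%C).
    { induction k as [|k IHk]; [unfold exp_coef; simpl; rewrite Rinv_1; ring|].
      change (psum exp_coef (S (S k)) 0) with (psum exp_coef (S k) 0 + exp_coef (S k) * 0 ^ S k)%C.
      rewrite IHk. simpl. ring. }
    rewrite P. ring. }
  assert (E2 : h 1 = (Cexp (- z) * psum exp_coef (S n) z)%C).
  { unfold h. f_equal; f_equal; ring. }
  replace (Cexp z - psum exp_coef (S n) z)%C with (- (Cexp z * (h 1 - h 0)))%C.
  - rewrite Cmod_opp, Cmod_mult, Cmod_Cexp.
    replace (2 * Cmod z) with (Cmod z + Cmod z) by ring. rewrite exp_plus, Rmult_assoc.
    apply Rmult_le_compat; [left; apply exp_pos|apply Cmod_ge_0| |rewrite Rminus_0_r, Rmult_1_l in B; exact B].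
    assert (A : Re z <= Cmod z) by (eapply Rle_trans; [apply Rle_abs|apply re_le_Cmod]).
    destruct A as [A|A]; [left; now apply exp_increasing|rewrite A; lra].
  - rewrite E1, E2.
    assert (X : (Cexp z * Cexp (- z))%C = 1%C).
    { rewrite <- Cexp_plus. replace (z + - z)%C with (RtoC 0) by ring. apply Cexp_0. }
    transitivity (Cexp z - (Cexp z * Cexp (- z)) * psum exp_coef (S n) z)%C; [ring|].
    rewrite X. ring.
Qed.

Lemma entire_Cexp : entire Cexp.
Proof.
  intros M eps He. set (M' := Rmax M 0). assert (HM' : 0 <= M') by apply Rmax_r.
  assert (K : 0 < exp (2 * M') * (M' + 1)).
  { apply Rmult_lt_0_compat; [apply exp_pos|lra]. }
  (* The Taylor bound carries [M' ^ (n + 1) / n!], one power more than the sequence known to vanish;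
     [M' + 1] absorbs it and stays positive when [M' = 0]. *)
  destruct (cv_speed_pow_fact M' (eps / (exp (2 * M') * (M' + 1)))) as (n & Hn).
  { apply Rdiv_lt_0_compat; lra. }
  exists (map exp_coef (seq 0 (S n))). intros v Hv. rewrite <- psum_peval.
  eapply Rle_trans; [apply Cexp_taylor|].
  assert (Hv' : Cmod v <= M') by (eapply Rle_trans; [exact Hv|apply Rmax_l]).
  specialize (Hn n (Nat.le_refl n)). unfold Rdist in Hn. rewrite Rminus_0_r in Hn.
  assert (F0 := INR_fact_lt_0 n).
  assert (P0 : 0 <= M' ^ n / INR (fact n)).
  { apply Rmult_le_pos; [now apply pow_le|left; now apply Rinv_0_lt_compat]. }
  rewrite Rabs_right in Hn by lra.
  assert (V0 := Cmod_ge_0 v).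
  apply Rle_trans with (exp (2 * M') * ((M' + 1) * (M' ^ n / INR (fact n)))).
  - apply Rmult_le_compat.
    + left; apply exp_pos.
    + apply Rmult_le_pos; [now apply pow_le|left; now apply Rinv_0_lt_compat].
    + destruct Hv' as [A|A]; [left; apply exp_increasing; lra|rewrite A; lra].
    + simpl. unfold Rdiv. rewrite Rmult_assoc.
      apply Rmult_le_compat; [assumption| |lra|].
      * apply Rmult_le_pos; [now apply pow_le|left; now apply Rinv_0_lt_compat].
      * apply Rmult_le_compat_r; [left; now apply Rinv_0_lt_compat|]. now apply pow_incr.
  - apply Rlt_le. rewrite <- Rmult_assoc. rewrite Rmult_comm.
    apply (Rmult_lt_reg_r (/ (exp (2 * M') * (M' + 1)))); [now apply Rinv_0_lt_compat|].
    rewrite Rmult_assoc, Rinv_r by lra. lra.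
Qed.

Lemma Cexp_sub_1_sub z : Cmod (Cexp z - 1 - z) <= exp (2 * Cmod z) * Cmod z ^ 2.
Proof.
  assert (T := Cexp_taylor z 1).
  replace (Cexp z - 1 - z)%C with (Cexp z - psum exp_coef 2 z)%C.
  - simpl in *. lra.
  - unfold exp_coef; simpl. rewrite Rinv_1. ring.
Qed.

(** * Dominated series and the function [0F1] *)

Lemma series_nonneg_partial (a : nat -> R) l n :
  (forall k, 0 <= a k) -> is_series a l -> sum_n a n <= l.
Proof.
  intros H Hs. apply (is_lim_seq_incr_compare (sum_n a)); [exact Hs|].
  intros k. rewrite sum_Sn. unfold plus; simpl. specialize (H (S k)). lra.
Qed.

(** Both [b - a] and [b + a] have nonnegative terms, so their partial sums stay below their sums;
    these are the two sides of the tail bound. *)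
Lemma series_dominated (a b : nat -> R) lb :
  (forall k, Rabs (a k) <= b k) -> is_series b lb ->
  Rabs (Series a) <= lb /\ forall n, Rabs (Series a - sum_n a n) <= lb - sum_n b n.
Proof.
  intros H Sb.
  assert (Ea : ex_series a).
  { apply (ex_series_le (V := R_CompleteNormedModule) a b); [exact H|]. now exists lb. }
  assert (Sa := Series_correct a Ea).
  assert (T : forall n, Rabs (Series a - sum_n a n) <= lb - sum_n b n).
  { intros n.
    assert (P1 : sum_n (fun k => minus (b k) (a k)) n <= minus lb (Series a)).
    { apply series_nonneg_partial; [|now apply (is_series_minus b a)].
      intros k. specialize (H k). apply Rabs_le_between in H.
      unfold minus, plus, opp; simpl. lra. }
    assert (P2 : sum_n (fun k => plus (b k) (a k)) n <= plus lb (Series a)).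
    { apply series_nonneg_partial; [|now apply (is_series_plus b a)].
      intros k. specialize (H k). apply Rabs_le_between in H.
      unfold minus, plus, opp; simpl. lra. }
    assert (E1 : sum_n (fun k => minus (b k) (a k)) n = sum_n b n - sum_n a n).
    { clear. induction n as [|n IH]; [now rewrite !sum_O|]. rewrite !sum_Sn, IH.
      unfold minus, plus, opp; simpl. ring. }
    assert (E2 : sum_n (fun k => plus (b k) (a k)) n = sum_n b n + sum_n a n).
    { clear. induction n as [|n IH]; [now rewrite !sum_O|]. rewrite !sum_Sn, IH.
      unfold minus, plus, opp; simpl. ring. }
    rewrite E1 in P1. rewrite E2 in P2. unfold minus, plus, opp in *; simpl in *.
    apply Rabs_le. lra. }
  split; [|exact T].
  assert (T0 := T O). rewrite !sum_O in T0. specialize (H O).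
  replace (Series a) with ((Series a - a O) + a O) by ring.
  eapply Rle_trans; [apply Rabs_triang|]. lra.
Qed.

Lemma is_series_exp x : is_series (fun k => x ^ k / INR (fact k)) (exp x).
Proof.
  apply (is_series_ext (fun k => scal (pow_n x k) (/ INR (fact k)))).
  - intros k. rewrite pow_n_pow. reflexivity.
  - apply is_exp_Reals.
Qed.

(** The factor 2 comes from [CSeries] summing real and imaginary parts separately. *)
Lemma Cmod_CSeries_le (a : nat -> C) (b : nat -> R) lb :
  (forall k, Cmod (a k) <= b k) -> is_series b lb -> Cmod (CSeries a) <= 2 * lb.
Proof.
  intros H Hb.
  destruct (series_dominated (fun k => Re (a k)) b lb) as [H1 _]; [|exact Hb|].
  { intros k. eapply Rle_trans; [apply re_le_Cmod|apply H]. }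
  destruct (series_dominated (fun k => Im (a k)) b lb) as [H2 _]; [|exact Hb|].
  { intros k. eapply Rle_trans; [apply im_le_Cmod|apply H]. }
  eapply Rle_trans; [apply Cmod_le_abs|]. simpl. unfold Re, Im in *. lra.
Qed.

Lemma Cmod_CSeries_tail_le (a : nat -> C) (b : nat -> R) lb (s : C) n :
  (forall k, Cmod (a k) <= b k) -> is_series b lb ->
  Re s = sum_n (fun k => Re (a k)) n -> Im s = sum_n (fun k => Im (a k)) n ->
  Cmod (CSeries a - s) <= 2 * (lb - sum_n b n).
Proof.
  intros H Hb Hr Hi.
  destruct (series_dominated (fun k => Re (a k)) b lb) as [_ H1]; [|exact Hb|].
  { intros k. eapply Rle_trans; [apply re_le_Cmod|apply H]. }
  destruct (series_dominated (fun k => Im (a k)) b lb) as [_ H2]; [|exact Hb|].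
  { intros k. eapply Rle_trans; [apply im_le_Cmod|apply H]. }
  specialize (H1 n). specialize (H2 n). rewrite <- Hr in H1. rewrite <- Hi in H2.
  eapply Rle_trans; [apply Cmod_le_abs|].
  destruct s as [s1 s2]. simpl in *. unfold Re, Im, Rminus in *. lra.
Qed.

(** Factorwise [c + j >= 1 + j]. The coefficients of [0F1] are thus at most [1 / k! ^ 2], and the
    second factorial is the source of the slow growth. *)
Lemma pochhammer_ge_fact c k : 1 <= c -> INR (fact k) <= pochhammer c k.
Proof.
  intros Hc. induction k as [|k IH]; [simpl; lra|].
  rewrite fact_simpl, mult_INR, S_INR. simpl pochhammer.
  assert (P := INR_fact_lt_0 k). assert (Q := pos_INR k).
  rewrite Rmult_comm. apply Rmult_le_compat; lra.
Qed.

Definition hyp0F1_coef (c : R) (k : nat) : R := / (pochhammer c k * INR (fact k)).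

Lemma hyp0F1_coef_bound c k : 1 <= c ->
  0 <= hyp0F1_coef c k <= / INR (fact k) * / INR (fact k).
Proof.
  intros Hc. assert (P := INR_fact_lt_0 k). assert (Q := pochhammer_ge_fact c k Hc).
  unfold hyp0F1_coef. split.
  - left. apply Rinv_0_lt_compat. apply Rmult_lt_0_compat; lra.
  - rewrite <- Rinv_mult. apply Rinv_le_contravar.
    + now apply Rmult_lt_0_compat.
    + apply Rmult_le_compat_r; lra.
Qed.

Lemma hyp0F1_term c z k : 1 <= c ->
  (z ^ k / RtoC (pochhammer c k * INR (fact k)))%C = (RtoC (hyp0F1_coef c k) * z ^ k)%C.
Proof.
  intros Hc. assert (P := INR_fact_lt_0 k). assert (Q := pochhammer_ge_fact c k Hc).
  unfold hyp0F1_coef. rewrite RtoC_inv; [unfold Cdiv; ring|].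
  apply Rgt_not_eq. apply Rmult_lt_0_compat; lra.
Qed.

Lemma Cmod_hyp0F1_term c z k : 1 <= c ->
  Cmod (z ^ k / RtoC (pochhammer c k * INR (fact k))) <= Cmod z ^ k / INR (fact k) * / INR (fact k).
Proof.
  intros Hc. rewrite hyp0F1_term by assumption.
  destruct (hyp0F1_coef_bound c k Hc) as [A B].
  rewrite Cmod_mult, Cmod_R, Cmod_pow, Rabs_right by lra.
  unfold Rdiv. rewrite Rmult_comm, Rmult_assoc. apply Rmult_le_compat_l; [|assumption].
  apply pow_le, Cmod_ge_0.
Qed.

Lemma pow_div_fact_le_exp x k : 0 <= x -> x ^ k / INR (fact k) <= exp x.
Proof.
  intros Hx.
  assert (T : forall j, 0 <= x ^ j / INR (fact j)).
  { intros j. apply Rmult_le_pos; [now apply pow_le|]. left; apply Rinv_0_lt_compat, INR_fact_lt_0. }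
  assert (Hs := series_nonneg_partial _ _ k T (is_series_exp x)).
  eapply Rle_trans; [|exact Hs]. destruct k as [|k].
  - rewrite sum_O. lra.
  - rewrite sum_Sn. unfold plus; simpl Rplus.
    assert (0 <= sum_n (fun k => x ^ k / INR (fact k)) k).
    { clear Hs. induction k as [|k IH]; [now rewrite sum_O|]. rewrite sum_Sn.
      unfold plus; simpl Rplus. apply Rplus_le_le_0_compat; [exact IH|apply T]. }
    simpl in *. lra.
Qed.

(* [0F1] has order 1/2, hence grows slower than every [exp (d |z|)]. *)
Lemma Cmod_hyp0F1_le c d z : 1 <= c -> 0 < d ->
  Cmod (hyp0F1 c z) <= 2 * exp (/ d) * exp (d * Cmod z).
Proof.
  intros Hc Hd. rewrite Rmult_assoc.
  apply (Cmod_CSeries_le _ (fun k => exp (/ d) * ((d * Cmod z) ^ k / INR (fact k)))).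
  - intros k. eapply Rle_trans; [now apply Cmod_hyp0F1_term|].
    assert (F := INR_fact_lt_0 k).
    (* One factorial is spent on the constant [exp (1 / d)]; the other sums the powers of [d |z|] to
       an exponential. *)
    assert (I : / d ^ k * / INR (fact k) <= exp (/ d)).
    { rewrite <- pow_inv. apply pow_div_fact_le_exp. left. now apply Rinv_0_lt_compat. }
    assert (D := pow_lt d k Hd).
    replace (Cmod z ^ k / INR (fact k) * / INR (fact k))
      with ((/ d ^ k * / INR (fact k)) * ((d * Cmod z) ^ k / INR (fact k))).
    + apply Rmult_le_compat_r; [|exact I].
      apply Rmult_le_pos; [|left; now apply Rinv_0_lt_compat].
      apply pow_le. apply Rmult_le_pos; [lra|apply Cmod_ge_0].
    + rewrite Rpow_mult_distr. field. split; lra.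
  - apply (is_series_scal (exp (/ d)) (fun k => (d * Cmod z) ^ k / INR (fact k)) (exp (d * Cmod z))).
    apply is_series_exp.
Qed.

(** On [|v| <= M'] the terms are dominated by [M' ^ k / k!], so the Taylor polynomials converge
    uniformly, at the speed of the exponential series at [M']. *)
Lemma entire_hyp0F1 c : 1 <= c -> entire (hyp0F1 c).
Proof.
  intros Hc M eps He. set (M' := Rmax M 0). assert (HM' : 0 <= M') by apply Rmax_r.
  assert (Hs := is_series_exp M').
  assert (He2 : 0 < eps / 2) by lra.
  assert (L := proj2 (is_lim_seq_spec (sum_n (fun k => M' ^ k / INR (fact k))) (exp M')) Hs
                 (mkposreal _ He2)).
  destruct L as (n & Hn). specialize (Hn n (Nat.le_refl n)). simpl in Hn.
  exists (map (fun k => RtoC (hyp0F1_coef c k)) (seq 0 (S n))). intros v Hv.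
  rewrite <- psum_peval.
  apply Rle_trans with (2 * (exp M' - sum_n (fun k => M' ^ k / INR (fact k)) n)).
  2: { apply Rabs_lt_between in Hn. lra. }
  assert (Hp : forall m, psum (fun k => RtoC (hyp0F1_coef c k)) (S m) v
     = (sum_n (fun k => Re (v ^ k / RtoC (pochhammer c k * INR (fact k)))) m,
        sum_n (fun k => Im (v ^ k / RtoC (pochhammer c k * INR (fact k)))) m)).
  { induction m as [|m IHm].
    - rewrite !sum_O, hyp0F1_term by assumption. apply C_eq; simpl; ring.
    - change (psum (fun k => RtoC (hyp0F1_coef c k)) (S (S m)) v)
        with (psum (fun k => RtoC (hyp0F1_coef c k)) (S m) v
              + RtoC (hyp0F1_coef c (S m)) * v ^ S m)%C.
      rewrite IHm, !sum_Sn, <- hyp0F1_term by assumption. reflexivity. }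
  apply Cmod_CSeries_tail_le.
  - intros k. eapply Rle_trans; [now apply Cmod_hyp0F1_term|].
    assert (F := INR_fact_lt_0 k).
    assert (Hv' : Cmod v <= M') by (eapply Rle_trans; [exact Hv|apply Rmax_l]).
    assert (I : / INR (fact k) <= 1).
    { rewrite <- Rinv_1. apply Rinv_le_contravar; [lra|]. apply (le_INR 1), lt_O_fact. }
    assert (I0 : 0 < / INR (fact k)) by now apply Rinv_0_lt_compat.
    assert (P : Cmod v ^ k <= M' ^ k) by (apply pow_incr; split; [apply Cmod_ge_0|assumption]).
    assert (P0 : 0 <= Cmod v ^ k) by (apply pow_le, Cmod_ge_0).
    assert (Q : Cmod v ^ k / INR (fact k) <= M' ^ k / INR (fact k)) by (apply Rmult_le_compat_r; lra).
    assert (Q0 : 0 <= Cmod v ^ k / INR (fact k)) by (apply Rmult_le_pos; lra).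
    eapply Rle_trans; [|exact Q]. rewrite <- (Rmult_1_r (Cmod v ^ k / INR (fact k))) at 2.
    now apply Rmult_le_compat_l.
  - exact Hs.
  - now rewrite Hp.
  - now rewrite Hp.
Qed.

(** * Improper integrals *)

(** A form of [is_RInt_gen] in terms of [Cmod]. Existence of the proper integrals up to every large
    [T] is part of it. *)
Definition is_improper (f : R -> C) (l : C) : Prop :=
  forall eps, 0 < eps -> exists M, 0 <= M /\
    forall T, M <= T -> exists y, is_CInt f 0 T y /\ Cmod (y - l) < eps.

Lemma is_improper_integral_0_oo f l : is_improper f l -> integral_0_oo f = l.
Proof.
  intros H. unfold integral_0_oo.
  apply (is_RInt_gen_unique (V := C_R_CompleteNormedModule)).
  intros P [eps HP].
  destruct (H eps (cond_pos eps)) as (M & HM & K).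
  exists (fun a => a = 0) (fun b => M < b).
  - reflexivity.
  - exists M. auto.
  - intros a b -> Hb. destruct (K b) as (y & Hy & Hyl); [lra|].
    exists y; split; [exact Hy|]. apply HP.
    split.
    + eapply Rle_lt_trans; [|exact Hyl].
      eapply Rle_trans; [|apply re_le_Cmod]. right. reflexivity.
    + eapply Rle_lt_trans; [|exact Hyl].
      eapply Rle_trans; [|apply im_le_Cmod]. right. reflexivity.
Qed.

Lemma is_RInt_exp_decay A c a b : 0 < c ->
  is_RInt (fun u => A * exp (- c * u)) a b (A / c * (exp (- c * a) - exp (- c * b))).
Proof.
  intros Hc.
  replace (A / c * (exp (- c * a) - exp (- c * b)))
    with (minus (- A / c * exp (- c * b)) (- A / c * exp (- c * a)))
    by (unfold minus, plus, opp; simpl; field; lra).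
  apply (is_RInt_derive (V := R_CompleteNormedModule) (fun u => - A / c * exp (- c * u))).
  - intros x _. auto_derive; [exact I|]. field. lra.
  - intros x _. apply (@ex_derive_continuous R_AbsRing R_NormedModule). auto_derive. exact I.
Qed.

Lemma exp_le_compat x y : x <= y -> exp x <= exp y.
Proof. intros [H|<-]; [left; now apply exp_increasing|lra]. Qed.

Lemma exp_decay_small B c eps : 0 < c -> 0 <= B -> 0 < eps ->
  exists M, 0 <= M /\ forall T, M <= T -> B * exp (- c * T) < eps.
Proof.
  intros Hc HB He.
  (* From [x < exp x]: beyond this threshold [B <= c T eps < exp (c T) eps]. *)
  exists (B / (c * eps)). split.
  { apply Rmult_le_pos; [assumption|]. left. apply Rinv_0_lt_compat. now apply Rmult_lt_0_compat. }
  intros T HT.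
  assert (H1 : B <= c * T * eps).
  { apply (Rmult_le_compat_r (c * eps)) in HT; [|apply Rlt_le; now apply Rmult_lt_0_compat].
    unfold Rdiv in HT. rewrite Rmult_assoc, Rinv_l, Rmult_1_r in HT; [lra|].
    apply Rgt_not_eq. now apply Rmult_lt_0_compat. }
  replace (- c * T) with (- (c * T)) by ring. rewrite exp_Ropp.
  assert (E := exp_pos (c * T)).
  apply (Rmult_lt_reg_r (exp (c * T))); [assumption|].
  rewrite Rmult_assoc, Rinv_l, Rmult_1_r by lra.
  assert (X := exp_ineq1_le (c * T)).
  assert (c * T * eps < exp (c * T) * eps) by (apply Rmult_lt_compat_r; lra). lra.
Qed.

Lemma is_CInt_exp_bound (f : R -> C) A c T l :
  0 < c -> 0 <= T -> 0 <= A -> (forall u, 0 <= u -> Cmod (f u) <= A * exp (- c * u)) ->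
  is_CInt f 0 T l -> Cmod l <= A / c.
Proof.
  intros Hc HT HA H Hl.
  apply Rle_trans with (A / c * (exp (- c * 0) - exp (- c * T))).
  - apply (is_CInt_le f (fun u => A * exp (- c * u)) 0 T l); try assumption.
    + intros t Ht. apply H. lra.
    + now apply is_RInt_exp_decay.
  - rewrite Rmult_0_r, exp_0. assert (E := exp_pos (- c * T)).
    rewrite <- (Rmult_1_r (A / c)) at 2. apply Rmult_le_compat_l; [|lra].
    apply Rmult_le_pos; [assumption|]. left; now apply Rinv_0_lt_compat.
Qed.

(** Cauchy's criterion for the proper integrals, whose increment from [a] to a later point is at
    most [A / c] times [exp (- c a)]. The bound [A / c], valid for each of them, passes to the
    limit. *)
Lemma exp_dominated_improper (f : R -> C) A c :
  0 < c -> (forall T, 0 <= T -> exists l, is_CInt f 0 T l) ->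
  (forall u, 0 <= u -> Cmod (f u) <= A * exp (- c * u)) ->
  exists l, is_improper f l /\ Cmod l <= A / c.
Proof.
  intros Hc Hex Hb.
  assert (HA : 0 <= A).
  { specialize (Hb 0 (Rle_refl 0)). rewrite Rmult_0_r, exp_0, Rmult_1_r in Hb.
    assert (P := Cmod_ge_0 (f 0)). lra. }
  set (I := fun T => RInt (V := C_R_CompleteNormedModule) f 0 T).
  assert (HI : forall T, 0 <= T -> is_CInt f 0 T (I T)).
  { intros T HT. destruct (Hex T HT) as [l Hl]. unfold I. now rewrite (is_CInt_unique _ _ _ _ Hl). }
  assert (HD : forall a b, 0 <= a -> a <= b -> Cmod (I b - I a) <= A / c * exp (- c * a)).
  { intros a b Ha Hab.
    assert (D : is_CInt f a b (I b - I a)%C).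
    { apply (is_RInt_ext (V := C_R_NormedModule) f); [reflexivity|].
      replace (I b - I a)%C with (plus (opp (I a)) (I b) : C_R_NormedModule)
        by (change (- I a + I b = I b - I a)%C; ring).
      apply (is_RInt_Chasles (V := C_R_NormedModule) f a 0 b).
      - apply (is_RInt_swap (V := C_R_NormedModule)). apply HI; lra.
      - apply HI; lra. }
    apply Rle_trans with (A / c * (exp (- c * a) - exp (- c * b))).
    - apply (is_CInt_le f (fun u => A * exp (- c * u)) a b); try assumption.
      + intros t Ht. apply Hb. lra.
      + now apply is_RInt_exp_decay.
    - apply Rmult_le_compat_l; [|assert (E := exp_pos (- c * b)); lra].
      apply Rmult_le_pos; [assumption|]. left; now apply Rinv_0_lt_compat. }
  assert (HAc : 0 <= A / c) by (apply Rmult_le_pos; [assumption|left; now apply Rinv_0_lt_compat]).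
  assert (HC : exists l : C,
            filterlim I (Rbar_locally p_infty) (@locally C_R_CompleteNormedModule l)).
  { apply (proj1 (filterlim_locally_cauchy (U := C_R_CompleteNormedModule)
                    (F := Rbar_locally p_infty) I)). intros eps.
    destruct (exp_decay_small (A / c) c (eps) Hc HAc (cond_pos eps)) as (M & HM & K).
    exists (fun T => M < T). split; [exists M; auto|].
    assert (G : forall u v, M < u -> u <= v -> Cmod (I v - I u) < eps).
    { intros u v Hu Huv. eapply Rle_lt_trans; [apply HD; lra|]. apply K. lra. }
    assert (G' : forall u v, M < u -> M < v -> Cmod (I v - I u) < eps).
    { intros u v Hu Hv. destruct (Rle_dec u v); [now apply G|]. rewrite Cmod_sub_sym. apply G; lra. }
    intros u v Hu Hv. specialize (G' u v Hu Hv). split.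
    - eapply Rle_lt_trans; [|exact G']. eapply Rle_trans; [|apply re_le_Cmod]. right. reflexivity.
    - eapply Rle_lt_trans; [|exact G']. eapply Rle_trans; [|apply im_le_Cmod]. right. reflexivity. }
  destruct HC as [l Hl].
  assert (Him : is_improper f l).
  { intros eps He. assert (He2 : 0 < eps / 2) by lra.
    destruct (proj1 (filterlim_locally _ _) Hl (mkposreal _ He2)) as (M & HM).
    exists (Rmax 0 (M + 1)). split; [apply Rmax_l|]. intros T HT.
    assert (T1 := Rmax_l 0 (M + 1)). assert (T2 := Rmax_r 0 (M + 1)).
    exists (I T). split; [apply HI; lra|].
    destruct (HM T) as [B1 B2]; [lra|].
    eapply Rle_lt_trans; [apply Cmod_le_abs|].
    unfold ball in B1, B2; simpl in B1, B2. unfold AbsRing_ball, abs, minus, plus, opp in B1, B2; simpl in B1, B2.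
    simpl. unfold Re, Im in *. lra. }
  exists l. split; [exact Him|].
  apply Rle_plus_epsilon. intros eps He.
  destruct (Him eps He) as (M & HM & K). destruct (K M (Rle_refl M)) as (y & Hy & Hyl).
  assert (By := is_CInt_exp_bound f A c M y Hc HM HA Hb Hy).
  rewrite Cmod_sub_sym in Hyl.
  replace l with (y + (l - y))%C by ring.
  eapply Rle_trans; [apply Cmod_triangle|]. lra.
Qed.

Lemma is_improper_ext f h l :
  (forall u, 0 <= u -> f u = h u) -> is_improper f l -> is_improper h l.
Proof.
  intros H Hf eps He. destruct (Hf eps He) as (M & HM & K). exists M; split; [assumption|].
  intros T HT. destruct (K T HT) as (y & Hy & Hyl). exists y; split; [|assumption].
  eapply is_CInt_ext; [|exact Hy]. rewrite Rmin_left, Rmax_right by lra. intros; apply H; lra.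
Qed.

Lemma is_improper_plus f h l k :
  is_improper f l -> is_improper h k -> is_improper (fun u => f u + h u)%C (l + k)%C.
Proof.
  intros Hf Hh eps He.
  destruct (Hf (eps / 2)) as (M1 & HM1 & K1); [lra|].
  destruct (Hh (eps / 2)) as (M2 & HM2 & K2); [lra|].
  assert (A1 := Rmax_l M1 M2). assert (A2 := Rmax_r M1 M2).
  exists (Rmax M1 M2); split; [lra|]. intros T HT.
  destruct (K1 T) as (y1 & Hy1 & B1); [lra|]. destruct (K2 T) as (y2 & Hy2 & B2); [lra|].
  exists (y1 + y2)%C; split; [now apply is_CInt_plus|].
  replace (y1 + y2 - (l + k))%C with ((y1 - l) + (y2 - k))%C by ring.
  eapply Rle_lt_trans; [apply Cmod_triangle|]. lra.
Qed.

Lemma is_improper_scal c f l :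
  is_improper f l -> is_improper (fun u => c * f u)%C (c * l)%C.
Proof.
  intros Hf eps He.
  assert (P := Cmod_ge_0 c).
  destruct (Hf (eps / (Cmod c + 1))) as (M & HM & K); [apply Rdiv_lt_0_compat; lra|].
  exists M; split; [assumption|]. intros T HT.
  destruct (K T HT) as (y & Hy & B). exists (c * y)%C; split; [now apply is_CInt_scal|].
  replace (c * y - c * l)%C with (c * (y - l))%C by ring. rewrite Cmod_mult.
  assert (Q := Cmod_ge_0 (y - l)).
  apply (Rmult_lt_compat_r (Cmod c + 1)) in B; [|lra].
  unfold Rdiv in B. rewrite Rmult_assoc, Rinv_l in B by lra. nra.
Qed.

Lemma is_improper_comp_scale k f l :
  0 < k -> is_improper f l -> is_improper (fun u => f (k * u)) (/ RtoC k * l)%C.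
Proof.
  intros Hk Hf.
  assert (N : RtoC k <> 0%C) by (intros E; apply RtoC_inj in E; lra).
  apply (is_improper_ext (fun u => / RtoC k * (RtoC k * f (k * u)%R))%C).
  { intros u _. field. exact N. }
  apply is_improper_scal.
  intros eps He. destruct (Hf eps He) as (M & HM & K).
  exists (M / k); split.
  { apply Rmult_le_pos; [assumption|]. left; now apply Rinv_0_lt_compat. }
  intros T HT.
  assert (HT' : M <= k * T).
  { apply (Rmult_le_compat_l k) in HT; [|lra]. replace (k * (M / k)) with M in HT by (field; lra). exact HT. }
  destruct (K _ HT') as (y & Hy & B). exists y; split; [|assumption].
  assert (L := is_RInt_comp_lin (V := C_R_NormedModule) f k 0 0 T y).
  rewrite Rmult_0_r, !Rplus_0_r in L.
  eapply is_CInt_ext; [|apply L; exact Hy].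
  intros x _. cbv beta. rewrite Rplus_0_r.
  unfold scal; simpl. unfold prod_scal, scal; simpl. unfold mult; simpl.
  apply C_eq; simpl; unfold Re, Im; ring.
Qed.

(** * Asymptotic estimates *)

(** A substitute for the complex logarithm: [X = 1 + O(1 / n ^ 2)] yields [X ^ n = 1 + O(1 / n)]. *)
Lemma Cmod_pow_sub_1 X d n : Cmod (X - 1) <= d -> Cmod (X ^ n - 1) <= INR n * d * (1 + d) ^ n.
Proof.
  intros H. assert (Hd : 0 <= d) by (eapply Rle_trans; [apply Cmod_ge_0|exact H]).
  assert (HX : Cmod X <= 1 + d).
  { replace X with (1 + (X - 1))%C by ring. eapply Rle_trans; [apply Cmod_triangle|].
    rewrite Cmod_1. lra. }
  induction n as [|n IH].
  - simpl. replace (1 - 1)%C with (RtoC 0) by ring. rewrite Cmod_0. lra.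
  - replace (X ^ S n - 1)%C with (X * (X ^ n - 1) + (X - 1))%C by (simpl; ring).
    eapply Rle_trans; [apply Cmod_triangle|]. rewrite Cmod_mult, S_INR.
    assert (P : 1 <= (1 + d) ^ S n) by (apply pow_R1_Rle; lra).
    apply Rle_trans with ((1 + d) * (INR n * d * (1 + d) ^ n) + d).
    + apply Rplus_le_compat; [|assumption]. apply Rmult_le_compat; auto using Cmod_ge_0.
    + simpl in *. assert (d <= d * ((1 + d) * (1 + d) ^ n)) by nra. lra.
Qed.

Lemma pow_le_exp x n : 0 <= x -> (1 + x) ^ n <= exp (INR n * x).
Proof.
  intros Hx. rewrite <- Rpower_pow by lra. unfold Rpower. apply exp_le_compat.
  apply Rmult_le_compat_l; [apply pos_INR|].
  rewrite <- (ln_exp x) at 2. apply Rcomplements.ln_le; [lra|].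
  apply exp_ineq1_le.
Qed.

Lemma Cmod_one_plus_ge z : Cmod z <= / 2 -> / 2 <= Cmod (1 + z).
Proof.
  intros H. assert (T := Cmod_triangle_sub (1 + z) z).
  replace (1 + z - z)%C with (RtoC 1) in T by ring. rewrite Cmod_1 in T. lra.
Qed.

(** The quantity is the [n]-th power of [X = exp (z / n) / (1 + z / (m + n))]. Numerator and
    denominator agree to first order, except that [z / n] and [z / (m + n)] differ by at most
    [M m / n ^ 2]; hence [X = 1 + O(1 / n ^ 2)]. The mismatch of [n] and [m + n] arises because [m]
    of the [N] factors are spikes. *)
Lemma compound_interest_complex M m : 0 <= M ->
  exists K N0, 0 <= K /\ (0 < N0)%nat /\ forall n z, (N0 <= n)%nat -> Cmod z <= M ->
    Cmod (Cexp z * (/ (1 + z / RtoC (INR (m + n)))) ^ n - 1) <= K / INR n.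
Proof.
  intros HM.
  (* Once [n >= 2 M], one has [|z / n| <= 1 / 2]: the quadratic remainder is then at most [exp 1]
     times the square, and dividing by [1 + z / (m + n)] costs a factor 2. *)
  set (k := 2 * (exp 1 * M ^ 2 + M * INR m)).
  assert (Hm := pos_INR m).
  assert (Hk : 0 <= k).
  { unfold k. assert (0 <= exp 1 * M ^ 2) by (apply Rmult_le_pos; [left; apply exp_pos|apply pow2_ge_0]).
    assert (0 <= M * INR m) by now apply Rmult_le_pos. lra. }
  destruct (INR_unbounded (2 * M)) as [N0 HN0].
  exists (k * exp k), (S N0). repeat split; [|lia|].
  { apply Rmult_le_pos; [assumption|left; apply exp_pos]. }
  intros n z Hn Hz.
  assert (Hn1 : 1 <= INR n) by (apply (le_INR 1); lia).
  assert (HnM : 2 * M <= INR n).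
  { apply Rle_trans with (INR N0); [lra|]. apply le_INR. lia. }
  rewrite plus_INR.
  assert (Nn : RtoC (INR n) <> 0%C) by (intros E; apply RtoC_inj in E; lra).
  assert (NN : RtoC (INR m + INR n) <> 0%C) by (intros E; apply RtoC_inj in E; lra).
  assert (B1 : Cmod (z / RtoC (INR n)) <= M / INR n).
  { rewrite Cmod_div, Cmod_R, Rabs_right by (assumption || lra).
    apply Rmult_le_compat_r; [left; apply Rinv_0_lt_compat; lra|assumption]. }
  assert (I1 : M / INR n <= / 2).
  { apply (Rmult_le_reg_r (INR n)); [lra|]. unfold Rdiv. rewrite Rmult_assoc, Rinv_l by lra. lra. }
  assert (B2 : Cmod (z / RtoC (INR m + INR n)) <= / 2).
  { rewrite Cmod_div, Cmod_R, Rabs_right by (assumption || lra).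
    apply Rle_trans with (M / INR n); [|assumption].
    apply Rmult_le_compat; [apply Cmod_ge_0|left; apply Rinv_0_lt_compat; lra|assumption|].
    apply Rinv_le_contravar; lra. }
  assert (Hinv := Cmod_one_plus_ge _ B2).
  assert (N1 : (1 + z / RtoC (INR m + INR n))%C <> 0%C).
  { apply Cmod_gt_0. lra. }
  set (X := (Cexp (z / RtoC (INR n)) * / (1 + z / RtoC (INR m + INR n)))%C).
  assert (EX : (Cexp z * (/ (1 + z / RtoC (INR m + INR n))) ^ n)%C = (X ^ n)%C).
  { assert (P : forall j, (Cexp (z / RtoC (INR n)) ^ j)%C = Cexp (RtoC (INR j) * (z / RtoC (INR n)))).
    { induction j as [|j IH].
      - simpl. replace (0 * (z / RtoC (INR n)))%C with (RtoC 0) by ring. now rewrite Cexp_0.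
      - rewrite S_INR, RtoC_plus.
        replace ((RtoC (INR j) + 1) * (z / RtoC (INR n)))%C
          with (z / RtoC (INR n) + RtoC (INR j) * (z / RtoC (INR n)))%C by ring.
        rewrite Cexp_plus, <- IH. reflexivity. }
    unfold X. rewrite Cpow_mult_l, P. f_equal. f_equal. field. assumption. }
  rewrite EX.
  assert (HX : Cmod (X - 1) <= k / (INR n) ^ 2).
  { replace (X - 1)%C with (((Cexp (z / RtoC (INR n)) - 1 - z / RtoC (INR n))
        + (z / RtoC (INR n) - z / RtoC (INR m + INR n))) * / (1 + z / RtoC (INR m + INR n)))%C
      by (unfold X; field; repeat split; try assumption; intros E; apply N1;
          replace (1 + z / RtoC (INR m + INR n))%C
            with ((RtoC (INR m + INR n) + z) / RtoC (INR m + INR n))%C by (field; assumption);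
          rewrite E; unfold Cdiv; ring).
    rewrite Cmod_mult, Cmod_inv by assumption.
    assert (D1 : / Cmod (1 + z / RtoC (INR m + INR n)) <= 2).
    { rewrite <- (Rinv_inv 2). apply Rinv_le_contravar; lra. }
    assert (D2 : Cmod (Cexp (z / RtoC (INR n)) - 1 - z / RtoC (INR n)) <= exp 1 * (M / INR n) ^ 2).
    { eapply Rle_trans; [apply Cexp_sub_1_sub|].
      apply Rmult_le_compat; [left; apply exp_pos|apply pow2_ge_0| |].
      - apply exp_le_compat. lra.
      - apply pow_incr. split; [apply Cmod_ge_0|assumption]. }
    assert (D3 : Cmod (z / RtoC (INR n) - z / RtoC (INR m + INR n)) <= M * INR m / (INR n) ^ 2).
    { replace (z / RtoC (INR n) - z / RtoC (INR m + INR n))%C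
        with (z * RtoC (INR m / (INR n * (INR m + INR n))))%C.
      - rewrite Cmod_mult, Cmod_R.
        assert (Q : 0 < INR n * (INR m + INR n)) by (apply Rmult_lt_0_compat; lra).
        assert (Q' := Rinv_0_lt_compat _ Q).
        rewrite Rabs_right by (apply Rle_ge, Rmult_le_pos; lra).
        unfold Rdiv. rewrite Rmult_assoc.
        apply Rmult_le_compat; [apply Cmod_ge_0|apply Rmult_le_pos; lra|assumption|].
        apply Rmult_le_compat_l; [assumption|]. apply Rinv_le_contravar; [|simpl; nra].
        apply pow_lt. lra.
      - unfold Rdiv. rewrite RtoC_mult, RtoC_inv, !RtoC_mult, RtoC_plus in * by nra.
        field. split; assumption. }
    apply Rle_trans with ((exp 1 * (M / INR n) ^ 2 + M * INR m / INR n ^ 2) * 2).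
    - apply Rmult_le_compat; [apply Cmod_ge_0|left; apply Rinv_0_lt_compat; lra| |assumption].
      eapply Rle_trans; [apply Cmod_triangle|]. lra.
    - right. unfold k. field. lra. }
  eapply Rle_trans; [apply (Cmod_pow_sub_1 X (k / INR n ^ 2) n HX)|].
  assert (Hd : 0 <= k / INR n ^ 2).
  { apply Rmult_le_pos; [assumption|]. left. apply Rinv_0_lt_compat, pow_lt. lra. }
  assert (HP : (1 + k / INR n ^ 2) ^ n <= exp k).
  { eapply Rle_trans; [now apply pow_le_exp|]. apply exp_le_compat.
    replace (INR n * (k / INR n ^ 2)) with (k * / INR n) by (field; lra).
    rewrite <- (Rmult_1_r k) at 2. apply Rmult_le_compat_l; [assumption|].
    rewrite <- Rinv_1. apply Rinv_le_contravar; lra. }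
  apply Rle_trans with (INR n * (k / INR n ^ 2) * exp k).
  - apply Rmult_le_compat_l; [|assumption]. apply Rmult_le_pos; lra.
  - right. field. lra.
Qed.

Lemma one_minus_pow_le q n : 0 <= q <= 1 -> 1 - q ^ n <= INR n * (1 - q).
Proof.
  intros Hq. induction n as [|n IH]; [simpl; lra|].
  rewrite S_INR. simpl.
  assert (P : 0 <= q ^ n) by (apply pow_le; lra).
  assert (P1 : q ^ n <= 1) by (rewrite <- (pow1 n); apply pow_incr; lra).
  nra.
Qed.

Lemma exp_opp_ge x : 1 - x <= exp (- x).
Proof.
  assert (H := exp_ineq1_le (- x)). lra.
Qed.

(** With [x = t / (m + n)] and [q = (1 + x) exp (- x)], the product is [q ^ n exp (- m x)]. Since
    [1 - x ^ 2 <= q <= 1], a Bernoulli inequality gives the rate. Unlike in the complex estimate,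
    [t] ranges over the whole half line. *)
Lemma compound_interest_real m n t : (0 < n)%nat -> 0 <= t ->
  0 <= (1 + t / INR (m + n)) ^ n * exp (- t) <= 1 /\
  1 - (1 + t / INR (m + n)) ^ n * exp (- t) <= (t ^ 2 + t * INR m) / INR (m + n).
Proof.
  intros Hn Ht.
  assert (HN : 0 < INR (m + n)) by (apply lt_0_INR; lia).
  assert (Hm := pos_INR m). assert (Hn0 := pos_INR n).
  set (x := t / INR (m + n)).
  assert (Hx : 0 <= x) by (apply Rmult_le_pos; [assumption|left; now apply Rinv_0_lt_compat]).
  assert (Et : t = INR n * x + INR m * x).
  { unfold x. rewrite plus_INR in *. field. lra. }
  set (q := (1 + x) * exp (- x)).
  assert (Hq : 0 <= q <= 1).
  { unfold q. assert (E := exp_pos (- x)). split; [apply Rmult_le_pos; lra|].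
    rewrite exp_Ropp. apply (Rmult_le_reg_r (exp x)); [apply exp_pos|].
    rewrite Rmult_assoc, Rinv_l, Rmult_1_l, Rmult_1_r by (apply Rgt_not_eq, exp_pos).
    apply exp_ineq1_le. }
  assert (Hq2 : 1 - q <= x ^ 2).
  { unfold q. assert (E := exp_opp_ge x).
    assert ((1 + x) * (1 - x) <= (1 + x) * exp (- x)) by (apply Rmult_le_compat_l; lra).
    lra. }
  assert (EA : (1 + x) ^ n * exp (- t) = q ^ n * exp (- (INR m * x))).
  { unfold q. rewrite Rpow_mult_distr.
    assert (P : forall j, exp (- x) ^ j = exp (- (INR j * x))).
    { induction j as [|j IH]; [simpl; rewrite Rmult_0_l, Ropp_0, exp_0; reflexivity|].
      rewrite S_INR. simpl. rewrite IH, <- exp_plus. f_equal. ring. }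
    rewrite P, Rmult_assoc, <- exp_plus. f_equal. f_equal. rewrite Et. ring. }
  rewrite EA.
  assert (Hp : 0 <= q ^ n <= 1).
  { split; [apply pow_le; lra|]. rewrite <- (pow1 n); apply pow_incr; lra. }
  assert (Hmx : 0 <= INR m * x) by now apply Rmult_le_pos.
  assert (He : 0 < exp (- (INR m * x)) <= 1).
  { split; [apply exp_pos|]. rewrite <- exp_0. apply exp_le_compat. lra. }
  split; [nra|].
  assert (B1 := one_minus_pow_le q n Hq).
  assert (B2 := exp_opp_ge (INR m * x)).
  assert (B3 : INR n * (1 - q) <= INR n * x ^ 2) by now apply Rmult_le_compat_l.
  apply Rle_trans with (INR n * x ^ 2 + INR m * x); [nra|].
  apply Rle_trans with (INR (m + n) * x ^ 2 + INR m * x).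
  - apply Rplus_le_compat_r. apply Rmult_le_compat_r; [apply pow2_ge_0|]. rewrite plus_INR. lra.
  - right. unfold x. field. lra.
Qed.

(** * Subexponential growth *)

Definition subexp (g : R -> R) : Prop :=
  forall d, 0 < d -> exists A, 0 <= A /\ forall s, 0 <= s -> Rabs (g s) <= A * exp (d * s).

Lemma subexp_const c : subexp (fun _ => c).
Proof.
  intros d Hd. exists (Rabs c); split; [apply Rabs_pos|]. intros s Hs.
  rewrite <- (Rmult_1_r (Rabs c)) at 1. apply Rmult_le_compat_l; [apply Rabs_pos|].
  rewrite <- exp_0. apply exp_le_compat. apply Rmult_le_pos; lra.
Qed.

Lemma subexp_id : subexp (fun s => s).
Proof.
  intros d Hd. exists (/ d); split; [left; now apply Rinv_0_lt_compat|]. intros s Hs.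
  rewrite Rabs_right by lra.
  assert (H := pow_div_fact_le_exp (d * s) 1 ltac:(apply Rmult_le_pos; lra)).
  simpl in H. apply (Rmult_le_reg_l d); [assumption|]. rewrite <- Rmult_assoc, Rinv_r by lra. lra.
Qed.

Lemma subexp_plus g h : subexp g -> subexp h -> subexp (fun s => g s + h s).
Proof.
  intros Hg Hh d Hd. destruct (Hg d Hd) as (A & HA & KA). destruct (Hh d Hd) as (B & HB & KB).
  exists (A + B); split; [lra|]. intros s Hs. eapply Rle_trans; [apply Rabs_triang|].
  rewrite Rmult_plus_distr_r. apply Rplus_le_compat; auto.
Qed.

(** Each factor gets half of the rate, which is why the definition asks for every positive rate. *)
Lemma subexp_mult g h : subexp g -> subexp h -> subexp (fun s => g s * h s).
Proof.
  intros Hg Hh d Hd. assert (Hd2 : 0 < d / 2) by lra.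
  destruct (Hg _ Hd2) as (A & HA & KA). destruct (Hh _ Hd2) as (B & HB & KB).
  exists (A * B); split; [now apply Rmult_le_pos|]. intros s Hs. rewrite Rabs_mult.
  replace (d * s) with (d / 2 * s + d / 2 * s) by field. rewrite exp_plus.
  replace (A * B * (exp (d / 2 * s) * exp (d / 2 * s)))
    with ((A * exp (d / 2 * s)) * (B * exp (d / 2 * s))) by ring.
  apply Rmult_le_compat; auto using Rabs_pos.
Qed.

Lemma subexp_ext g h : (forall s, 0 <= s -> g s = h s) -> subexp g -> subexp h.
Proof.
  intros H Hg d Hd. destruct (Hg d Hd) as (A & HA & K). exists A; split; [assumption|].
  intros s Hs. rewrite <- H by assumption. auto.
Qed.

Lemma subexp_le g h : (forall s, 0 <= s -> Rabs (h s) <= g s) -> subexp g -> subexp h.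
Proof.
  intros H Hg d Hd. destruct (Hg d Hd) as (A & HA & K). exists A; split; [assumption|].
  intros s Hs. eapply Rle_trans; [now apply H|]. eapply Rle_trans; [apply Rle_abs|auto].
Qed.

Lemma subexp_hyp0F1 c x : 1 <= c -> subexp (fun s => Cmod (hyp0F1 c (- (RtoC s * RtoC x)))).
Proof.
  intros Hc d Hd.
  (* So that [r |x| <= d]; the added 1 covers [x = 0]. *)
  set (r := d / (Rabs x + 1)).
  assert (Hx := Rabs_pos x).
  assert (Hr : 0 < r) by (apply Rdiv_lt_0_compat; lra).
  exists (2 * exp (/ r)); split; [assert (E := exp_pos (/ r)); lra|].
  intros s Hs. rewrite Rabs_right by (apply Rle_ge, Cmod_ge_0).
  eapply Rle_trans; [apply (Cmod_hyp0F1_le c r); assumption|].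
  apply Rmult_le_compat_l; [assert (E := exp_pos (/ r)); lra|].
  apply exp_le_compat. rewrite Cmod_opp, Cmod_mult, !Cmod_R, (Rabs_right s) by lra.
  unfold r. apply (Rmult_le_reg_r (Rabs x + 1)); [lra|].
  replace (d / (Rabs x + 1) * (s * Rabs x) * (Rabs x + 1)) with (d * s * Rabs x) by (field; lra).
  apply Rmult_le_compat_l; [apply Rmult_le_pos; lra|lra].
Qed.

(** * Cauchy transforms on the half line *)

Definition cauchy_transform (p : path) (B : C -> C) (s : R) : C :=
  contour_integral (fun w => B w * cauchy_kernel (RtoC s) w)%C p.

Definition off_half_line (p : path) : Prop := forall s, 0 <= s -> ~ on_path p (RtoC s).

(** The continuous function [|Im w| + (|Re w| - Re w)] vanishes exactly on the half line, hence has
    a positive minimum on the path. It is at most three times the distance from [w] to any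
    [s >= 0]. *)
Lemma half_line_distance p : smooth p -> off_half_line p ->
  exists d, 0 < d /\ forall w s, on_path p w -> 0 <= s -> d <= Cmod (w - RtoC s).
Proof.
  intros Hp Ho.
  destruct (path_lower_bound p (fun w => Rabs (Im w) + (Rabs (Re w) - Re w))) as (d & Hd & Hb).
  - intros g t Hg Ht. destruct (C1_arc_cont g t (Hp g Hg) Ht) as [C1 C2].
    apply (continuous_plus (fun s => Rabs (Im (g s))) (fun s => Rabs (Re (g s)) - Re (g s))).
    + apply (continuous_comp (fun s => Im (g s)) Rabs); [assumption|apply continuous_Rabs].
    + apply (continuous_minus (fun s => Rabs (Re (g s))) (fun s => Re (g s))); [|assumption].
      apply (continuous_comp (fun s => Re (g s)) Rabs); [assumption|apply continuous_Rabs].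
  - intros w Hw. assert (A := Rabs_pos (Im w)). assert (B := Rle_abs (Re w)).
    destruct (Req_dec (Rabs (Im w) + (Rabs (Re w) - Re w)) 0) as [E|E]; [|lra].
    exfalso. assert (Im w = 0) by (apply Rabs_eq_0; lra).
    assert (E2 : Rabs (Re w) = Re w) by lra. assert (P := Rabs_pos (Re w)). rewrite E2 in P.
    apply (Ho (Re w) P). replace (RtoC (Re w)) with w; [assumption|]. apply C_eq; [reflexivity|assumption].
  - exists (d / 3); split; [lra|]. intros w s Hw Hs. specialize (Hb w Hw).
    assert (A := re_le_Cmod (w - RtoC s)). assert (B := im_le_Cmod (w - RtoC s)).
    destruct w as [x y]; simpl in *.
    replace (y + - 0) with y in B by ring.
    assert (Rabs x - x <= 2 * Rabs (x + - s)) by (unfold Rabs; repeat destruct Rcase_abs; lra). lra.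
Qed.

Lemma cauchy_kernel_path_cont p s : smooth p -> off_half_line p -> 0 <= s ->
  path_cont (cauchy_kernel (RtoC s)) p.
Proof. intros Hp Ho Hs. apply path_cont_kernel; auto. Qed.

(** [K] is a length bound divided by the distance to the half line, and is the same for all [B] and
    [s]. *)
Lemma cauchy_transform_bound p : smooth p -> off_half_line p ->
  exists K, 0 <= K /\ forall B M s, 0 <= M -> path_cont B p -> 0 <= s ->
    (forall w, on_path p w -> Cmod (B w) <= M) -> Cmod (cauchy_transform p B s) <= K * M.
Proof.
  intros Hp Ho.
  destruct (half_line_distance p Hp Ho) as (d & Hd & Hdb).
  destruct (contour_integral_bound p Hp) as (L & HL & HLb).
  exists (L * / d); split; [apply Rmult_le_pos; [assumption|left; now apply Rinv_0_lt_compat]|].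
  intros B M s HM HB Hs HBM. rewrite Rmult_assoc. apply HLb.
  - apply path_cont_mult; [assumption|now apply cauchy_kernel_path_cont].
  - intros w Hw. unfold cauchy_kernel. specialize (Hdb w s Hw Hs).
    rewrite Cmod_mult, Cmod_inv by (apply Cmod_gt_0; lra). rewrite Rmult_comm.
    apply Rmult_le_compat; [left; apply Rinv_0_lt_compat; lra|apply Cmod_ge_0| |auto].
    now apply Rinv_le_contravar.
Qed.

Lemma Rmax_0_lipschitz a b : Rabs (Rmax a 0 - Rmax b 0) <= Rabs (a - b).
Proof. unfold Rmax; repeat destruct Rle_dec; unfold Rabs; repeat destruct Rcase_abs; lra. Qed.

(* Clamping at [0] makes the transform continuous on both sides of the endpoint. *)
Lemma cauchy_transform_cont p B : smooth p -> off_half_line p -> path_cont B p ->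
  forall t, Ccont (fun s => cauchy_transform p B (Rmax s 0)) t.
Proof.
  intros Hp Ho HB t.
  destruct (half_line_distance p Hp Ho) as (d & Hd & Hdb).
  destruct (contour_integral_bound p Hp) as (L & HL & HLb).
  destruct (path_bounded B p HB) as (M & HM & HMb).
  (* A Lipschitz constant from the resolvent identity [1 / (w - a) - 1 / (w - b) = (a - b) / ((w -
     a) (w - b))], increased by 1 to be positive. *)
  set (K := L * (M * / (d * d)) + 1).
  assert (Hdd : 0 < / (d * d)) by (apply Rinv_0_lt_compat; now apply Rmult_lt_0_compat).
  assert (HK : 0 < K).
  { unfold K. assert (0 <= L * (M * / (d * d))); [|lra].
    apply Rmult_le_pos; [assumption|]. apply Rmult_le_pos; lra. }
  assert (Lip : forall a b, 0 <= a -> 0 <= b ->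
     Cmod (cauchy_transform p B a - cauchy_transform p B b) <= K * Rabs (a - b)).
  { intros a b Ha Hb. unfold cauchy_transform.
    rewrite <- contour_integral_minus by (try assumption; apply path_cont_mult; try assumption;
      now apply cauchy_kernel_path_cont).
    apply Rle_trans with (L * (M * / (d * d) * Rabs (a - b))).
    - apply HLb.
      + apply path_cont_minus; apply path_cont_mult; try assumption; now apply cauchy_kernel_path_cont.
      + intros w Hw. assert (Da := Hdb w a Hw Ha). assert (Db := Hdb w b Hw Hb).
        assert (Na : (w - RtoC a)%C <> 0%C) by (apply Cmod_gt_0; lra).
        assert (Nb : (w - RtoC b)%C <> 0%C) by (apply Cmod_gt_0; lra).
        replace (B w * cauchy_kernel a w - B w * cauchy_kernel b w)%C
          with (B w * (/ (w - RtoC a) * / (w - RtoC b)) * RtoC (a - b))%C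
          by (unfold cauchy_kernel; rewrite RtoC_minus; field; split; assumption).
        rewrite !Cmod_mult, Cmod_R, !Cmod_inv by assumption.
        apply Rmult_le_compat_r; [apply Rabs_pos|].
        assert (Ia : / Cmod (w - RtoC a) <= / d) by now apply Rinv_le_contravar.
        assert (Ib : / Cmod (w - RtoC b) <= / d) by now apply Rinv_le_contravar.
        assert (Ia0 : 0 < / Cmod (w - RtoC a)) by (apply Rinv_0_lt_compat; lra).
        assert (Ib0 : 0 < / Cmod (w - RtoC b)) by (apply Rinv_0_lt_compat; lra).
        apply Rmult_le_compat; [apply Cmod_ge_0|apply Rmult_le_pos; lra|auto|].
        rewrite Rinv_mult. apply Rmult_le_compat; lra.
    - unfold K. assert (P := Rabs_pos (a - b)).
      rewrite Rmult_plus_distr_r, <- !Rmult_assoc. lra. }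
  apply Ccont_eps. intros eps He. exists (eps / K); split; [now apply Rdiv_lt_0_compat|].
  intros s Hs. eapply Rle_lt_trans; [apply Lip; apply Rmax_r|].
  apply (Rmult_lt_reg_l (/ K)); [now apply Rinv_0_lt_compat|].
  rewrite <- Rmult_assoc, Rinv_l, Rmult_1_l by lra. rewrite Rmult_comm.
  eapply Rle_lt_trans; [apply Rmax_0_lipschitz|exact Hs].
Qed.

(** * The circle around the distant pole *)

Definition circle (c r : R) : path :=
  (fun t => RtoC c + RtoC r * (cos (2 * PI * t), sin (2 * PI * t)))%C :: nil.

Lemma circle_arc_derive c r t :
  is_Cderive (fun t => RtoC c + RtoC r * (cos (2 * PI * t), sin (2 * PI * t)))%C t
    (RtoC (2 * PI * r) * ((- sin (2 * PI * t))%R, cos (2 * PI * t)))%C.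
Proof.
  split; simpl; auto_derive; try exact I; ring.
Qed.

Lemma circle_closed c r : closed_contour (circle c r).
Proof.
  split.
  - intros g [<-|[]] t _. destruct (circle_arc_derive c r t) as [D1 D2].
    split; [|split]; [eexists; exact D1|eexists; exact D2|].
    apply Ccont_continuous.
    apply (Ccont_ext (fun t => RtoC (2 * PI * r) * ((- sin (2 * PI * t))%R, cos (2 * PI * t)))%C).
    + intros s. symmetry. apply velocity_unique, circle_arc_derive.
    + apply Ccont_mult; [apply Ccont_const|].
      split; apply (@ex_derive_continuous R_AbsRing R_NormedModule); simpl; auto_derive; exact I.
  - intros [|i] Hi; simpl in *; [|lia].
    rewrite Rmult_1_r, Rmult_0_r, cos_2PI, sin_2PI, cos_0, sin_0. reflexivity.
Qed.

Lemma Cmod_cos_sin a : Cmod (cos a, sin a) = 1.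
Proof.
  unfold Cmod; simpl. replace (_ + _) with (Rsqr (sin a) + Rsqr (cos a)) by (unfold Rsqr; ring).
  rewrite sin2_cos2. apply sqrt_1.
Qed.

Lemma on_circle c r w : on_path (circle c r) w -> exists a, w = (RtoC c + RtoC r * (cos a, sin a))%C.
Proof. intros (g & t & [<-|[]] & _ & <-). now eexists. Qed.

Lemma on_circle_re c r w : 0 <= r -> on_path (circle c r) w -> c - r <= Re w <= c + r.
Proof.
  intros Hr Hw. destruct (on_circle c r w Hw) as [a ->]. simpl.
  assert (B := COS_bound a). nra.
Qed.

Lemma Ci_neq_0 : Ci <> 0%C.
Proof. intros E. apply (f_equal Im) in E. simpl in E. lra. Qed.

Lemma two_pi_i_neq_0 : two_pi_i <> 0%C.
Proof.
  assert (P := PI_RGT_0). apply Cmult_neq_0; [|apply Ci_neq_0].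
  intros E. apply RtoC_inj in E. lra.
Qed.

(** With [e = exp (2 pi i t)] the velocity is [2 pi i r e] and the kernel [1 / (r e)]: the integrand
    is constant. *)
Lemma circle_winding c r : 0 < r -> contour_integral (cauchy_kernel (RtoC c)) (circle c r) = two_pi_i.
Proof.
  intros Hr. unfold contour_integral, circle; simpl. rewrite Cplus_0_r.
  apply is_CInt_unique.
  apply (is_CInt_ext (fun _ => two_pi_i)).
  - intros t _. rewrite (velocity_unique _ _ _ (circle_arc_derive c r t)).
    unfold cauchy_kernel, two_pi_i.
    set (e := (cos (2 * PI * t), sin (2 * PI * t)) : C).
    assert (He : e <> 0%C).
    { apply Cmod_gt_0. unfold e. rewrite Cmod_cos_sin. lra. }
    assert (E : (((- sin (2 * PI * t))%R, cos (2 * PI * t)) : C) = (Ci * e)%C).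
    { unfold e. apply C_eq; simpl; ring. }
    rewrite E, (RtoC_mult (2 * PI) r).
    assert (RtoC r <> 0%C) by (intros X; apply RtoC_inj in X; lra).
    replace (RtoC c + RtoC r * e - RtoC c)%C with (RtoC r * e)%C by ring.
    field. split; assumption.
  - assert (H := is_RInt_const (V := C_R_NormedModule) 0 1 two_pi_i).
    refine (eq_ind _ (fun l => is_CInt (fun _ => two_pi_i) 0 1 l) H _ _).
    rewrite Rminus_0_r. apply (scal_one (V := C_R_NormedModule)).
Qed.

(** The length must be explicit here, since the radius of the circle grows with [N]. *)
Lemma circle_integral_bound c r f M : 0 < r -> path_cont f (circle c r) ->
  (forall v, on_path (circle c r) v -> Cmod (f v) <= M) ->
  Cmod (contour_integral f (circle c r)) <= 2 * PI * r * M.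
Proof.
  intros Hr Hf HM.
  assert (A := arc_integral_correct f (circle c r) _ (closed_smooth _ (circle_closed c r)) Hf
                 (or_introl eq_refl)).
  unfold contour_integral, circle; simpl. rewrite Cplus_0_r.
  replace (2 * PI * r * M) with ((1 - 0) * (M * (2 * PI * r))) by ring.
  eapply is_CInt_le_const; [lra| |exact A].
  intros t Ht. cbv beta. rewrite Cmod_mult.
  rewrite (velocity_unique _ _ _ (circle_arc_derive c r t)), Cmod_mult, Cmod_R.
  assert (P := PI_RGT_0).
  rewrite Rabs_right by (apply Rle_ge, Rmult_le_pos; lra).
  assert (E : Cmod ((- sin (2 * PI * t))%R, cos (2 * PI * t)) = 1).
  { unfold Cmod; simpl. replace (_ + _) with (Rsqr (sin (2 * PI * t)) + Rsqr (cos (2 * PI * t)))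
      by (unfold Rsqr; ring).
    rewrite sin2_cos2. apply sqrt_1. }
  rewrite E, Rmult_1_r. apply Rmult_le_compat_r; [apply Rmult_le_pos; lra|].
  apply HM. exact (on_path_in (circle c r) _ t (or_introl eq_refl) Ht).
Qed.

(** * Products over the poles *)

Lemma Cprod_ext f h n : (forall l, (1 <= l <= n)%nat -> f l = h l) -> Cprod f n = Cprod h n.
Proof.
  induction n as [|n IH]; intros H; simpl; [reflexivity|].
  rewrite IH by (intros; apply H; lia). now rewrite H by lia.
Qed.

Lemma Cprod_split f m n : Cprod f (m + n) = (Cprod f m * Cprod (fun l => f (m + l)%nat) n)%C.
Proof.
  induction n as [|n IH]; simpl.
  - rewrite Nat.add_0_r. ring.
  - rewrite Nat.add_succ_r. simpl. rewrite IH. ring.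
Qed.

Lemma Cprod_const c n : Cprod (fun _ => c) n = (c ^ n)%C.
Proof. induction n as [|n IH]; simpl; [reflexivity|]. rewrite IH. ring. Qed.

Lemma Cprod_mult f h n : Cprod (fun l => f l * h l)%C n = (Cprod f n * Cprod h n)%C.
Proof. induction n as [|n IH]; simpl; [ring|]. rewrite IH. ring. Qed.

Fixpoint spikes (sigma : nat -> R) (m : nat) : list C :=
  match m with
  | O => nil
  | S m' => RtoC (- sigma (S m')) :: spikes sigma m'
  end.

Lemma in_spikes sigma m z :
  In z (spikes sigma m) -> exists j, (1 <= j <= m)%nat /\ z = RtoC (- sigma j).
Proof.
  induction m as [|m IH]; intros H; [destruct H|]. destruct H as [<-|H].
  - exists (S m). split; [lia|reflexivity].
  - destruct (IH H) as (j & Hj & E). exists j. split; [lia|assumption].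
Qed.

Lemma invprod_spikes sigma m w :
  invprod (spikes sigma m) w = Cprod (fun j => / (w + RtoC (sigma j)))%C m.
Proof.
  induction m as [|m IH]; [reflexivity|].
  change (invprod (spikes sigma (S m)) w)
    with (cauchy_kernel (RtoC (- sigma (S m))) w * invprod (spikes sigma m) w)%C.
  rewrite IH. simpl. unfold cauchy_kernel.
  replace (w - RtoC (- sigma (S m)))%C with (w + RtoC (sigma (S m)))%C
    by (rewrite RtoC_opp; ring).
  ring.
Qed.

Lemma invprod_app Z Z' w : invprod (Z ++ Z') w = (invprod Z w * invprod Z' w)%C.
Proof. induction Z as [|z Z IH]; simpl; [ring|]. rewrite IH. ring. Qed.

Lemma invprod_repeat z n w : invprod (repeat z n) w = (cauchy_kernel z w ^ n)%C.
Proof. induction n as [|n IH]; simpl; [reflexivity|]. now rewrite IH. Qed.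

(** * The rescaled kernel *)

(** The sign turns the [1 / (s - w)] of the kernel into the Cauchy kernel [1 / (w - s)]. *)
Definition prefactor (nu0 m : nat) (sigma : nat -> R) (xi s : R) : C :=
  (- (hyp0F1 (INR nu0 + 1) (- (RtoC s * RtoC xi)) * RtoC s ^ nu0
      * Cprod (fun j => RtoC s + RtoC (sigma j)) m))%C.

Definition limit_density (nu0 m : nat) (sigma : nat -> R) (eta : R) (w : C) : C :=
  (Cexp w * hyp0F1 (INR nu0 + 1) (- (w * RtoC eta)) * invprod (spikes sigma m) w)%C.

(** With [beta = b - 1] one has [1 / k = 1 + 1 / beta], so [exp ((w - s) / k)] leaves
    [exp (w / beta)] and [exp (- s / beta)] beside the limiting exponential. Each is joined to its
    half of the product of the [n = N - m] equal factors; [interest] and [damping] then both tend to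
    1 at fixed arguments. *)
Definition interest (beta : R) (m n : nat) (w : C) : C :=
  (Cexp (w / RtoC beta) * (/ (1 + w / RtoC beta / RtoC (INR (m + n)))) ^ n)%C.

Definition damping (beta : R) (m n : nat) (s : R) : R :=
  (1 + s / beta / INR (m + n)) ^ n * exp (- (s / beta)).

Lemma nu_ge_1 nu0 : 1 <= INR nu0 + 1.
Proof. assert (H := pos_INR nu0). lra. Qed.

Lemma entire_hyp0F1_opp_scal nu0 eta :
  entire (fun w => hyp0F1 (INR nu0 + 1) (- (w * RtoC eta)))%C.
Proof.
  apply (entire_ext (fun w => hyp0F1 (INR nu0 + 1) (RtoC (- eta) * w)%C)).
  - intros v. f_equal. rewrite RtoC_opp. ring.
  - apply (entire_scale (RtoC (- eta))). apply entire_hyp0F1, nu_ge_1.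
Qed.

Lemma Ccont_real_id t : Ccont (fun s => RtoC s) t.
Proof. split; simpl; [apply continuous_id|apply continuous_const]. Qed.

Lemma Ccont_pow f n t : Ccont f t -> Ccont (fun s => f s ^ n)%C t.
Proof.
  intros H. induction n as [|n IH]; simpl; [apply Ccont_const|].
  now apply (Ccont_mult f (fun s => f s ^ n)%C).
Qed.

Lemma prefactor_cont nu0 m sigma xi t : Ccont (prefactor nu0 m sigma xi) t.
Proof.
  apply Ccont_opp. apply Ccont_mult; [apply Ccont_mult|].
  - apply (entire_Ccont (fun w => hyp0F1 (INR nu0 + 1) (- (w * RtoC xi)))%C);
      [apply entire_hyp0F1_opp_scal|apply Ccont_real_id].
  - apply Ccont_pow, Ccont_real_id.
  - induction m as [|m IH]; simpl; [apply Ccont_const|].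
    apply (Ccont_mult (fun s => Cprod (fun j => RtoC s + RtoC (sigma j)) m)%C); [assumption|].
    apply Ccont_plus; [apply Ccont_real_id|apply Ccont_const].
Qed.

Lemma prefactor_subexp nu0 m sigma xi : subexp (fun s => Cmod (prefactor nu0 m sigma xi s)).
Proof.
  unfold prefactor.
  apply (subexp_ext (fun s => Cmod (hyp0F1 (INR nu0 + 1) (- (RtoC s * RtoC xi))) * Cmod (RtoC s ^ nu0)
           * Cmod (Cprod (fun j => RtoC s + RtoC (sigma j)) m)%C)).
  { intros s _. now rewrite Cmod_opp, !Cmod_mult. }
  assert (P : forall c, subexp (fun s => Cmod (RtoC s + RtoC c))).
  { intros c. apply (subexp_le (fun s => s + Rabs c)).
    - intros s Hs. rewrite Rabs_right by (apply Rle_ge, Cmod_ge_0).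
      eapply Rle_trans; [apply Cmod_triangle|]. rewrite !Cmod_R, (Rabs_right s) by lra. lra.
    - apply subexp_plus; [apply subexp_id|apply subexp_const]. }
  apply subexp_mult; [apply subexp_mult|].
  - apply subexp_hyp0F1, nu_ge_1.
  - induction nu0 as [|k IH]; simpl.
    + apply subexp_const.
    + apply (subexp_ext (fun s => Cmod (RtoC s + RtoC 0) * Cmod (RtoC s ^ k))).
      * intros s _. rewrite Cplus_0_r, Cmod_mult. reflexivity.
      * apply subexp_mult; [apply P|exact IH].
  - induction m as [|m IH]; simpl.
    + apply subexp_const.
    + apply (subexp_ext (fun s => Cmod (Cprod (fun j => RtoC s + RtoC (sigma j)) m)%C
                                * Cmod (RtoC s + RtoC (sigma (S m))))).
      * intros s _. now rewrite Cmod_mult.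
      * apply subexp_mult; [exact IH|apply P].
Qed.

Lemma limit_density_path_cont nu0 m sigma eta p :
  smooth p -> avoids p (spikes sigma m) -> path_cont (limit_density nu0 m sigma eta) p.
Proof.
  intros Hp Ha. apply path_cont_mult; [apply path_cont_mult|now apply path_cont_invprod].
  - apply entire_path_cont; [apply entire_Cexp|assumption].
  - apply (entire_path_cont (fun w => hyp0F1 (INR nu0 + 1) (- (w * RtoC eta)))%C);
      [apply entire_hyp0F1_opp_scal|assumption].
Qed.

Lemma entire_Cexp_div beta : entire (fun w => Cexp (w / RtoC beta)%C).
Proof.
  apply (entire_ext (fun w => Cexp (/ RtoC beta * w)%C)).
  - intros v. f_equal. unfold Cdiv. ring.
  - apply entire_scale, entire_Cexp.
Qed.

(** Brings the factor to the form of a Cauchy kernel at the far pole, which [invprod] can absorb. *)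
Lemma interest_factor beta m n w : 0 < beta -> (0 < m + n)%nat ->
  (w - RtoC (- (beta * INR (m + n))))%C <> 0%C ->
  (1 + w / RtoC beta / RtoC (INR (m + n)))%C <> 0%C /\
  (/ (1 + w / RtoC beta / RtoC (INR (m + n))))%C =
  (RtoC (beta * INR (m + n)) * cauchy_kernel (RtoC (- (beta * INR (m + n)))) w)%C.
Proof.
  intros Hb Hn Hw.
  assert (HN : 0 < INR (m + n)) by (apply lt_0_INR; assumption).
  assert (N1 : RtoC beta <> 0%C) by (intros E; apply RtoC_inj in E; lra).
  assert (N2 : RtoC (INR (m + n)) <> 0%C) by (intros E; apply RtoC_inj in E; lra).
  unfold cauchy_kernel. rewrite RtoC_opp, RtoC_mult in *.
  set (NN := RtoC (INR (m + n))) in *.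
  assert (E : (1 + w / RtoC beta / NN)%C = ((w - - (RtoC beta * NN)) / (RtoC beta * NN))%C)
    by (field; split; assumption).
  assert (X : (1 + w / RtoC beta / NN)%C <> 0%C).
  { rewrite E. intros F. apply Hw.
    replace (w - - (RtoC beta * NN))%C
      with ((w - - (RtoC beta * NN)) / (RtoC beta * NN) * (RtoC beta * NN))%C by (field; split; assumption).
    rewrite F. ring. }
  split; [exact X|]. rewrite E. field. repeat split; try assumption.
Qed.

Lemma interest_path_cont beta m n p : 0 < beta -> (0 < m + n)%nat -> smooth p ->
  ~ on_path p (RtoC (- (beta * INR (m + n)))) -> path_cont (interest beta m n) p.
Proof.
  intros Hb Hn Hp Ha. apply path_cont_mult.
  - apply (entire_path_cont (fun w => Cexp (w / RtoC beta)%C)); [apply entire_Cexp_div|assumption].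
  - apply (path_cont_pow (fun w => / (1 + w / RtoC beta / RtoC (INR (m + n))))%C).
    apply path_cont_inv.
    + apply path_cont_plus; [apply path_cont_const|]. unfold Cdiv.
      apply (path_cont_mult (fun w => w * / RtoC beta)%C); [|apply path_cont_const].
      apply (path_cont_mult (fun w => w)); [now apply path_cont_id|apply path_cont_const].
    + intros v Hv. apply interest_factor; try assumption. now apply (avoids_neq p).
Qed.

Lemma limit_integrand nu0 m sigma xi eta p s :
  smooth p -> off_half_line p -> avoids p (spikes sigma m) -> 0 <= s ->
  contour_integral (fun v =>
     hyp0F1 (INR nu0 + 1) (- (RtoC s * RtoC xi))
     * hyp0F1 (INR nu0 + 1) (- (v * RtoC eta))
     * RtoC s ^ nu0
     * (Cexp (- RtoC s + v) / (RtoC s - v))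
     * Cprod (fun j => (RtoC s + RtoC (sigma j)) / (v + RtoC (sigma j))) m)%C p
  = (RtoC (exp (- s)) * prefactor nu0 m sigma xi s
     * cauchy_transform p (limit_density nu0 m sigma eta) s)%C.
Proof.
  intros Hp Ho Ha Hs. unfold cauchy_transform.
  rewrite <- contour_integral_scal; try assumption.
  2: { apply path_cont_mult; [now apply limit_density_path_cont|now apply cauchy_kernel_path_cont]. }
  apply contour_integral_ext. intros v Hv.
  unfold Cdiv. rewrite (Cprod_mult (fun j => RtoC s + RtoC (sigma j))%C), <- invprod_spikes.
  rewrite Cexp_plus, <- RtoC_opp, Cexp_RtoC.
  unfold prefactor, limit_density, cauchy_kernel.
  assert (N : (v - RtoC s)%C <> 0%C) by (apply (avoids_neq p); auto).
  replace (/ (RtoC s - v))%C with (- / (v - RtoC s))%C.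
  - ring.
  - field. split; [|assumption]. intros E. apply N.
    replace (v - RtoC s)%C with (- (RtoC s - v))%C by ring. rewrite E. ring.
Qed.

Definition density (nu0 m n : nat) (sigma : nat -> R) (beta eta : R) (w : C) : C :=
  (limit_density nu0 m sigma eta w * interest beta m n w)%C.

Lemma density_path_cont nu0 m n sigma beta eta p : 0 < beta -> (0 < m + n)%nat -> smooth p ->
  avoids p (spikes sigma m) -> ~ on_path p (RtoC (- (beta * INR (m + n)))) ->
  path_cont (density nu0 m n sigma beta eta) p.
Proof.
  intros. apply path_cont_mult; [now apply limit_density_path_cont|now apply interest_path_cont].
Qed.

Lemma RtoC_neq_0 x : x <> 0 -> RtoC x <> 0%C.
Proof. intros H E. now apply RtoC_inj in E. Qed.

(** For a spike, [u + a = (k u + sigma) / k], and the [k] cancels in the quotient. For the other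
    factors, [u + b N = b N (1 + u / (b N))] with [u / (b N) = k u / ((b - 1) N)]. *)
Lemma spiked_product m n b sigma u v :
  1 < b -> (0 < m + n)%nat ->
  ~ In (RtoC (1 - 1 / b) * v)%C (spikes sigma m) ->
  (RtoC (1 - 1 / b) * v)%C <> RtoC (- ((b - 1) * INR (m + n))) ->
  Cprod (fun l => (RtoC u + RtoC (spiked m b sigma (m + n) l))
                  / (v + RtoC (spiked m b sigma (m + n) l)))%C (m + n)
  = (Cprod (fun j => RtoC ((1 - 1 / b) * u) + RtoC (sigma j)) m
     * invprod (spikes sigma m) (RtoC (1 - 1 / b) * v)
     * RtoC ((1 + (1 - 1 / b) * u / (b - 1) / INR (m + n)) ^ n)
     * (/ (1 + RtoC (1 - 1 / b) * v / RtoC (b - 1) / RtoC (INR (m + n)))) ^ n)%C.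
Proof.
  intros Hb Hn Hs Hp.
  assert (HN : 0 < INR (m + n)) by (apply lt_0_INR; assumption).
  assert (Nb : RtoC b <> 0%C) by (apply RtoC_neq_0; lra).
  assert (Nb1 : RtoC (b - 1) <> 0%C) by (apply RtoC_neq_0; lra).
  assert (NN : RtoC (INR (m + n)) <> 0%C) by (apply RtoC_neq_0; lra).
  assert (Ek : 1 - 1 / b = (b - 1) / b) by (field; lra).
  rewrite Cprod_split, invprod_spikes, <- Cprod_mult, <- !Cmult_assoc. f_equal.
  - apply Cprod_ext. intros l Hl.
    assert (Hw : (RtoC (1 - 1 / b) * v + RtoC (sigma l))%C <> 0%C).
    { intros E. apply Hs.
      replace (RtoC (1 - 1 / b) * v)%C with (RtoC (- sigma l)).
      - clear -Hl. induction m as [|m IH]; [lia|].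
        destruct (Nat.eq_dec l (S m)) as [->|]; [now left|right; apply IH; lia].
      - rewrite RtoC_opp. replace (- RtoC (sigma l))%C
          with (- RtoC (sigma l) + (RtoC (1 - 1 / b) * v + RtoC (sigma l)))%C by (rewrite E; ring).
        ring. }
    unfold spiked. rewrite (proj2 (Nat.leb_le l m)) by lia.
    rewrite Ek in *. unfold Rdiv in *. rewrite !RtoC_mult, !RtoC_inv in * by lra.
    field. repeat split; try assumption; intros E; apply Hw;
      (transitivity (0 * / RtoC b)%C; [rewrite <- E; field; assumption|ring]).
  - rewrite RtoC_pow, <- Cpow_mult_l, <- Cprod_const. apply Cprod_ext. intros l Hl.
    unfold spiked. rewrite (proj2 (Nat.leb_gt (m + l) m)) by lia.
    assert (Hw : (v + RtoC b * RtoC (INR (m + n)))%C <> 0%C).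
    { intros E. apply Hp. rewrite Ek, RtoC_opp. unfold Rdiv. rewrite !RtoC_mult, RtoC_inv by lra.
      replace v with (v + RtoC b * RtoC (INR (m + n)) - RtoC b * RtoC (INR (m + n)))%C by ring.
      rewrite E. field. assumption. }
    rewrite RtoC_plus, Ek. unfold Rdiv. rewrite !RtoC_mult, !RtoC_inv by lra.
    field. repeat split; try assumption; intros E; apply Hw; rewrite <- E; ring.
Qed.

(** The powers of [k] balance: [(k eta) ^ nu0 u ^ nu0 = eta ^ nu0 (k u) ^ nu0], and the [k] in
    [1 / (u - v) = k / (k u - k v)] is the Jacobian of the dilated contour. The exponentials of
    [Psi] and [Phi] combine to [exp (k (xi - eta))]. *)
Lemma kernel_integrand nu0 m n b sigma xi eta p u :
  1 < b -> (0 < m + n)%nat ->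
  smooth (scale_path (1 - 1 / b) p) -> off_half_line (scale_path (1 - 1 / b) p) ->
  avoids (scale_path (1 - 1 / b) p) (spikes sigma m) ->
  ~ on_path (scale_path (1 - 1 / b) p) (RtoC (- ((b - 1) * INR (m + n)))) -> 0 <= u ->
  contour_integral (fun v =>
    RtoC u ^ nu0 * Cexp (- RtoC u + v) * Psi nu0 (RtoC u) ((1 - 1 / b) * xi)
    * Phi nu0 v ((1 - 1 / b) * eta) * / (RtoC u - v)
    * Cprod (fun l => (RtoC u + RtoC (spiked m b sigma (m + n) l))
                      / (v + RtoC (spiked m b sigma (m + n) l))) (m + n))%C p
  = (RtoC (exp ((1 - 1 / b) * (xi - eta)) * (eta ^ nu0 / Gamma (INR nu0 + 1) ^ 2))
     * (RtoC (exp (- ((1 - 1 / b) * u)) * damping (b - 1) m n ((1 - 1 / b) * u))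
        * prefactor nu0 m sigma xi ((1 - 1 / b) * u)
        * cauchy_transform (scale_path (1 - 1 / b) p) (density nu0 m n sigma (b - 1) eta)
            ((1 - 1 / b) * u)))%C.
Proof.
  intros Hb Hn Hp Ho Ha HaN Hu.
  assert (Hk : 0 < 1 - 1 / b).
  { assert (/ b < 1) by (rewrite <- Rinv_1; apply Rinv_lt_contravar; lra). lra. }
  assert (Ek : 1 - 1 / b = (b - 1) / b) by (field; lra).
  assert (Hs : 0 <= (1 - 1 / b) * u) by (apply Rmult_le_pos; lra).
  unfold cauchy_transform.
  assert (CD : path_cont (fun w => density nu0 m n sigma (b - 1) eta w
                 * cauchy_kernel (RtoC ((1 - 1 / b) * u)) w)%C (scale_path (1 - 1 / b) p)).
  { apply path_cont_mult; [apply density_path_cont; try assumption; lra|].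
    now apply cauchy_kernel_path_cont. }
  rewrite !Cmult_assoc.
  rewrite <- (contour_integral_scal _ _ _ Hp CD).
  rewrite contour_integral_scale.
  apply contour_integral_ext. intros v Hv.
  assert (Hkv : on_path (scale_path (1 - 1 / b) p) (RtoC (1 - 1 / b) * v)%C).
  { destruct Hv as (g & t & Hg & Ht & <-).
    exists (fun t => (RtoC (1 - 1 / b) * g t)%C), t. repeat split; try apply Ht.
    apply in_map_iff. now exists g. }
  rewrite spiked_product; try assumption.
  2: { intros I. now apply (Ha _ I). }
  2: { intros E. apply HaN. now rewrite <- E. }
  unfold Psi, Phi, density, limit_density, interest, prefactor, damping, cauchy_kernel.
  assert (Nu : (RtoC (1 - 1 / b) * v - RtoC ((1 - 1 / b) * u))%C <> 0%C).
  { apply (avoids_neq (scale_path (1 - 1 / b) p)); auto. }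
  assert (Nk : RtoC (1 - 1 / b) <> 0%C) by (apply RtoC_neq_0; lra).
  assert (E1 : (/ (RtoC u - v))%C
     = (- (RtoC (1 - 1 / b) * / (RtoC (1 - 1 / b) * v - RtoC ((1 - 1 / b) * u))))%C).
  { rewrite RtoC_mult in *.
    assert (v - RtoC u <> 0)%C.
    { intros E. apply Nu. replace (RtoC (1 - 1 / b) * v - RtoC (1 - 1 / b) * RtoC u)%C
        with (RtoC (1 - 1 / b) * (v - RtoC u))%C by ring. rewrite E. ring. }
    assert (RtoC u - v <> 0)%C.
    { intros E. apply H. replace (v - RtoC u)%C with (- (RtoC u - v))%C by ring. rewrite E. ring. }
    field. repeat split; assumption. }
  (* Uses [u = k u + k u / (b - 1)], and likewise for [v]. *)
  assert (E2 : (Cexp (- RtoC u + v))%C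
     = (RtoC (exp (- ((1 - 1 / b) * u))) * RtoC (exp (- ((1 - 1 / b) * u / (b - 1))))
        * (Cexp (RtoC (1 - 1 / b) * v) * Cexp (RtoC (1 - 1 / b) * v / RtoC (b - 1))))%C).
  { rewrite <- !Cexp_RtoC, <- !Cexp_plus. f_equal.
    assert (RtoC b <> 0)%C by (apply RtoC_neq_0; lra).
    assert (RtoC (b - 1) <> 0)%C by (apply RtoC_neq_0; lra).
    rewrite !RtoC_opp, Ek. unfold Rdiv. rewrite !RtoC_mult, !RtoC_inv by lra.
    rewrite RtoC_minus in *. field. split; assumption. }
  assert (E3 : (- (RtoC u * RtoC ((1 - 1 / b) * xi)) = - (RtoC ((1 - 1 / b) * u) * RtoC xi))%C).
  { rewrite !RtoC_mult. ring. }
  assert (E4 : (- (v * RtoC ((1 - 1 / b) * eta)) = - (RtoC (1 - 1 / b) * v * RtoC eta))%C).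
  { rewrite !RtoC_mult. ring. }
  assert (E5 : exp ((1 - 1 / b) * (xi - eta))
     = exp ((1 - 1 / b) * xi) * exp (- ((1 - 1 / b) * eta))).
  { rewrite <- exp_plus. f_equal. ring. }
  assert (E6 : eta ^ nu0 / Gamma (INR nu0 + 1) ^ 2
     = eta ^ nu0 * (/ Gamma (INR nu0 + 1) * / Gamma (INR nu0 + 1))).
  { simpl. rewrite Rmult_1_r, <- Rinv_mult. reflexivity. }
  assert (E7 : (RtoC ((1 - 1 / b) * u) ^ nu0)%C = (RtoC (1 - 1 / b) ^ nu0 * RtoC u ^ nu0)%C).
  { now rewrite RtoC_mult, Cpow_mult_l. }
  assert (E8 : RtoC (((1 - 1 / b) * eta) ^ nu0) = (RtoC (1 - 1 / b) ^ nu0 * RtoC (eta ^ nu0))%C).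
  { now rewrite Rpow_mult_distr, RtoC_mult, RtoC_pow. }
  rewrite E1, E2, E3, E4, E5, E6, E7.
  rewrite (RtoC_mult (/ Gamma (INR nu0 + 1) * ((1 - 1 / b) * eta) ^ nu0)).
  rewrite (RtoC_mult (/ Gamma (INR nu0 + 1)) (((1 - 1 / b) * eta) ^ nu0)), E8.
  rewrite (RtoC_mult (exp _ * exp _)).
  repeat rewrite (RtoC_mult (exp _)). rewrite (RtoC_mult (eta ^ nu0)).
  repeat rewrite (RtoC_mult (/ Gamma _)). rewrite (RtoC_mult ((1 + _) ^ n)).
  ring.
Qed.

(** Off the poles, the density times the Cauchy kernel is an entire function over linear factors:
    [s], the spikes, and [n] times the far pole. Cauchy's theorem then applies to each [s]
    separately. *)
Lemma density_decompose nu0 m n sigma beta eta p q r s :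
  0 < beta -> (0 < m + n)%nat -> 0 <= s ->
  closed_contour p -> closed_contour q -> closed_contour r ->
  let Z := RtoC s :: RtoC (- (beta * INR (m + n))) :: spikes sigma m in
  avoids p Z -> avoids q Z -> avoids r Z ->
  (forall z, In z Z -> contour_integral (cauchy_kernel z) p =
     (contour_integral (cauchy_kernel z) q + contour_integral (cauchy_kernel z) r)%C) ->
  cauchy_transform p (density nu0 m n sigma beta eta) s =
  (cauchy_transform q (density nu0 m n sigma beta eta) s
   + cauchy_transform r (density nu0 m n sigma beta eta) s)%C.
Proof.
  intros Hb Hn Hs Cp Cq Cr Z Ap Aq Ar HZ.
  set (c := RtoC (- (beta * INR (m + n)))) in *.
  set (f := fun w => (Cexp w * hyp0F1 (INR nu0 + 1) (- (w * RtoC eta)) * Cexp (w / RtoC beta))%C).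
  (* [Z] lists the far pole once, for the winding number condition; [Z'] repeats it according to its
     order. *)
  set (Z' := RtoC s :: spikes sigma m ++ repeat c n).
  assert (Hin : incl Z' Z).
  { intros z [<-|H]; [now left|]. apply in_app_or in H. destruct H as [H|H].
    - right; now right.
    - right; left. symmetry. now apply (repeat_spec n c). }
  assert (Ef : entire f).
  { apply entire_mult; [apply entire_mult; [apply entire_Cexp|apply entire_hyp0F1_opp_scal]|].
    apply entire_Cexp_div. }
  assert (E : forall w (pa : path), avoids pa Z -> on_path pa w ->
     (density nu0 m n sigma beta eta w * cauchy_kernel (RtoC s) w)%C
     = (RtoC (beta * INR (m + n)) ^ n * (f w * invprod Z' w))%C).
  { intros w pa Hpa Hw.
    assert (Nc : (w - c)%C <> 0%C).
    { apply (avoids_neq pa); [|assumption]. apply Hpa. right; now left. }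
    destruct (interest_factor beta m n w Hb Hn Nc) as [_ EF].
    unfold density, limit_density, interest, Z', f. rewrite EF.
    rewrite Cpow_mult_l. fold c.
    change (invprod (RtoC s :: spikes sigma m ++ repeat c n) w)
      with (cauchy_kernel (RtoC s) w * invprod (spikes sigma m ++ repeat c n) w)%C.
    rewrite invprod_app, invprod_repeat. ring. }
  assert (T : forall pa, closed_contour pa -> avoids pa Z ->
     cauchy_transform pa (density nu0 m n sigma beta eta) s
     = (RtoC (beta * INR (m + n)) ^ n * contour_integral (fun w => f w * invprod Z' w) pa)%C).
  { intros pa Hc Hpa. unfold cauchy_transform. rewrite <- contour_integral_scal.
    - apply contour_integral_ext. intros w Hw. now apply (E w pa).
    - now apply closed_smooth.
    - apply path_cont_mult; [now apply entire_path_cont, closed_smooth|].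
      apply path_cont_invprod; [now apply closed_smooth|]. intros z Hz. apply Hpa. now apply Hin. }
  rewrite !T by assumption.
  rewrite (contour_integral_decompose f Z' p q r); try assumption; try (intros z Hz; auto).
  ring.
Qed.

Lemma Cmod_invprod_le_1 Z w :
  (forall z, In z Z -> Cmod (cauchy_kernel z w) <= 1) -> Cmod (invprod Z w) <= 1.
Proof.
  induction Z as [|z Z IH]; intros H; simpl; [rewrite Cmod_1; lra|].
  rewrite Cmod_mult. rewrite <- (Rmult_1_r 1).
  apply Rmult_le_compat; try apply Cmod_ge_0; [apply H; now left|].
  apply IH. intros; apply H; now right.
Qed.

Lemma Cmod_cauchy_kernel_le_re z w d : 0 < d -> d <= Rabs (Re w - Re z) -> Cmod (cauchy_kernel z w) <= / d.
Proof.
  intros Hd H. assert (A := re_le_Cmod (w - z)).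
  replace (Re (w - z)) with (Re w - Re z) in A by (destruct w, z; simpl; ring).
  unfold cauchy_kernel. rewrite Cmod_inv by (apply Cmod_gt_0; lra).
  apply Rinv_le_contravar; lra.
Qed.

Lemma finite_upper_bound (sigma : nat -> R) m : exists S, 0 <= S /\ forall j, (1 <= j <= m)%nat -> sigma j <= S.
Proof.
  induction m as [|m (S & HS & IH)]; [exists 0; split; [lra|]; intros; lia|].
  exists (Rmax S (sigma (Datatypes.S m))); split.
  - eapply Rle_trans; [exact HS|apply Rmax_l].
  - intros j Hj. destruct (Nat.eq_dec j (Datatypes.S m)) as [->|]; [apply Rmax_r|].
    eapply Rle_trans; [apply IH; lia|apply Rmax_l].
Qed.

(** Equivalent to [b exp (1 - b) < 1], the source of the exponential decay on the circle. *)
Lemma ln_lt_sub_1 b : 1 < b -> ln b < b - 1.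
Proof.
  intros Hb. assert (L : 0 < ln b) by (rewrite <- ln_1; apply ln_increasing; lra).
  assert (E := exp_ineq1 (ln b)). rewrite exp_ln in E by lra. lra.
Qed.

(* On the circle of radius [kN] about [-(b - 1) N], [k = 1 - 1/b], the factor
   [1 + w / ((b - 1) N)] has modulus exactly [1 / b], so the density is at most
   [(b e^(1 - b))^N] up to the subexponential growth of [0F1]. *)
Lemma circle_transform_small nu0 m sigma b eta :
  1 < b -> 0 < eta ->
  exists K g N1, 0 <= K /\ 0 < g /\ (0 < N1)%nat /\ forall n s, (N1 <= n)%nat -> 0 <= s ->
    Cmod (cauchy_transform (circle (- ((b - 1) * INR (m + n))) ((1 - 1 / b) * INR (m + n)))
            (density nu0 m n sigma (b - 1) eta) s) <= K * exp (- g * INR (m + n)).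
Proof.
  intros Hb He.
  set (k := 1 - 1 / b). set (beta := b - 1).
  assert (Hib : 0 < / b < 1).
  { split; [apply Rinv_0_lt_compat; lra|]. rewrite <- Rinv_1; apply Rinv_lt_contravar; lra. }
  assert (Hk : 0 < k < 1) by (unfold k, Rdiv; lra).
  assert (Hbe : 0 < beta) by (unfold beta; lra).
  (* The rightmost point of the circle, [- (beta - k) N], is therefore [- k beta N]. *)
  assert (Ekb : beta - k = k * beta) by (unfold k, beta; field; lra).
  assert (Hkb : 0 < k * beta) by (apply Rmult_lt_0_compat; lra).
  assert (HL := ln_lt_sub_1 b Hb). fold beta in HL.
  (* Half of the decay rate [beta - ln b] is given up to [0F1]. As [|w| <= (beta + k) N] on the
     circle, the choice of [d] below makes its growth at most [exp (g N)]. *)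
  set (g := (beta - ln b) / 2). assert (Hg : 0 < g) by (unfold g; lra).
  set (d := g / (eta * (beta + k))).
  assert (Heb : 0 < eta * (beta + k)) by (apply Rmult_lt_0_compat; lra).
  assert (Hd : 0 < d) by (apply Rdiv_lt_0_compat; lra).
  destruct (finite_upper_bound sigma m) as (S & HS & HSb).
  (* From here on the circle lies at least 1 to the left of every spike, so the Cauchy kernels at
     the spikes have modulus at most 1. *)
  destruct (INR_unbounded ((1 + S) / (k * beta))) as [N1 HN1].
  assert (PI0 := PI_RGT_0). assert (Ed := exp_pos (/ d)).
  exists (4 * PI * exp (/ d) / beta), g, (Datatypes.S N1).
  split; [|split; [assumption|split; [lia|]]].
  { apply Rmult_le_pos; [|left; now apply Rinv_0_lt_compat]. apply Rmult_le_pos; lra. }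
  intros n s Hn Hs.
  set (N := INR (m + n)).
  assert (HN : INR N1 <= N) by (apply le_INR; lia).
  assert (HN1' : 1 <= N) by (apply (le_INR 1); lia).
  assert (HNS : 1 + S <= k * beta * N).
  { apply Rlt_le, Rlt_le_trans with (k * beta * INR N1); [|apply Rmult_le_compat_l; lra].
    apply (Rmult_lt_compat_l (k * beta)) in HN1; [|assumption].
    replace (k * beta * ((1 + S) / (k * beta))) with (1 + S) in HN1 by (field; lra). lra. }
  assert (HkN : 0 < k * N) by (apply Rmult_lt_0_compat; lra).
  set (r := circle (- (beta * N)) (k * N)).
  assert (Hr : smooth r) by apply closed_smooth, circle_closed.
  assert (Hre : forall w, on_path r w -> Re w <= - (k * beta * N)).
  { intros w Hw. apply on_circle_re in Hw; [|lra].
    replace (k * beta * N) with (beta * N - k * N) by (rewrite <- Ekb; ring). lra. }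
  assert (Hker : forall w z, on_path r w -> - S <= Re z -> Cmod (cauchy_kernel z w) <= 1).
  { intros w z Hw Hz. rewrite <- Rinv_1. apply Cmod_cauchy_kernel_le_re; [lra|].
    specialize (Hre w Hw). rewrite Rabs_left1 by lra. lra. }
  assert (Hsp : forall z, In z (spikes sigma m) -> - S <= Re z).
  { intros z Hz. destruct (in_spikes _ _ _ Hz) as (j & Hj & ->). simpl. specialize (HSb j Hj). lra. }
  assert (Hav : avoids r (spikes sigma m)).
  { intros z Hz Hw. assert (A := Hre z Hw). specialize (Hsp z Hz). lra. }
  assert (Hoff : off_half_line r).
  { intros t Ht Hw. assert (A := Hre _ Hw). simpl in A. lra. }
  assert (Hc : ~ on_path r (RtoC (- (beta * N)))).
  { intros Hw. destruct (on_circle _ _ _ Hw) as [a Ha].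
    assert (E : (RtoC (k * N) * (cos a, sin a))%C = 0%C).
    { replace (RtoC (k * N) * (cos a, sin a))%C
        with ((RtoC (- (beta * N)) + RtoC (k * N) * (cos a, sin a)) - RtoC (- (beta * N)))%C by ring.
      rewrite <- Ha. ring. }
    apply (f_equal Cmod) in E. rewrite Cmod_mult, Cmod_cos_sin, Cmod_R, Cmod_0, Rabs_right in E by lra.
    lra. }
  assert (Hmn : (0 < m + n)%nat) by lia.
  unfold cauchy_transform.
  (* The last factor bounds the Cauchy kernel at [s]; it offsets the length [2 pi k N] of the
     circle. *)
  set (M := 2 * exp (/ d) * exp (- g * N) * / (k * beta * N)).
  replace (4 * PI * exp (/ d) / beta * exp (- g * N)) with (2 * PI * (k * N) * M)
    by (unfold M; field; repeat split; lra).
  apply circle_integral_bound; [assumption| |].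
  { apply path_cont_mult; [now apply density_path_cont|now apply cauchy_kernel_path_cont]. }
  intros w Hw. unfold density, limit_density, interest. fold N beta.
  rewrite !Cmod_mult, !Cmod_Cexp, Cmod_pow.
  assert (B0 : Cmod (cauchy_kernel s w) <= / (k * beta * N)).
  { specialize (Hre w Hw). apply Cmod_cauchy_kernel_le_re; simpl; [apply Rmult_lt_0_compat; lra|].
    rewrite Rabs_left1 by lra. lra. }
  assert (B1 : Cmod (invprod (spikes sigma m) w) <= 1).
  { apply Cmod_invprod_le_1. intros z Hz. apply Hker; auto. }
  destruct (on_circle _ _ _ Hw) as [a Ha].
  assert (Hwm : Cmod w <= (beta + k) * N).
  { rewrite Ha. eapply Rle_trans; [apply Cmod_triangle|].
    assert (0 < beta * N) by (apply Rmult_lt_0_compat; lra).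
    rewrite Cmod_mult, Cmod_cos_sin, !Cmod_R, Rabs_Ropp, !Rabs_right by lra. lra. }
  assert (B2 : Cmod (hyp0F1 (INR nu0 + 1) (- (w * RtoC eta))) <= 2 * exp (/ d) * exp (g * N)).
  { eapply Rle_trans; [apply (Cmod_hyp0F1_le _ d); [apply nu_ge_1|assumption]|].
    apply Rmult_le_compat_l; [lra|]. apply exp_le_compat.
    rewrite Cmod_opp, Cmod_mult, Cmod_R, (Rabs_right eta) by lra.
    apply Rle_trans with (d * ((beta + k) * N * eta)).
    - apply Rmult_le_compat_l; [lra|]. apply Rmult_le_compat_r; lra.
    - right. unfold d. field. split; lra. }
  assert (B3 : Cmod (/ (1 + w / RtoC beta / RtoC N)) = b).
  { assert (Nb : RtoC beta <> 0%C) by (apply RtoC_neq_0; lra).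
    assert (NN : RtoC N <> 0%C) by (apply RtoC_neq_0; lra).
    replace (1 + w / RtoC beta / RtoC N)%C with (RtoC (k / beta) * (cos a, sin a))%C.
    - assert (0 < k / beta) by (apply Rdiv_lt_0_compat; lra).
      assert (E : Cmod (RtoC (k / beta) * (cos a, sin a)) = k / beta).
      { rewrite Cmod_mult, Cmod_cos_sin, Cmod_R, Rabs_right by lra. ring. }
      rewrite Cmod_inv, E by (apply Cmod_gt_0; lra).
      unfold k, beta. field. lra.
    - rewrite Ha. unfold Rdiv. rewrite !RtoC_mult, RtoC_inv, RtoC_opp, RtoC_mult by lra.
      field. split; assumption. }
  rewrite B3.
  assert (B4 : exp (Re w) * exp (Re (w / RtoC beta)) <= exp (- beta * N)).
  { rewrite <- exp_plus. apply exp_le_compat.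
    replace (Re (w / RtoC beta)) with (Re w / beta) by (destruct w; simpl; field; lra).
    specialize (Hre w Hw).
    apply Rle_trans with ((1 + / beta) * - (k * beta * N)).
    - replace (Re w + Re w / beta) with ((1 + / beta) * Re w) by (field; lra).
      apply Rmult_le_compat_l; [|assumption]. assert (0 < / beta) by now apply Rinv_0_lt_compat. lra.
    - right. unfold k, beta. field. lra. }
  assert (B5 : b ^ n <= exp (ln b * N)).
  { apply Rle_trans with (b ^ (m + n)).
    - apply Rle_pow; [lra|lia].
    - right. rewrite <- Rpower_pow by lra. unfold Rpower, N. f_equal. ring. }
  unfold M.
  replace (exp (- g * N)) with (exp (g * N) * exp (- beta * N) * exp (ln b * N))
    by (rewrite <- !exp_plus; f_equal; unfold g; field).
  set (e1 := exp (Re w)) in *. set (e2 := exp (Re (w / RtoC beta))) in *.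
  set (h := Cmod (hyp0F1 _ _)) in *. set (ip := Cmod (invprod _ _)) in *.
  set (ck := Cmod (cauchy_kernel _ _)) in *.
  assert (P1 : 0 < e1) by apply exp_pos. assert (P2 : 0 < e2) by apply exp_pos.
  assert (P3 : 0 <= h) by apply Cmod_ge_0. assert (P4 : 0 <= ip) by apply Cmod_ge_0.
  assert (P5 : 0 <= ck) by apply Cmod_ge_0. assert (P6 : 0 < b ^ n) by (apply pow_lt; lra).
  replace (e1 * h * ip * (e2 * b ^ n) * ck) with ((e1 * e2) * h * ip * b ^ n * ck) by ring.
  replace (2 * exp (/ d) * (exp (g * N) * exp (- beta * N) * exp (ln b * N)) * / (k * beta * N))
    with (exp (- beta * N) * (2 * exp (/ d) * exp (g * N)) * 1 * exp (ln b * N) * / (k * beta * N)) by ring.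
  assert (Q1 : 0 <= e1 * e2) by (apply Rmult_le_pos; lra).
  apply Rmult_le_compat; [|assumption| |assumption].
  { repeat apply Rmult_le_pos; lra. }
  apply Rmult_le_compat; [|lra| |assumption].
  { repeat apply Rmult_le_pos; lra. }
  apply Rmult_le_compat; [|lra| |assumption].
  { repeat apply Rmult_le_pos; lra. }
  apply Rmult_le_compat; assumption.
Qed.

(** Write [D I - 1 = D (I - 1) + (D - 1)] for the damping [D] and the interest [I]. As
    [0 <= D <= 1], the first part is controlled by the complex estimate on the bounded path, and the
    second by the real one, which brings in the quadratic growth in [s]. *)
Lemma contour_transform_close nu0 m sigma beta eta p :
  0 < beta -> smooth p -> off_half_line p -> avoids p (spikes sigma m) ->
  exists K N1, 0 <= K /\ (0 < N1)%nat /\ forall n s, (N1 <= n)%nat -> 0 <= s ->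
    ~ on_path p (RtoC (- (beta * INR (m + n)))) ->
    Cmod (RtoC (damping beta m n s) * cauchy_transform p (density nu0 m n sigma beta eta) s
          - cauchy_transform p (limit_density nu0 m sigma eta) s)
    <= K * (1 + (s / beta) ^ 2 + s / beta * INR m) / INR n.
Proof.
  intros Hb Hp Ho Ha.
  destruct (cauchy_transform_bound p Hp Ho) as (L & HL & HLb).
  assert (CL := limit_density_path_cont nu0 m sigma eta p Hp Ha).
  destruct (path_bounded _ p CL) as (B & HB & HBb).
  destruct (path_bounded (fun w => w) p (path_cont_id p Hp)) as (W & HW & HWb).
  destruct (compound_interest_complex (W / beta) m) as (K & N1 & HK & HN1 & HKb).
  { apply Rlt_le, Rdiv_lt_0_compat; assumption. }
  exists (L * B * (K + 1)), N1. split; [|split; [assumption|]].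
  { repeat apply Rmult_le_pos; lra. }
  intros n s Hn Hs HaN.
  assert (Hn0 : 1 <= INR n) by (apply (le_INR 1); lia).
  assert (Hmn : (0 < m + n)%nat) by lia.
  assert (Ht : 0 <= s / beta) by (apply Rmult_le_pos; [assumption|left; now apply Rinv_0_lt_compat]).
  destruct (compound_interest_real m n (s / beta)) as [HD1 HD2]; [lia|assumption|].
  fold (damping beta m n s) in HD1, HD2.
  set (D := damping beta m n s) in *. set (t := s / beta) in *.
  assert (CDn := density_path_cont nu0 m n sigma beta eta p Hb Hmn Hp Ha HaN).
  assert (Ck := cauchy_kernel_path_cont p s Hp Ho Hs).
  assert (Hm := pos_INR m).
  assert (Hq : 0 <= t ^ 2 + t * INR m).
  { assert (0 <= t * INR m) by now apply Rmult_le_pos. assert (0 <= t ^ 2) by apply pow2_ge_0. lra. }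
  set (e := (K + (t ^ 2 + t * INR m)) / INR n).
  assert (He : 0 <= e) by (apply Rmult_le_pos; [lra|left; apply Rinv_0_lt_compat; lra]).
  replace (RtoC D * cauchy_transform p (density nu0 m n sigma beta eta) s
          - cauchy_transform p (limit_density nu0 m sigma eta) s)%C
    with (cauchy_transform p (fun w => limit_density nu0 m sigma eta w
                                        * (RtoC D * interest beta m n w - 1))%C s).
  - apply Rle_trans with (L * (B * e)).
    + apply HLb; [apply Rmult_le_pos; lra| |assumption|].
      * apply path_cont_mult; [assumption|]. apply path_cont_minus; [|apply path_cont_const].
        apply path_cont_mult; [apply path_cont_const|now apply interest_path_cont].
      * intros w Hw. rewrite Cmod_mult.
        apply Rmult_le_compat; try apply Cmod_ge_0; [auto|].
        assert (HX : Cmod (interest beta m n w - 1) <= K / INR n).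
        { apply HKb; [assumption|].
          rewrite Cmod_div, Cmod_R, Rabs_right by (try (apply RtoC_neq_0); lra).
          apply Rmult_le_compat_r; [left; now apply Rinv_0_lt_compat|auto]. }
        replace (RtoC D * interest beta m n w - 1)%C
          with (RtoC D * (interest beta m n w - 1) + RtoC (D - 1))%C
          by (rewrite RtoC_minus; ring).
        eapply Rle_trans; [apply Cmod_triangle|].
        rewrite Cmod_mult, !Cmod_R, (Rabs_right D), (Rabs_left1 (D - 1)) by lra.
        assert (C1 : D * Cmod (interest beta m n w - 1) <= K / INR n).
        { rewrite <- (Rmult_1_l (K / INR n)). apply Rmult_le_compat; try apply Cmod_ge_0; lra. }
        assert (C2 : (t ^ 2 + t * INR m) / INR (m + n) <= (t ^ 2 + t * INR m) / INR n).
        { apply Rmult_le_compat_l; [assumption|]. apply Rinv_le_contravar; [lra|].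
          rewrite plus_INR. lra. }
        unfold e. rewrite Rdiv_plus_distr. lra.
    + unfold e, Rdiv. rewrite <- !Rmult_assoc.
      apply Rmult_le_compat_r; [left; apply Rinv_0_lt_compat; lra|].
      rewrite !Rmult_assoc. apply Rmult_le_compat_l; [assumption|].
      apply Rmult_le_compat_l; [lra|]. nra.
  - unfold cauchy_transform.
    rewrite <- (contour_integral_scal (RtoC D)), <- contour_integral_minus; try assumption;
      try (apply path_cont_mult; [apply path_cont_const|]); try (now apply path_cont_mult).
    apply contour_integral_ext. intros w _. unfold density. ring.
Qed.

(** * Winding numbers and dilation of admissible contours *)

Lemma encircles_kernel p z : encircles p z ->
  ~ on_path p z /\ contour_integral (cauchy_kernel z) p = two_pi_i.
Proof.
  intros [H1 H2]. split; [assumption|]. unfold winding_number in H2.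
  change (contour_integral (cauchy_kernel z) p / two_pi_i = 1)%C in H2.
  transitivity (contour_integral (cauchy_kernel z) p / two_pi_i * two_pi_i)%C.
  - field. apply two_pi_i_neq_0.
  - rewrite H2. ring.
Qed.

Lemma leaves_outside_kernel p z : leaves_outside p z ->
  ~ on_path p z /\ contour_integral (cauchy_kernel z) p = 0%C.
Proof.
  intros [H1 H2]. split; [assumption|]. unfold winding_number in H2.
  change (contour_integral (cauchy_kernel z) p / two_pi_i = 0)%C in H2.
  transitivity (contour_integral (cauchy_kernel z) p / two_pi_i * two_pi_i)%C.
  - field. apply two_pi_i_neq_0.
  - rewrite H2. ring.
Qed.

Lemma kernel_scale k p z : k <> 0 -> ~ on_path p z ->
  ~ on_path (scale_path k p) (RtoC k * z)%C /\
  contour_integral (cauchy_kernel (RtoC k * z)) (scale_path k p) = contour_integral (cauchy_kernel z) p.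
Proof.
  intros Hk Hz. assert (N := RtoC_neq_0 k Hk). split.
  - intros H. destruct (on_path_scale _ _ _ H) as (w & Hw & E). apply Hz.
    replace z with w; [assumption|].
    transitivity (/ RtoC k * (RtoC k * w))%C; [field; assumption|]. rewrite <- E. field. assumption.
  - rewrite contour_integral_scale. apply contour_integral_ext. intros v Hv.
    unfold cauchy_kernel.
    assert (Nv : (v - z)%C <> 0%C) by (now apply (avoids_neq p)).
    replace (RtoC k * v - RtoC k * z)%C with (RtoC k * (v - z))%C by ring.
    field. split; assumption.
Qed.

Lemma contour_around_scale k n a p : 0 < k -> contour_around n a p ->
  contour_around n (fun l => k * a l) (scale_path k p).
Proof.
  intros Hk (Hc & He & Ho). split; [now apply closed_contour_scale|]. split.
  - intros l Hl. destruct (He l Hl) as [H1 H2].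
    destruct (kernel_scale k p (RtoC (- a l))) as [S1 S2]; [lra|assumption|].
    rewrite <- RtoC_mult in S1, S2. replace (k * - a l) with (- (k * a l)) in S1, S2 by ring.
    split; [assumption|]. unfold winding_number in *.
    change (contour_integral (cauchy_kernel (RtoC (- (k * a l)))) (scale_path k p) / two_pi_i = 1)%C.
    rewrite S2. exact H2.
  - intros u Hu. destruct (Ho (/ k * u)) as [H1 H2].
    { apply Rmult_le_pos; [left; now apply Rinv_0_lt_compat|assumption]. }
    destruct (kernel_scale k p (RtoC (/ k * u))) as [S1 S2]; [lra|assumption|].
    rewrite <- RtoC_mult in S1, S2. replace (k * (/ k * u)) with u in S1, S2 by (field; lra).
    split; [assumption|]. unfold winding_number in *.
    change (contour_integral (cauchy_kernel (RtoC u)) (scale_path k p) / two_pi_i = 0)%C.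
    rewrite S2. exact H2.
Qed.

Lemma contour_around_avoids m a p : contour_around m a p -> avoids p (spikes a m).
Proof.
  intros (_ & He & _) z Hz. destruct (in_spikes _ _ _ Hz) as (j & Hj & ->). apply (He j Hj).
Qed.

Lemma contour_around_off n a p : contour_around n a p -> off_half_line p.
Proof. intros (_ & _ & Ho) u Hu. apply (Ho u Hu). Qed.

Lemma contour_around_smooth n a p : contour_around n a p -> smooth p.
Proof. intros (H & _ & _). now apply closed_smooth. Qed.

Lemma scaled_spike b sigma m n l : 1 < b ->
  (1 - 1 / b) * spiked m b sigma (m + n) l =
  if Nat.leb l m then sigma l else (b - 1) * INR (m + n).
Proof. intros Hb. unfold spiked. destruct (Nat.leb l m); field; lra. Qed.

(** Winding numbers about the poles, for the dilated [q], for [p] and for the circle: 0, 0, 0 at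
    [s]; 1, 0, 1 at the far pole; 1, 1, 0 at the spikes. The zeros for [p] at the far pole and for
    the circle come from vertical separation: [k beta N > W + S] puts the circle to the left of [p]
    and of the spikes, and the far pole to the left of [p]. *)
Lemma transform_split nu0 m sigma b eta p :
  1 < b -> contour_around m sigma p ->
  exists N1, forall n q s, (N1 <= n)%nat -> 0 <= s ->
    contour_around (m + n) (spiked m b sigma (m + n)) q ->
    ~ on_path p (RtoC (- ((b - 1) * INR (m + n)))) /\
    avoids (scale_path (1 - 1 / b) q) (spikes sigma m) /\
    ~ on_path (scale_path (1 - 1 / b) q) (RtoC (- ((b - 1) * INR (m + n)))) /\
    cauchy_transform (scale_path (1 - 1 / b) q) (density nu0 m n sigma (b - 1) eta) s =
    (cauchy_transform p (density nu0 m n sigma (b - 1) eta) s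
     + cauchy_transform (circle (- ((b - 1) * INR (m + n))) ((1 - 1 / b) * INR (m + n)))
         (density nu0 m n sigma (b - 1) eta) s)%C.
Proof.
  intros Hb Hp.
  assert (Hps := contour_around_smooth _ _ _ Hp).
  destruct (path_bounded (fun w => w) p (path_cont_id p Hps)) as (W & HW & HWb).
  destruct (finite_upper_bound sigma m) as (S & HS & HSb).
  set (k := 1 - 1 / b). set (beta := b - 1).
  assert (Hib : 0 < / b < 1).
  { split; [apply Rinv_0_lt_compat; lra|]. rewrite <- Rinv_1; apply Rinv_lt_contravar; lra. }
  assert (Hk : 0 < k < 1) by (unfold k, Rdiv; lra).
  assert (Hbe : 0 < beta) by (unfold beta; lra).
  assert (Ekb : beta - k = k * beta) by (unfold k, beta; field; lra).
  assert (Hkb : 0 < k * beta) by (apply Rmult_lt_0_compat; lra).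
  destruct (INR_unbounded ((W + S) / (k * beta))) as [N1 HN1].
  exists (Datatypes.S N1). intros n q s Hn Hs Hq.
  set (N := INR (m + n)).
  assert (HN : INR N1 <= N) by (apply le_INR; lia).
  assert (HN0 : 1 <= N) by (apply (le_INR 1); lia).
  assert (HNS : W + S < k * beta * N).
  { apply Rlt_le_trans with (k * beta * INR N1); [|apply Rmult_le_compat_l; lra].
    apply (Rmult_lt_compat_l (k * beta)) in HN1; [|assumption].
    replace (k * beta * ((W + S) / (k * beta))) with (W + S) in HN1 by (field; lra). lra. }
  assert (HkN : 0 < k * N) by (apply Rmult_lt_0_compat; lra).
  assert (HbN : k * beta * N = beta * N - k * N) by (rewrite <- Ekb; ring).
  set (c := RtoC (- (beta * N))). set (r := circle (- (beta * N)) (k * N)).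
  assert (Hr : closed_contour r) by apply circle_closed.
  assert (Hre : forall w, on_path r w -> Re w <= - (k * beta * N)).
  { intros w Hw. apply on_circle_re in Hw; lra. }
  assert (Hpre : forall w, on_path p w -> Re c < Re w).
  { intros w Hw. assert (A := HWb w Hw). assert (B := re_le_Cmod w). simpl.
    assert (D := Rle_abs (- Re w)). rewrite Rabs_Ropp in D. lra. }
  assert (Hpc : ~ on_path p c) by (intros H; specialize (Hpre c H); lra).
  assert (Hq' := contour_around_scale k _ _ q (proj1 Hk) Hq).
  set (q' := scale_path k q) in *.
  assert (Wspike : forall z, In z (spikes sigma m) ->
     ~ on_path q' z /\ contour_integral (cauchy_kernel z) q' = two_pi_i).
  { intros z Hz. destruct (in_spikes _ _ _ Hz) as (j & Hj & ->).
    assert (E := proj1 (proj2 Hq') j ltac:(lia)). cbv beta in E.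
    unfold k in E. rewrite scaled_spike in E by assumption.
    rewrite (proj2 (Nat.leb_le j m)) in E by lia. now apply encircles_kernel. }
  assert (Wc : ~ on_path q' c /\ contour_integral (cauchy_kernel c) q' = two_pi_i).
  (* The index [m + n] exceeds [m] because [n >= 1], so its parameter is not a spike. *)
  { assert (E := proj1 (proj2 Hq') (m + n)%nat ltac:(lia)). cbv beta in E.
    unfold k in E. rewrite scaled_spike in E by assumption.
    rewrite (proj2 (Nat.leb_gt (m + n) m)) in E by lia. now apply encircles_kernel. }
  assert (Ws : ~ on_path q' (RtoC s) /\ contour_integral (cauchy_kernel (RtoC s)) q' = 0%C).
  { apply leaves_outside_kernel, (proj2 (proj2 Hq') s Hs). }
  assert (Vspike : forall z, In z (spikes sigma m) ->
     ~ on_path p z /\ contour_integral (cauchy_kernel z) p = two_pi_i).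
  { intros z Hz. destruct (in_spikes _ _ _ Hz) as (j & Hj & ->).
    apply encircles_kernel, (proj1 (proj2 Hp) j Hj). }
  assert (Vs : ~ on_path p (RtoC s) /\ contour_integral (cauchy_kernel (RtoC s)) p = 0%C).
  { apply leaves_outside_kernel, (proj2 (proj2 Hp) s Hs). }
  assert (Vc : contour_integral (cauchy_kernel c) p = 0%C).
  { apply contour_integral_kernel_half_plane; [apply Hp|]. intros w Hw. specialize (Hpre w Hw). lra. }
  assert (Rright : forall z, - S <= Re z ->
     ~ on_path r z /\ contour_integral (cauchy_kernel z) r = 0%C).
  { intros z Hz. split.
    - intros H. specialize (Hre z H). lra.
    - apply contour_integral_kernel_half_plane; [assumption|]. intros w Hw. specialize (Hre w Hw). lra. }
  assert (Rspike : forall z, In z (spikes sigma m) -> - S <= Re z).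
  { intros z Hz. destruct (in_spikes _ _ _ Hz) as (j & Hj & ->). simpl. specialize (HSb j Hj). lra. }
  assert (Rc : ~ on_path r c).
  { intros H. destruct (on_circle _ _ _ H) as [a Ha].
    assert (E : (RtoC (k * N) * (cos a, sin a))%C = 0%C).
    { replace (RtoC (k * N) * (cos a, sin a))%C with ((c + RtoC (k * N) * (cos a, sin a)) - c)%C by ring.
      unfold c at 1. rewrite <- Ha. ring. }
    apply (f_equal Cmod) in E. rewrite Cmod_mult, Cmod_cos_sin, Cmod_R, Cmod_0, Rabs_right in E by lra.
    lra. }
  split; [exact Hpc|]. split; [intros z Hz; now apply Wspike|]. split; [apply Wc|].
  apply density_decompose; try assumption; try lia; try (now apply Hp); try (now apply Hq').
  - intros z [<-|[<-|Hz]]; [apply Ws|apply Wc|now apply Wspike].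
  - intros z [<-|[<-|Hz]]; [apply Vs|apply Hpc|now apply Vspike].
  - intros z [<-|[<-|Hz]]; [apply Rright; simpl; lra|apply Rc|apply Rright; now apply Rspike].
  - intros z [<-|[<-|Hz]].
    + rewrite (proj2 Ws), (proj2 Vs), (proj2 (Rright (RtoC s) ltac:(simpl; lra))). ring.
    + fold N c r. rewrite (proj2 Wc), Vc. unfold r, c. rewrite circle_winding by assumption. ring.
    + rewrite (proj2 (Wspike z Hz)), (proj2 (Vspike z Hz)), (proj2 (Rright z (Rspike z Hz))). ring.
Qed.

(** * Integration in [s] and the limit *)

Lemma clamped_integrable (f h : R -> C) T :
  0 <= T -> (forall t, Ccont h t) -> (forall s, 0 <= s -> h s = f s) -> exists l, is_CInt f 0 T l.
Proof.
  intros HT Hc H. destruct (ex_CInt_cont h 0 T) as [l Hl]; [intros; apply Hc|].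
  exists l. eapply is_CInt_ext; [|exact Hl].
  rewrite Rmin_left, Rmax_right by lra. intros x Hx. apply H. lra.
Qed.

(** Half of [exp (- s)] pays for the growth of [g]; the other half keeps the majorant integrable. *)
Lemma subexp_exp_decay g : subexp g ->
  exists A, 0 <= A /\ forall s, 0 <= s -> exp (- s) * Rabs (g s) <= A * exp (- / 2 * s).
Proof.
  intros Hg. destruct (Hg (/ 2)) as (A & HA & HAb); [lra|].
  exists A; split; [assumption|]. intros s Hs.
  apply Rle_trans with (exp (- s) * (A * exp (/ 2 * s))).
  - apply Rmult_le_compat_l; [left; apply exp_pos|auto].
  - right. rewrite (Rmult_comm A), <- Rmult_assoc, <- exp_plus, Rmult_comm. do 2 f_equal. field.
Qed.

(** Weakens the exponentially small error of the circle to order [1 / N], so that it shares a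
    majorant with the error on the limit contour. *)
Lemma exp_neg_le_inv g x : 0 < g -> 0 < x -> exp (- g * x) <= / g * / x.
Proof.
  intros Hg Hx. rewrite <- Rinv_mult. replace (- g * x) with (- (g * x)) by ring. rewrite exp_Ropp.
  apply Rinv_le_contravar; [now apply Rmult_lt_0_compat|].
  assert (H := exp_ineq1_le (g * x)). lra.
Qed.

Theorem theorem3p2 :
  forall (nu0 m : nat) (b : R) (sigma : nat -> R)
         (contourN : nat -> path) (contour : path) (xi eta : R),
    (1 <= m)%nat ->
    1 < b ->
    (forall j, (1 <= j <= m)%nat -> 0 < sigma j) ->
    (forall N, (m <= N)%nat ->
       contour_around N (spiked m b sigma N) (contourN N)) ->
    contour_around m sigma contour ->
    0 < xi ->
    0 < eta ->
    filterlim
      (fun N : nat =>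
         (RtoC (exp ((1 - 1 / b) * (eta - xi)) * (1 - 1 / b))
          * kernel nu0 N (spiked m b sigma N) (contourN N)
                   ((1 - 1 / b) * xi) ((1 - 1 / b) * eta))%C)
      eventually
      (@locally C_UniformSpace
         (/ two_pi_i * RtoC (eta ^ nu0 / Gamma (INR nu0 + 1) ^ 2)
          * integral_0_oo (fun u =>
              contour_integral (fun v =>
                hyp0F1 (INR nu0 + 1) (- (RtoC u * RtoC xi))
                * hyp0F1 (INR nu0 + 1) (- (v * RtoC eta))
                * RtoC u ^ nu0
                * (Cexp (- RtoC u + v) / (RtoC u - v))
                * Cprod (fun j => (RtoC u + RtoC (sigma j))
                                  / (v + RtoC (sigma j))) m)
              contour))%C).
Proof.
  intros nu0 m b sigma contourN contour xi eta Hm Hb Hsig HcN Hc Hxi Heta.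
  set (k := 1 - 1 / b). set (beta := b - 1).
  assert (Hk : 0 < k).
  { assert (/ b < 1) by (rewrite <- Rinv_1; apply Rinv_lt_contravar; lra). unfold k, Rdiv; lra. }
  assert (Nk : RtoC k <> 0%C) by (apply RtoC_neq_0; lra).
  assert (Hbe : 0 < beta) by (unfold beta; lra).
  assert (Hps := contour_around_smooth _ _ _ Hc).
  assert (Hpo := contour_around_off _ _ _ Hc).
  assert (Hpa := contour_around_avoids _ _ _ Hc).
  set (pf := prefactor nu0 m sigma xi).
  set (lim := fun s => cauchy_transform contour (limit_density nu0 m sigma eta) s).
  set (J := fun s => (RtoC (exp (- s)) * pf s * lim s)%C).
  assert (CL := limit_density_path_cont nu0 m sigma eta contour Hps Hpa).
  assert (Cexpneg : forall t, Ccont (fun s => RtoC (exp (- s))) t).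
  { intros t. apply Ccont_RtoC. apply (@ex_derive_continuous R_AbsRing R_NormedModule).
    auto_derive. exact I. }
  (* The limit integral converges: [exp (- s)] dominates the subexponential prefactor, and the
     transform is bounded by [L B] uniformly in [s]. *)
  assert (HJ : exists l, is_improper J l).
  { destruct (cauchy_transform_bound contour Hps Hpo) as (L & HL & HLb).
    destruct (path_bounded _ _ CL) as (B & HB & HBb).
    destruct (subexp_exp_decay (fun s => Cmod (pf s) * (L * B))) as (A & HA & HAb).
    { apply subexp_mult; [apply prefactor_subexp|apply subexp_const]. }
    destruct (exp_dominated_improper J A (/ 2)) as (l & Hl & _); [lra| | |now exists l].
    - intros T HT. apply (clamped_integrable _
        (fun s => RtoC (exp (- s)) * pf s * lim (Rmax s 0))%C T HT).
      + intros t. apply Ccont_mult; [apply Ccont_mult; [apply Cexpneg|apply prefactor_cont]|].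
        now apply cauchy_transform_cont.
      + intros s Hs. rewrite Rmax_left by lra. reflexivity.
    - intros s Hs. eapply Rle_trans; [|now apply HAb]. unfold J.
      rewrite !Cmod_mult, Cmod_R, Rabs_right by (left; apply exp_pos).
      rewrite Rmult_assoc. apply Rmult_le_compat_l; [left; apply exp_pos|].
      eapply Rle_trans; [|apply Rle_abs]. apply Rmult_le_compat_l; [apply Cmod_ge_0|].
      apply HLb; auto. lra. }
  destruct HJ as [l Hl].
  replace (integral_0_oo _) with l.
  2: { symmetry. apply is_improper_integral_0_oo. apply (is_improper_ext J); [|exact Hl].
       intros u Hu. unfold J, pf, lim. symmetry. now apply limit_integrand. }
  destruct (transform_split nu0 m sigma b eta contour Hb Hc) as (N1 & HN1).
  destruct (contour_transform_close nu0 m sigma beta eta contour Hbe Hps Hpo Hpa)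
    as (K2 & N2 & HK2 & HN2 & HK2b).
  destruct (circle_transform_small nu0 m sigma b eta Hb Heta) as (K3 & g & N3 & HK3 & Hg & HN3 & HK3b).
  (* The majorant, up to [exp (- s) / n]: its bracket collects the error on the limit contour and
     that on the circle. *)
  set (G := fun s => Cmod (pf s) * (K2 * (1 + s / beta * (s / beta) + s / beta * INR m) + K3 * / g)).
  destruct (subexp_exp_decay G) as (A & HA & HAb).
  { assert (St : subexp (fun s => s / beta)).
    { apply (subexp_mult (fun s => s) (fun _ => / beta)); [apply subexp_id|apply subexp_const]. }
    apply subexp_mult; [apply prefactor_subexp|]. apply subexp_plus; [|apply subexp_const].
    apply subexp_mult; [apply subexp_const|].
    apply subexp_plus; [apply subexp_plus; [apply subexp_const|now apply subexp_mult]|].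
    apply subexp_mult; [exact St|apply subexp_const]. }
  set (c0 := RtoC (eta ^ nu0 / Gamma (INR nu0 + 1) ^ 2)).
  (* With [N = m + n], the normalised kernel is the limit expression with [l] replaced by [l + d],
     where [d] is the integral of the pointwise error [E]. *)
  assert (Main : forall n, (N1 + N2 + N3 <= n)%nat -> exists d, Cmod d <= 2 * A / INR n /\
     (RtoC (exp (k * (eta - xi)) * k)
          * kernel nu0 (m + n) (spiked m b sigma (m + n)) (contourN (m + n)%nat) (k * xi) (k * eta))%C
     = (/ two_pi_i * c0 * (l + d))%C).
  { intros n Hn.
    assert (Hn1 : 1 <= INR n) by (apply (le_INR 1); lia).
    set (q := contourN (m + n)%nat).
    assert (Hq : contour_around (m + n) (spiked m b sigma (m + n)) q) by (apply HcN; lia).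
    assert (Hq' := contour_around_scale k _ _ q Hk Hq).
    assert (Hqs := contour_around_smooth _ _ _ Hq').
    assert (Hqo := contour_around_off _ _ _ Hq').
    (* The avoidance statements do not involve [s], so they may be read off at [s = 0]. *)
    destruct (HN1 n q 0) as (Hpc & Hqa & Hqc & _); [lia|lra|assumption|].
    assert (Hsplit : forall s, 0 <= s -> _ = _)
      by (intros s Hs; exact (proj2 (proj2 (proj2 (HN1 n q s ltac:(lia) Hs Hq))))).
    cbv beta in Hsplit. fold k beta in Hsplit, Hpc, Hqa, Hqc.
    set (D := density nu0 m n sigma beta eta) in *.
    set (q' := scale_path k q) in *.
    set (JN := fun s => (RtoC (exp (- s) * damping beta m n s) * pf s * cauchy_transform q' D s)%C).
    set (E := fun s => (RtoC (exp (- s)) * pf s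
                 * (RtoC (damping beta m n s) * cauchy_transform q' D s - lim s))%C).
    destruct (exp_dominated_improper E (A / INR n) (/ 2)) as (d & Hd & Hdb); [lra| | |].
    - intros T HT. apply (clamped_integrable _ (fun s => RtoC (exp (- s)) * pf s
         * (RtoC (damping beta m n s) * cauchy_transform q' D (Rmax s 0) - lim (Rmax s 0)))%C T HT).
      + intros t. apply Ccont_mult; [apply Ccont_mult; [apply Cexpneg|apply prefactor_cont]|].
        apply Ccont_minus; [|now apply cauchy_transform_cont]. apply Ccont_mult.
        * apply Ccont_RtoC. apply (@ex_derive_continuous R_AbsRing R_NormedModule).
          unfold damping. auto_derive. exact I.
        * apply cauchy_transform_cont; try assumption. apply density_path_cont; try assumption. lia.
      + intros s Hs. rewrite Rmax_left by lra. reflexivity.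
    - intros s Hs.
      apply Rle_trans with (/ INR n * (exp (- s) * Rabs (G s))).
      + unfold E. rewrite !Cmod_mult, Cmod_R, Rabs_right by (left; apply exp_pos).
        rewrite (Rmult_comm (/ INR n)), !Rmult_assoc.
        apply Rmult_le_compat_l; [left; apply exp_pos|].
        rewrite <- (Rabs_right (/ INR n)) by (left; apply Rinv_0_lt_compat; lra).
        rewrite <- Rabs_mult. eapply Rle_trans; [|apply Rle_abs].
        unfold G. rewrite Rmult_assoc. apply Rmult_le_compat_l; [apply Cmod_ge_0|].
        rewrite (Hsplit s Hs).
        assert (HN : INR n <= INR (m + n)) by (apply le_INR; lia).
        assert (T1 := HK2b n s ltac:(lia) Hs Hpc). fold D in T1.
        assert (T2 := HK3b n s ltac:(lia) Hs). fold k beta D in T2.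
        destruct (compound_interest_real m n (s / beta)) as [HD1 _]; [lia| |].
        { apply Rmult_le_pos; [assumption|left; now apply Rinv_0_lt_compat]. }
        fold (damping beta m n s) in HD1.
        set (cr := cauchy_transform (circle _ _) D s) in *.
        set (dm := damping beta m n s) in *.
        fold lim in T1. set (cp := cauchy_transform contour D s) in *.
        change (cauchy_transform contour (limit_density nu0 m sigma eta) s) with (lim s) in T1.
        replace (RtoC dm * (cp + cr) - lim s)%C with ((RtoC dm * cp - lim s) + RtoC dm * cr)%C by ring.
        eapply Rle_trans; [apply Cmod_triangle|].
        rewrite Cmod_mult, Cmod_R, (Rabs_right dm) by lra.
        assert (T3 : dm * Cmod cr <= K3 * / g * / INR n).
        { rewrite <- (Rmult_1_l (K3 * / g * / INR n)).
          apply Rmult_le_compat; [lra|apply Cmod_ge_0|lra|].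
          eapply Rle_trans; [exact T2|]. rewrite Rmult_assoc. apply Rmult_le_compat_l; [assumption|].
          eapply Rle_trans; [apply exp_neg_le_inv; lra|].
          apply Rmult_le_compat_l; [left; now apply Rinv_0_lt_compat|]. apply Rinv_le_contravar; lra. }
        replace ((s / beta) ^ 2) with (s / beta * (s / beta)) in T1 by ring.
        rewrite Rmult_plus_distr_r. apply Rplus_le_compat; assumption.
      + unfold Rdiv. rewrite (Rmult_comm A), Rmult_assoc.
        apply Rmult_le_compat_l; [left; apply Rinv_0_lt_compat; lra|auto].
    - exists d. split.
      (* The decay rate [1 / 2] is what doubles [A]. *)
      { eapply Rle_trans; [exact Hdb|]. right. field. lra. }
      assert (HJN : is_improper JN (l + d)%C).
      { apply (is_improper_ext (fun s => J s + E s)%C); [|now apply is_improper_plus].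
        intros s _. unfold J, E, JN. rewrite RtoC_mult. ring. }
      unfold kernel.
      rewrite (is_improper_integral_0_oo _ (RtoC (exp (k * (xi - eta))) * c0 * (/ RtoC k * (l + d)))%C).
      (* The normalisation [exp (k (eta - xi)) k] cancels the exponentials of [Psi] and [Phi] and
         the Jacobian of [s = k u]. *)
      + replace (k * (xi - eta)) with (- (k * (eta - xi))) by ring.
        rewrite exp_Ropp, RtoC_mult, RtoC_inv by (apply Rgt_not_eq, exp_pos).
        field. repeat split; [apply two_pi_i_neq_0|assumption|].
        apply RtoC_neq_0, Rgt_not_eq, exp_pos.
      + apply (is_improper_ext (fun u => RtoC (exp (k * (xi - eta))) * c0 * JN (k * u)%R)%C).
        * intros u Hu. symmetry. unfold c0. rewrite <- RtoC_mult.
          apply kernel_integrand; try assumption. lia.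
        * apply is_improper_scal. now apply is_improper_comp_scale. }
  apply filterlim_locally. intros eps.
  set (Q := Cmod (/ two_pi_i * c0)).
  assert (HQ : 0 <= Q) by apply Cmod_ge_0.
  destruct (INR_unbounded (Q * (2 * A) / eps)) as [N4 HN4].
  assert (He := cond_pos eps).
  exists (m + (N1 + N2 + N3 + N4))%nat. intros N HN.
  replace N with (m + (N - m))%nat by lia.
  destruct (Main (N - m)%nat ltac:(lia)) as (d & Hd & EN).
  assert (HN' : INR N4 <= INR (N - m)) by (apply le_INR; lia).
  assert (Hn1 : 1 <= INR (N - m)) by (apply (le_INR 1); lia).
  (* Balls of [C_UniformSpace] are componentwise; a bound on the modulus suffices. *)
  apply C_NormedModule_mixin_compat1.
  fold k. rewrite EN. fold c0.
  replace (minus (/ two_pi_i * c0 * (l + d))%C (/ two_pi_i * c0 * l)%C) with (/ two_pi_i * c0 * d)%C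
    by (change (/ two_pi_i * c0 * d = / two_pi_i * c0 * (l + d) - / two_pi_i * c0 * l)%C; ring).
  rewrite Cmod_mult. fold Q.
  apply Rle_lt_trans with (Q * (2 * A / INR (N - m))); [now apply Rmult_le_compat_l|].
  apply (Rmult_lt_reg_r (INR (N - m))); [lra|].
  replace (Q * (2 * A / INR (N - m)) * INR (N - m)) with (Q * (2 * A)) by (field; lra).
  apply (Rmult_lt_compat_l eps) in HN4; [|assumption].
  replace (eps * (Q * (2 * A) / eps)) with (Q * (2 * A)) in HN4 by (field; lra).
  eapply Rlt_le_trans; [exact HN4|]. apply Rmult_le_compat_l; lra.
Qed.
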